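(* Let $\Phi$ be a classical root system of rank $\ell\geqslant 2$, let $R$ be an arbitrary commutative ring and $I$ an ideal of $R$ satisfying one of the following assumptions: - $\Phi=\mathsf{A}_\ell$, $\ell\geqslant2$, and $\mathrm{sr}(I)\leqslant\ell$; - $\Phi=\mathsf{C}_\ell$, $\ell\geqslant2$, and $\mathrm{sr}(I)\leqslant 2\ell-1$; - $\Phi=\mathsf{B}_\ell$ or $\mathsf{D}_\ell$, $\ell\geqslant3$, and $\mathrm{asr}(I)\leqslant\ell-1$. Then the principal congruence subgroup $\mathrm{G}(\Phi,R,I)$ admits the decomposition $$\mathrm{G}(\Phi,R,I)=\mathrm{U}(\Phi^+,I)\cdot\mathrm{U}(\Phi^-,I)\cdot Z\cdot\mathrm{U}(\Sigma_1^-\setminus\{-\alpha_{\max}\},I)\cdot\mathrm{U}(\Sigma_1^+,I)\cdot\mathrm{G}(\Delta_1,R,I),$$ where $Z=\{z_{-\alpha_{\max}}(r,1)\mid r\in I\}$.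
   Context: Root systems are reduced and irreducible, with simple roots $\alpha_1,\ldots,\alpha_\ell$ in Bourbaki numbering; $\Phi^\pm$ are the positive/negative roots, $\alpha_{\max}$ is the highest root, $m_1(\alpha)$ is the coefficient of $\alpha_1$ in $\alpha$; $\Delta_1=\{\alpha: m_1(\alpha)=0\}$, $\Sigma_1^+=\{\alpha:m_1(\alpha)>0\}$, $\Sigma_1^-=-\Sigma_1^+$. $\mathrm{G}(\Phi,R)$ is the simply connected Chevalley group with elementary root unipotents $x_\alpha(\xi)$; $\mathrm{G}(\Phi,R,I)=\ker(\mathrm{G}(\Phi,R)\to\mathrm{G}(\Phi,R/I))$. $\mathrm{G}(\Delta_1,R)\leqslant\mathrm{G}(\Phi,R)$ is the simply connected Chevalley group of the subsystem $\Delta_1$ embedded as subsystem subgroup, and $\mathrm{G}(\Delta_1,R,I)$ its principal congruence subgroup of level $I$. For a set of roots $\Sigma$, $\mathrm{U}(\Sigma,I)$ is the subgroup generated by $x_\alpha(s)$, $\alpha\in\Sigma$, $s\in I$. For $s\in I,\xi\in R$: $z_\alpha(s,\xi)=x_{-\alpha}(-\xi)x_\alpha(s)x_{-\alpha}(\xi)$. A row in $R^n$ is $I$-unimodular if it is congruent to $(1,0,\ldots,0)$ modulo $I$ and its components generate $R$ as an ideal. $\mathrm{SR}_n(I)$: for every $I$-unimodular row $(a_1,\ldots,a_{n+1})$ there are $b_1,\ldots,b_n\in I$ with $(a_1+a_{n+1}b_1,\ldots,a_n+a_{n+1}b_n)$ $I$-unimodular. $\mathrm{sr}(I)$ is the smallest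 natural $n\geqslant1$ with $\mathrm{SR}_n(I)$ ($\infty$ if none). For a row $a$, $\mathfrak{J}(a)$ is the intersection of all maximal ideals of $R$ containing all components of $a$ ($R$ if there are none). $\mathrm{ASR}_n(I)$: $\mathrm{SR}_n(I)$ holds and for every $(a_1,\ldots,a_{n+1})\in I^{n+1}$ there are $c_1,\ldots,c_n\in I$ with $\mathfrak{J}(a_1,\ldots,a_{n+1})=\mathfrak{J}(a_1+c_1a_{n+1},\ldots,a_n+c_na_{n+1})$. $\mathrm{asr}(I)$ is the smallest natural $n$ with $\mathrm{ASR}_n(I)$ ($\infty$ if none). *)

(* Defs.v *)
From HB Require Import structures.
From mathcomp Require Export all_boot all_order all_algebra.
From mathcomp Require Export classical_sets.

Set Implicit Arguments.
Unset Strict Implicit.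
Unset Printing Implicit Defensive.

Export GRing.Theory.

Local Open Scope ring_scope.
Local Open Scope classical_set_scope.

Variant classical_type := TypeA | TypeB | TypeC | TypeD.

Definition coord_dim (X : classical_type) (l : nat) : nat :=
  if X is TypeA then l.+1 else l.

(* Roots are given in Bourbaki's coordinates. Indices start at 0: [evec n k] is
   Bourbaki's epsilon_(k+1). *)
Definition evec (n k : nat) : 'rV[int]_n := \row_(j < n) ((j : nat) == k)%:R.

Definition A_roots n : set 'rV[int]_n :=
  [set a | exists i j : 'I_n, i != j /\ a = evec n i - evec n j].

Definition D_roots n : set 'rV[int]_n :=
  [set a | exists (i j : 'I_n) (s t : bool),
     i != j /\ a = (-1) ^+ s *: evec n i + (-1) ^+ t *: evec n j].

Definition short_axis_roots n : set 'rV[int]_n :=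
  [set a | exists (i : 'I_n) (s : bool), a = (-1) ^+ s *: evec n i].

Definition long_axis_roots n : set 'rV[int]_n :=
  [set a | exists (i : 'I_n) (s : bool), a = (-1) ^+ s *: (evec n i *+ 2)].

Definition root_system (X : classical_type) (l : nat)
    : set 'rV[int]_(coord_dim X l) :=
  match X with
  | TypeA => @A_roots _
  | TypeB => @D_roots _ `|` @short_axis_roots _
  | TypeC => @D_roots _ `|` @long_axis_roots _
  | TypeD => @D_roots _
  end.

(* [simple_root X l i] is alpha_(i+1) in Bourbaki's numbering. *)
Definition simple_root (X : classical_type) (l : nat) (i : 'I_l)
    : 'rV[int]_(coord_dim X l) :=
  let e := evec (coord_dim X l) in
  match X with
  | TypeA => e i - e i.+1
  | TypeB => if i.+1 == l then e i else e i - e i.+1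
  | TypeC => if i.+1 == l then e i *+ 2 else e i - e i.+1
  | TypeD => if i.+1 == l then e i.-1 + e i else e i - e i.+1
  end.

Arguments root_system : clear implicits.
Arguments simple_root : clear implicits.

Section RootSystem.
Variables (X : classical_type) (l : nat).
Local Notation root := 'rV[int]_(coord_dim X l).
Local Notation Phi := (root_system X l).

Definition simple_expansion (a : root) (m : 'I_l -> int) : Prop :=
  a = \sum_(i < l) m i *: simple_root X l i.

Definition nonneg_combination (a : root) : Prop :=
  exists2 m : 'I_l -> int, simple_expansion a m & forall i, 0 <= m i.

Definition positive_roots : set root := [set a | Phi a /\ nonneg_combination a].
Definition negative_roots : set root := [set a | positive_roots (- a)].

Definition highest_root (amax : root) : Prop :=
  Phi amax /\ forall b, Phi b -> nonneg_combination (amax - b).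

(* The relation m_1(a) = k. *)
Definition m1_eq (a : root) (k : int) : Prop :=
  exists2 m : 'I_l -> int, simple_expansion a m &
    forall i : 'I_l, i = 0%N :> nat -> m i = k.

Definition Delta1 : set root := [set a | Phi a /\ m1_eq a 0].
Definition Sigma1_pos : set root :=
  [set a | Phi a /\ exists2 k, m1_eq a k & 0 < k].
Definition Sigma1_neg : set root := [set a | Sigma1_pos (- a)].

(* The coordinates occurring in the roots of D.  [Delta1] consists of all the
   roots of [Phi] that involve only the coordinates in [coord_support Delta1]
   (all coordinates but the first one). *)
Definition coord_support (D : set root) : set 'I_(coord_dim X l) :=
  [set i | exists2 a, D a & a 0 i != 0].

End RootSystem.

Arguments positive_roots : clear implicits.
Arguments negative_roots : clear implicits.
Arguments Delta1 : clear implicits.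
Arguments Sigma1_pos : clear implicits.
Arguments Sigma1_neg : clear implicits.

Section Stability.
Variable R : comPzRingType.
Implicit Types I M : set R.

Definition is_ideal I : Prop :=
  [/\ I 0, (forall x y, I x -> I y -> I (x + y)) &
      (forall a x, I x -> I (a * x))].

Definition is_maximal_ideal M : Prop :=
  [/\ is_ideal M, M != setT &
      forall J : set R, is_ideal J -> M `<=` J -> J = M \/ J = setT].

Definition generated_ideal n (a : 'rV[R]_n) : set R :=
  [set x | exists b : 'rV[R]_n, x = \sum_(i < n) b 0 i * a 0 i].

Definition unimodular_row I n (a : 'rV[R]_n) : Prop :=
  (forall i : 'I_n, I (a 0 i - ((i : nat) == 0%N)%:R)) /\
  generated_ideal a = setT.

Definition shorten_row n (a : 'rV[R]_n.+1) (b : 'rV[R]_n) : 'rV[R]_n :=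
  \row_(i < n) (a 0 (widen_ord (leqnSn n) i) + a 0 ord_max * b 0 i).

Definition SR I n : Prop :=
  forall a : 'rV[R]_n.+1, unimodular_row I a ->
    exists2 b : 'rV[R]_n, (forall i, I (b 0 i)) &
      unimodular_row I (shorten_row a b).

Definition frakJ n (a : 'rV[R]_n) : set R :=
  [set x | forall M, is_maximal_ideal M -> (forall i, M (a 0 i)) -> M x].

Definition ASR I n : Prop :=
  SR I n /\
  forall a : 'rV[R]_n.+1, (forall i, I (a 0 i)) ->
    exists2 c : 'rV[R]_n, (forall i, I (c 0 i)) &
      frakJ a = frakJ (shorten_row a c).

Definition is_least (P : nat -> Prop) (n : nat) : Prop :=
  P n /\ forall m, P m -> (n <= m)%N.

(* SR_k and ASR_k are about rows of positive length k, whence 1 <= k. *)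
Definition sr_le I (N : nat) : Prop :=
  exists2 n, is_least (fun k => (1 <= k)%N /\ SR I k) n & (n <= N)%N.

Definition asr_le I (N : nat) : Prop :=
  exists2 n, is_least (fun k => (1 <= k)%N /\ ASR I k) n & (n <= N)%N.

End Stability.

(* The simply connected Chevalley groups of types A_l, B_l, C_l, D_l are
   SL_(l+1), Spin_(2l+1), Sp_2l, Spin_2l of the split forms.  They are
   realized as matrices over R of the following sizes: natural representation
   for A and C, spin representation (sum of the two half-spin ones for D) on
   the exterior algebra of R^l for B and D. *)
Definition rep_dim (X : classical_type) (l : nat) : nat :=
  match X with
  | TypeA => l.+1
  | TypeC => l + l
  | TypeB | TypeD => #|{: {set 'I_l}}|
  end.

Section Spinors.
Variables (R : comPzRingType) (l : nat).
Local Notation Mat := 'M[R]_#|{: {set 'I_l}}|.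

(* The basis vector of index b is the wedge product e_S of the e_j, j in
   S := enum_val b, in increasing order; [wedge i] is x |-> e_i /\ x.  Its
   transpose is the contraction by the dual basis vector e_i^*. *)
Definition wedge (i : 'I_l) : Mat :=
  \matrix_(a, b)
    let S : {set 'I_l} := enum_val b in
    if (i \notin S) && (enum_val a == (i |: S)%SET)
    then (-1) ^+ #|[set j in S | (j < i)%N]%SET| else 0.

Definition contr (i : 'I_l) : Mat := (wedge i)^T.

Definition parity : Mat := diag_mx (\row_b (-1) ^+ #|(enum_val b : {set 'I_l})|).

(* A vector \sum_i (x_i e_i + y_i e_(-i)) of R^2l, with the quadratic form
   \sum_i x_i y_i, acts by \sum_i (x_i wedge_i + y_i contr_i): this gives the
   isomorphism of the Clifford algebra onto all matrices.  A vector with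
   additional coordinate z on e_0, for the form z^2 + \sum_i x_i y_i on
   R^(2l+1), acts by the previous operator plus z parity; this gives an
   isomorphism onto all matrices of the even part of the Clifford algebra, and
   is also injective on its odd part.
   [clifford_vectors with_e0 S] is the set of vectors with x, y supported on S. *)
Definition clifford_vectors (with_e0 : bool) (S : set 'I_l) : set Mat :=
  [set v | exists x y : 'I_l -> R, exists z : R,
     [/\ forall i, ~ S i -> x i = 0 /\ y i = 0,
         with_e0 = false -> z = 0 &
         v = \sum_i (x i *: wedge i + y i *: contr i) + z *: parity]].

(* [reversal V g h]: g is in the even part of the Clifford algebra generated by
   V and h is the image of g by the canonical anti-automorphism, the one which
   is the identity on V. *)
Inductive reversal (V : set Mat) : Mat -> Mat -> Prop :=
| reversal_scalar c : reversal V c%:M c%:M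
| reversal_pair v w : V v -> V w -> reversal V (v *m w) (w *m v)
| reversal_add g g' h h' :
    reversal V g h -> reversal V g' h' -> reversal V (g + g') (h + h')
| reversal_mul g g' h h' :
    reversal V g h -> reversal V g' h' -> reversal V (g *m g') (h' *m h).

(* Even units of the Clifford algebra with g V g^-1 = V and spinor norm
   g g^rev = 1. *)
Definition spin_group (V : set Mat) : set Mat :=
  [set g | exists h, [/\ reversal V g h, g *m h = 1%:M, h *m g = 1%:M,
     (forall v, V v -> V (g *m v *m h)) & (forall v, V v -> V (h *m v *m g))]].

End Spinors.

Section Chevalley.
Variables (R : comPzRingType) (X : classical_type) (l : nat).
Local Notation Mat := 'M[R]_(rep_dim X l).
Local Notation root := 'rV[int]_(coord_dim X l).

(* Coordinates of the natural module of Sp_2l: e_1, .., e_l, e_(-1), .., e_(-l),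
   the symplectic form being <e_i, e_(-i)> = 1 = - <e_(-i), e_i>. *)
Definition symplectic_form : 'M[R]_(l + l) :=
  block_mx 0 1%:M (- 1%:M) 0.

Definition symplectic_coord (i : 'I_(l + l)) : 'I_l :=
  match split i with inl k | inr k => k end.

Definition identity_outside n (S : set 'I_n) (g : 'M[R]_n) : Prop :=
  forall i j, ~ (S i /\ S j) -> g i j = (i == j)%:R.

(* The classical group of the coordinates in S: SL, Sp of the corresponding free
   direct summand of the natural module (extended by the identity on the other
   coordinates), respectively Spin of the corresponding orthogonal summand
   (always containing e_0 for type B) inside the Clifford algebra. *)
Definition classical_group (S : set 'I_(coord_dim X l)) : set Mat :=
  match X return set 'I_(coord_dim X l) -> set 'M[R]_(rep_dim X l) with
  | TypeA => fun S => [set g | \det g = 1 /\ identity_outside S g]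
  | TypeB => fun S => spin_group (@clifford_vectors R l true S)
  | TypeC => fun S => [set g |
      g^T *m symplectic_form *m g = symplectic_form /\
      identity_outside [set i | S (symplectic_coord i)] g]
  | TypeD => fun S => spin_group (@clifford_vectors R l false S)
  end S.

Definition chevalley_group : set Mat := classical_group setT.

Definition chevalley_group_Delta1 : set Mat :=
  classical_group (coord_support (Delta1 X l)).

(* The kernel, in a matrix group G over R, of the reduction modulo I. *)
Definition congruence_subgroup (G : set Mat) (I : set R) : set Mat :=
  [set g | G g /\ forall i j, I ((g - 1%:M) i j)].

(* The root vector e_a in the representation above, for a root a.  These come
   from a Chevalley basis, with e_(-a) the transpose of e_a and
   [e_a, e_(-a)] = h_a; in every case e_a ^ 2 = 0. *)
Definition root_vector (a : root) : Mat :=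
  match X return 'rV[int]_(coord_dim X l) -> 'M[R]_(rep_dim X l) with
  | TypeA => fun a => let e := evec l.+1 in
      \matrix_(i, j) (a == e i - e j)%:R
  | TypeC => fun a => let e := evec l in
      block_mx (\matrix_(i, j) (a == e i - e j)%:R)
               (\matrix_(i, j) (a == e i + e j)%:R)
               (\matrix_(i, j) (a == - (e i + e j))%:R)
               (- \matrix_(i, j) (a == e j - e i)%:R)
  | TypeB => fun a => let e := evec l in
      \sum_(i < l) \sum_(j < l | (i < j)%N)
        ((a == e i + e j)%:R *: (wedge R i *m wedge R j)
         + (a == - (e i + e j))%:R *: (contr R j *m contr R i))
      + \sum_(i < l) \sum_(j < l | i != j)
          (a == e i - e j)%:R *: (wedge R i *m contr R j)
      + \sum_(i < l)
          ((a == e i)%:R *: (wedge R i *m parity R l)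
           + (a == - e i)%:R *: (parity R l *m contr R i))
  | TypeD => fun a => let e := evec l in
      \sum_(i < l) \sum_(j < l | (i < j)%N)
        ((a == e i + e j)%:R *: (wedge R i *m wedge R j)
         + (a == - (e i + e j))%:R *: (contr R j *m contr R i))
      + \sum_(i < l) \sum_(j < l | i != j)
          (a == e i - e j)%:R *: (wedge R i *m contr R j)
  end a.

(* x_a(xi) = exp (xi e_a) *)
Definition root_unipotent (a : root) (xi : R) : Mat :=
  1%:M + xi *: root_vector a.

Definition is_subgroup (H : set Mat) : Prop :=
  [/\ H 1%:M, (forall g h, H g -> H h -> H (g *m h)) &
      (forall g h, H g -> g *m h = 1%:M -> H h)].

Definition unipotent_subgroup (Sigma : set root) (I : set R) : set Mat :=
  smallest is_subgroup
    [set g | exists a s, [/\ Sigma a, I s & g = root_unipotent a s]].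

Definition z_elt (a : root) (s xi : R) : Mat :=
  root_unipotent (- a) (- xi) *m root_unipotent a s *m root_unipotent (- a) xi.

Definition Z_set (amax : root) (I : set R) : set Mat :=
  [set z_elt (- amax) r 1 | r in I].

Definition set_mulmx (A B : set Mat) : set Mat :=
  [set a *m b | a in A & b in B].

End Chevalley.

Arguments chevalley_group : clear implicits.
Arguments chevalley_group_Delta1 : clear implicits.

Notation "A :*m: B" := (set_mulmx A B)
  (at level 40, left associativity) : classical_set_scope.

(* Main.v *)
Require Import Defs.
From mathcomp Require Import boolp ring zify.
Set Implicit Arguments.
Unset Strict Implicit.
Unset Printing Implicit Defensive.
Import Order.TTheory Num.Theory.
Local Open Scope ring_scope.
Local Open Scope classical_set_scope.

(** Each of the groups acts on vectors: [SL] and [Sp] on columns, [Spin] by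
    conjugation on the vectors of the Clifford algebra.  Let [v0] be the first
    basis vector, which is a highest weight vector.  The decomposition follows
    from two facts about the congruence subgroup of level [I]
    ([congruence_decomposition]).
    - The image [v] of [v0] under an element [g] of it can be moved by some [u] in
      [U(Phi^+, I)] and then by some [u'] in [U(Phi^-, I)] to a vector
      [z w v0], with [z] in [Z] and [w] in the factor for
      [Sigma_1^-] without [- alpha_max].
    - The stabiliser of [v0] in it is contained in the product of the last two
      factors.
    Indeed the product of [u' u g] with the inverse of [z w] then fixes [v0].
    The other inclusion holds because all factors are contained in the
    congruence subgroup.

    The element [z_(- alpha_max)(r, 1)] acts on the plane of [v0] and its image under
    the root vector of [- alpha_max] as a matrix of [SL_2] with the first column
    [(1 - r, r)].  This makes the vectors [z w v0] easy to recognize: they are given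
    by one linear equation between two coordinates, namely that their sum be 1,
    for type A (first and last coordinate) and for types B and D (the coordinates
    at [e_1] and [e_(-2)]), with a quadratic correction for type C.

    Type A ([moves_A]): the stable rank condition makes all coordinates but the last
    one comaximal, by [U(Phi^+, I)]; then [U(Phi^-, I)] gives the last one any value
    that is allowed modulo [I].

    Type C ([moves_C]): the stable rank condition is applied to a row of length [2l]
    that ends with the coordinate at [e_(-1)].  The matrices in the unipotent
    radicals are now symmetric, and a change of one coordinate comes with unwanted
    changes of others; these are cancelled by rank one symmetric matrices and by
    elements of the Levi subgroup, for which it is enough that
    suitable squares still generate the unit ideal ([first_move], [last_move]).

    Types B and D ([moves_spin]): the vector is isotropic, with coordinates [x_i] at
    [e_i], [y_i] at [e_(-i)], and [z] at [e_0].  By isotropy the [x_i] and [y_i]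
    generate the unit ideal ([spin_image]).  The condition on radicals in [ASR] is
    applied once for every [k] to remove [y_k] from the generators
    ([radical_step]), until the [x_i] alone are comaximal.  Then the
    stable rank condition for the row of the [x_i] allows to prescribe [y_2], as in
    type A.

    For the stabiliser one divides by an element of [U(Sigma_1^+, I)] such that a
    dual vector gets fixed as well.  For [SL] and [Sp] the result visibly lies in the
    group of the other coordinates.  For [Spin] it commutes with a hyperbolic
    plane in the Clifford algebra, and belongs to the spin group of the orthogonal
    complement since the centraliser of the plane in the even Clifford algebra is
    the even Clifford algebra of the complement ([split_centraliser],
    [spin_centraliser]). *)

(** * Comaximal families and stable rank conditions *)

Section Ideals.
Variable R : comPzRingType.
Implicit Types (I K M : set R).

Lemma ideal0 K : is_ideal K -> K 0. Proof. by case. Qed.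

Lemma idealD K x y : is_ideal K -> K x -> K y -> K (x + y).
Proof. by case=> _ + _; apply. Qed.

Lemma idealMl K x y : is_ideal K -> K y -> K (x * y).
Proof. by case=> _ _; apply. Qed.

Lemma idealMr K x y : is_ideal K -> K x -> K (x * y).
Proof. by rewrite mulrC => idK; apply: idealMl. Qed.

Lemma idealN K x : is_ideal K -> K x -> K (- x).
Proof. by rewrite -mulN1r => idK; apply: idealMl. Qed.

Lemma idealB K x y : is_ideal K -> K x -> K y -> K (x - y).
Proof. by move=> idK Kx Ky; apply: idealD => //; apply: idealN. Qed.

Lemma ideal_sum K (T : Type) (r : seq T) (P : pred T) (F : T -> R) :
  is_ideal K -> (forall t, P t -> K (F t)) -> K (\sum_(t <- r | P t) F t).
Proof.
move=> idK KF; apply: (big_ind K) => //; first exact: ideal0.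
by move=> x y; apply: idealD.
Qed.

Lemma ideal1 K x : is_ideal K -> K 1 -> K x.
Proof. by move=> idK K1; rewrite -(mulr1 x); apply: idealMl. Qed.

(** Comaximality is expressed by quantifying over the ideals that contain the
    family: no coefficients have to be exhibited when the family is changed by
    elementary transformations. *)
Definition comaximal (T : Type) (D : T -> Prop) (a : T -> R) : Prop :=
  forall K, is_ideal K -> (forall t, D t -> K (a t)) -> K 1.

Lemma comaximal_coef (T : finType) (D : pred T) (a : T -> R) :
  comaximal D a -> exists d : T -> R, \sum_(t | D t) d t * a t = 1.
Proof.
pose K : set R := [set x | exists d : T -> R, x = \sum_(t | D t) d t * a t].
case/(_ K) => [|t Dt|d ->]; last by exists d.
  split=> [|x y [d ->] [d' ->]|x y [d ->]].
  - by exists (fun=> 0); rewrite big1 // => t _; rewrite mul0r.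
  - exists (fun t => d t + d' t); rewrite -big_split.
    by apply: eq_bigr => t _; rewrite mulrDl.
  - exists (fun t => x * d t); rewrite mulr_sumr.
    by apply: eq_bigr => t _; rewrite mulrA.
exists (fun u => (u == t)%:R); rewrite (bigD1 t) //= eqxx mul1r big1 ?addr0 //.
by move=> u /andP[_ /negbTE->]; rewrite mul0r.
Qed.

Lemma exists_maximal_ideal K :
  is_ideal K -> ~ K 1 -> exists2 M, is_maximal_ideal M & K `<=` M.
Proof.
move=> idK nK1.
(* Joining [K] to the members of a chain makes the empty chain no exception. *)
pose P (A : set R) := is_ideal (A `|` K) /\ ~ (A `|` K) 1.
have [F FP Ftot|A [[idAK nAK1] maxA]] := @Zorn_bigcup R P.
  have case2 x y : (\bigcup_(X in F) X `|` K) x -> (\bigcup_(X in F) X `|` K) y ->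
      exists2 A, P A /\ (A `<=` \bigcup_(X in F) X) & (A `|` K) x /\ (A `|` K) y.
    have sub A : F A -> A `<=` \bigcup_(X in F) X by move=> FA z Az; exists A.
    case=> [[A FA Ax]|Kx] [[B FB By]|Ky].
    - have [AB|BA] := Ftot A B FA FB.
        by exists B; [split; [apply: FP|apply: sub] | split; left => //; apply: AB].
      by exists A; [split; [apply: FP|apply: sub] | split; left => //; apply: BA].
    - by exists A; [split; [apply: FP|apply: sub] | split; [left|right]].
    - by exists B; [split; [apply: FP|apply: sub] | split; [right|left]].
    - exists set0; last by split; right.
      by split=> [|z []]; rewrite /P set0U.
  have up A x : A `<=` \bigcup_(X in F) X -> (A `|` K) x ->
      (\bigcup_(X in F) X `|` K) x.
    by move=> sA [/sA|]; [left|right].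
  split.
    split=> [|x y Ux Uy|x y Uy]; first by right; apply: ideal0.
      have [A [[idA _] sA] [Ax Ay]] := case2 _ _ Ux Uy.
      by apply: (up A) => //; apply: idealD.
    have [A [[idA _] sA] [Ay _]] := case2 _ _ Uy Uy.
    by apply: (up A) => //; apply: idealMl.
  by move=> U1; have [A [[_ nA1] _] [A1 _]] := case2 _ _ U1 U1.
exists (A `|` K); last by move=> x; right.
split=> //; first by apply/eqP=> AKT; apply: nAK1; rewrite AKT.
move=> J idJ sAKJ; have KJ : K `<=` J by move=> x Kx; apply: sAKJ; right.
have JK : J `|` K = J by apply/seteqP; split=> x; [case=> // /KJ|left].
have [J1|nJ1] := pselect (J 1).
  by right; apply/seteqP; split=> // x _; apply: ideal1 J1.
left; apply/seteqP; split=> // x Jx; apply: contrapT => nx.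
apply: (maxA J); last by rewrite /P JK.
split; first by move=> z Az; apply: sAKJ; left.
by move=> JA; apply: nx; left; apply: JA.
Qed.

Lemma maximal_ideal_proper M : is_maximal_ideal M -> ~ M 1.
Proof.
by case=> idM MT _ M1; case/eqP: MT; apply/seteqP; split=> // x _; apply: ideal1.
Qed.

Lemma maximal_ideal_prime M x y :
  is_maximal_ideal M -> M (x * y) -> M x \/ M y.
Proof.
move=> maxM Mxy; have [Mx|nMx] := pselect (M x); [by left | right].
have [idM _ maxM'] := maxM.
pose J : set R := [set z | exists u m, M m /\ z = u * x + m].
have idJ : is_ideal J.
  split=> [|_ _ [u [m [Mm ->]]] [v [n [Mn ->]]]|v _ [u [m [Mm ->]]]].
  - by exists 0, 0; split; [apply: ideal0|ring].
  - by exists (u + v), (m + n); split; [apply: idealD|ring].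
  - by exists (v * u), (v * m); split; [apply: idealMl|ring].
case: (maxM' J) => // [m Mm|JM|JT].
- by exists 0, m; split=> //; ring.
- by case: nMx; rewrite -JM; exists 1, 0; split; [apply: ideal0|ring].
have [u [m [Mm e1]]] : J 1 by rewrite JT.
rewrite -(mul1r y) e1 mulrDl -mulrA.
by apply: idealD => //; [apply: idealMl|apply: idealMr].
Qed.

Lemma comaximal_by_maximal (T : Type) (D : T -> Prop) (a : T -> R) :
  (forall M, is_maximal_ideal M -> ~ (forall t, D t -> M (a t))) ->
  comaximal D a.
Proof.
move=> noM K idK Ka; apply: contrapT => nK1.
have [M maxM KM] := exists_maximal_ideal idK nK1.
by apply: (noM M maxM) => t Dt; apply/KM/Ka.
Qed.

End Ideals.

Section StableRank.
Variables (R : comPzRingType) (I : set R).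
Hypothesis idI : is_ideal I.

(** [SR] and the condition on radicals in [ASR] for families indexed by a
    finite type, the last entry of the row being replaced by the entry [k]. *)
Definition SR_on (T : finType) : Prop :=
  forall (k j0 : T) (a : T -> R) (f : R),
  j0 != k -> (forall j, j != k -> I (a j - (j == j0)%:R)) -> I f ->
  (forall K, is_ideal K -> (forall j, j != k -> K (a j)) -> K f -> K 1) ->
  exists2 b : T -> R, (forall j, I (b j)) &
    comaximal (fun j => j != k) (fun j => a j + b j * f).

Definition JSR_on (T : finType) : Prop :=
  forall (k : T) (a : T -> R) (f : R),
  (forall j, j != k -> I (a j)) -> I f ->
  exists2 b : T -> R, (forall j, I (b j)) &
    forall M, is_maximal_ideal M ->
      (forall j, j != k -> M (a j + b j * f)) -> M f.

Lemma generated_idealP n (a : 'rV[R]_n) :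
  generated_ideal a = setT <-> comaximal xpredT (fun i => a 0 i).
Proof.
split=> [aT K idK Ka|/(@comaximal_coef _ _ predT) [d d1]].
  have [b ->] : generated_ideal a 1 by rewrite aT.
  by apply: ideal_sum => // i _; apply: idealMl => //; apply: Ka.
apply/seteqP; split=> // x _; exists (\row_i (x * d i)).
rewrite -[LHS]mulr1 -d1 mulr_sumr; apply: eq_bigr => i _.
by rewrite mxE mulrA.
Qed.

Section Family.
Variables (T : finType) (m : nat) (k j0 : T).
Hypotheses (m_gt0 : (0 < m)%N) (ltmT : (m < #|T|)%N) (j0k : j0 != k).

(** Families are turned into rows of length [m] along a list of indices other
    than [k] that starts with [j0]. *)
Let s := take m (j0 :: enum [pred j | (j != k) && (j != j0)]).

Let size_s : size s = m.
Proof.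
rewrite size_takel //= -cardE.
have -> : #|[pred j | (j != k) && (j != j0)]|.+1 = #|T|.-1.
  rewrite -(cardC1 k) (cardD1 j0 (predC1 k)) inE j0k add1n; congr _.+1.
  by apply: eq_card => j; rewrite !inE andbC.
by rewrite -ltnS (ltn_predK ltmT).
Qed.

Let uniq_s : uniq s.
Proof.
by apply: take_uniq; rewrite /= mem_enum inE eqxx andbF enum_uniq.
Qed.

Let s_neq j : j \in s -> j != k.
Proof.
move=> /mem_take; rewrite inE => /orP[/eqP->//|].
by rewrite mem_enum inE => /andP[].
Qed.

Let s_head : nth j0 s 0 = j0.
Proof. by rewrite nth_take. Qed.

Let row (a : T -> R) (f : R) : 'rV[R]_m.+1 :=
  \row_i (if (i < m)%N then a (nth j0 s i) else f).

Let coef (b : 'rV[R]_m) (j : T) : R :=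
  \sum_(i < m | nth j0 s i == j) b 0 i.

Let coef_nth b (i : 'I_m) : coef b (nth j0 s i) = b 0 i.
Proof.
rewrite /coef (bigD1 i) //= big1 ?addr0 // => i' /andP[+ ne].
by rewrite nth_uniq ?size_s // => /eqP/val_inj e; rewrite e eqxx in ne.
Qed.

Let coef_in (b : 'rV[R]_m) : (forall i, I (b 0 i)) -> forall j, I (coef b j).
Proof. by move=> Ib j; apply: ideal_sum. Qed.

Let shorten_row_family a f (b : 'rV[R]_m) (i : 'I_m) :
  shorten_row (row a f) b 0 i =
  a (nth j0 s i) + coef b (nth j0 s i) * f.
Proof. by rewrite !mxE /= ltn_ord ltnn coef_nth mulrC. Qed.

Let all_s (P : T -> Prop) :
  (forall i : 'I_m, P (nth j0 s i)) -> forall j, j \in s -> P j.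
Proof.
move=> Ps j js; rewrite -(nth_index j0 js).
have lt : (index j s < m)%N by rewrite -[X in (_ < X)%N]size_s index_mem.
exact: (Ps (Ordinal lt)).
Qed.

(** A row that is longer than required is shortened by adding to [m] of its
    entries multiples of the contribution of all the others to the Bezout
    relation. *)
Lemma SR_family a f : SR I m ->
  (forall j, j != k -> I (a j - (j == j0)%:R)) -> I f ->
  (forall K, is_ideal K -> (forall j, j != k -> K (a j)) -> K f -> K 1) ->
  exists2 b : T -> R, (forall j, I (b j)) &
    comaximal (fun j => j != k) (fun j => a j + b j * f).
Proof.
move=> sr aI If a1.
pose D := [pred j | (j != k) && (j \notin s)].
pose A j := if j == k then f else a j.
have [d d1] : exists d : T -> R, \sum_t d t * A t = 1.
  apply: (@comaximal_coef _ _ predT) => K idK KA; apply: a1 => // [j jk|].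
    by have:= KA j isT; rewrite /A (negbTE jk).
  by have:= KA k isT; rewrite /A eqxx.
pose g := \sum_(j | D j) d j * a j.
have Ig : I g.
  apply: ideal_sum => // j /andP[jk js]; apply: idealMl => //.
  have := aI j jk; have -> : (j == j0) = false.
    apply/negbTE/eqP => jj0; case/negP: js; rewrite jj0 -s_head mem_nth //.
    by rewrite size_s.
  by rewrite subr0.
have Bezout K : is_ideal K -> (forall j, j \in s -> K (a j)) ->
    K (d k * f + g) -> K 1.
  move=> idK Ks Kg; rewrite -d1 (bigID (mem s)) /=; apply: idealD => //.
    apply: ideal_sum => // j js; apply: idealMl => //.
    by rewrite /A (negbTE (s_neq js)); apply: Ks.
  rewrite (bigD1 k) /=; last by apply/negP => /s_neq; rewrite eqxx.
  rewrite {1}/A eqxx; congr (K (_ + _)): Kg; rewrite /g; apply: eq_big => [j|j].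
    by rewrite /D /= andbC.
  by rewrite /A => /andP[/negbTE-> _].
have [|b Ib [_ /generated_idealP b1]] := sr (row a (d k * f + g)).
  split=> [i|].
    rewrite !mxE; case: ltnP => lti.
      have /aI : nth j0 s i != k by apply/s_neq/mem_nth; rewrite size_s.
      congr (I (_ - (_ : bool)%:R)).
      by rewrite -{2}s_head nth_uniq ?size_s.
    have -> : (i == 0 :> nat) = false by lia.
    by rewrite subr0; apply: idealD => //; apply: idealMl.
  apply/generated_idealP => K idK Krow; apply: Bezout => //.
    apply: (@all_s (fun j => K (a j))) => i; have:= Krow (widen_ord (leqnSn m) i) isT.
    by rewrite mxE /= ltn_ord.
  by have:= Krow ord_max isT; rewrite mxE /= ltnn.
exists (fun j => coef b j * d k) => [j|K idK Kb].
  by apply: idealMr => //; apply: coef_in.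
have Kg : K g.
  apply: ideal_sum => // j /andP[jk js]; apply: idealMl => //.
  suff -> : a j = a j + coef b j * d k * f by apply: Kb.
  rewrite /coef big1 ?mul0r ?addr0 // => i /eqP ij.
  by case/negP: js; rewrite -ij mem_nth // size_s.
apply: b1 => // i _; rewrite shorten_row_family mulrDr addrA mulrA.
apply: idealD => //; last exact: idealMl.
by apply: Kb; apply/s_neq/mem_nth; rewrite size_s.
Qed.

Lemma JSR_family a f : ASR I m ->
  (forall j, j != k -> I (a j)) -> I f ->
  exists2 b : T -> R, (forall j, I (b j)) &
    forall M, is_maximal_ideal M ->
      (forall j, j != k -> M (a j + b j * f)) -> M f.
Proof.
move=> [_ asr] aI If.
have [|b Ib eJ] := asr (row a f).
  move=> i; rewrite mxE; case: ltnP => // lti.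
  by apply/aI/s_neq/mem_nth; rewrite size_s.
exists (coef b) => [|M maxM Mb]; first exact: coef_in.
suff : frakJ (row a f) f.
  rewrite eJ; apply=> // i; rewrite shorten_row_family.
  by apply: Mb; apply/s_neq/mem_nth; rewrite size_s.
by move=> N _ /(_ ord_max); rewrite mxE ltnn.
Qed.

End Family.

Lemma SR_onP (T : finType) n : sr_le I n -> #|T| = n.+1 -> SR_on T.
Proof.
case=> m [[m_gt0 sr] _] lemn cT k j0 a f j0k.
by apply: (@SR_family T m) => //; rewrite cT.
Qed.

Lemma JSR_onP (T : finType) n : asr_le I n -> #|T| = n.+1 -> JSR_on T.
Proof.
case=> m [[m_gt0 asr] _] lemn cT k a f.
have [j0 j0k] : exists j0, j0 != k.
  have : (0 < #|predC1 k|)%N by rewrite cardC1 cT; apply: leq_trans lemn.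
  by case/card_gt0P=> j0; exists j0.
by apply: (@JSR_family T m k j0) => //; rewrite cT.
Qed.

Lemma asr_sr_le n : asr_le I n -> exists2 m, (0 < m <= n)%N & SR I m.
Proof. by case=> m [[m_gt0 [sr _]] _] lemn; exists m; rewrite ?m_gt0. Qed.

Lemma asr_SR_onP (T : finType) n : asr_le I n -> #|T| = n.+1 -> SR_on T.
Proof.
move=> /asr_sr_le[m /andP[m_gt0 lemn] sr] cT k j0 a f j0k.
by apply: (@SR_family T m) => //; rewrite cT.
Qed.

(** The radical condition also holds for rows with one entry [a j0] congruent to
    1: apply it to the row with [a j0] multiplied by [rho = 1 - a j0].  At a
    maximal ideal that contains [rho] the new entry number [j0] is 1. *)
Lemma JSR_on_congr1 (T : finType) (k j0 : T) a f : JSR_on T -> j0 != k ->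
  (forall j, j != k -> I (a j - (j == j0)%:R)) -> I f ->
  exists2 b : T -> R, (forall j, I (b j)) &
    forall M, is_maximal_ideal M ->
      (forall j, j != k -> M (a j + b j * f)) -> M f.
Proof.
move=> jsr j0k aI If; pose rho := 1 - a j0.
have Irho : I rho.
  by rewrite /rho -opprB; apply: idealN => //; have:= aI j0 j0k; rewrite eqxx.
pose a' j := if j == j0 then rho * a j0 else a j.
have [j jk||b Ib maxb] := jsr k a' (rho ^+ 2 * f).
- rewrite /a'; case: eqP => [_|/eqP jj0]; first exact: idealMr.
  by have:= aI j jk; rewrite (negbTE jj0) subr0.
- exact: idealMl.
exists (fun j => b j * (if j == j0 then rho else rho ^+ 2)).
  by move=> j; apply: idealMr.
move=> M maxM Mb; have [idM _ _] := maxM.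
have Mj0 : M (a j0 + b j0 * rho * f) by have:= Mb j0 j0k; rewrite eqxx.
have [//|] : M f \/ M rho.
  have /(maximal_ideal_prime maxM)[|//] : M (rho ^+ 2 * f).
    apply: maxb => // j jk; rewrite /a'; case: eqP => [->|/eqP jj0].
      have -> : rho * a j0 + b j0 * (rho ^+ 2 * f)
                = rho * (a j0 + b j0 * rho * f) by ring.
      exact: idealMl.
    by rewrite mulrA; have:= Mb j jk; rewrite (negbTE jj0).
  - by rewrite expr2 => /(maximal_ideal_prime maxM)[]; right.
  - by left.
move=> Mrho; case: (maximal_ideal_proper maxM).
have -> : 1 = (a j0 + b j0 * rho * f) + rho * (1 - b j0 * f).
  by rewrite /rho; ring.
by apply: idealD => //; apply: idealMr.
Qed.

End StableRank.

(** * Roots *)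

Lemma evecE n k (j : 'I_n) : evec n k 0 j = ((j : nat) == k)%:R.
Proof. by rewrite mxE. Qed.

(** A linear functional that is positive on the simple roots and takes distinct
    values at the coordinate vectors: it singles out the highest root. *)
Definition height n (a : 'rV[int]_n) : int := \sum_(j < n) a 0 j * (n%:Z - j%:Z).

Lemma heightD n (a b : 'rV[int]_n) : height (a + b) = height a + height b.
Proof. by rewrite -big_split; apply: eq_bigr => j _; rewrite mxE mulrDl. Qed.

Lemma heightZ n k (a : 'rV[int]_n) : height (k *: a) = k * height a.
Proof. by rewrite mulr_sumr; apply: eq_bigr => j _; rewrite mxE mulrA. Qed.

Lemma heightN n (a : 'rV[int]_n) : height (- a) = - height a.
Proof. by rewrite -scaleN1r heightZ mulN1r. Qed.

Lemma height_evec n k : (k < n)%N -> height (evec n k) = n%:Z - k%:Z.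
Proof.
move=> ltk; rewrite /height (bigD1 (Ordinal ltk)) //= evecE eqxx mul1r.
rewrite big1 ?addr0 // => j; rewrite -val_eqE /= => /negbTE jk.
by rewrite evecE jk mul0r.
Qed.

Section Roots.
Variables (X : classical_type) (l : nat).
Local Notation n := (coord_dim X l).
Local Notation Phi := (root_system X l).
Local Notation nonneg := (@nonneg_combination X l).
Local Notation e := (evec n).
Implicit Types a b : 'rV[int]_n.

Lemma nonneg0 : nonneg 0.
Proof.
exists (fun=> 0) => //; rewrite /simple_expansion big1 // => i _.
by rewrite scale0r.
Qed.

Lemma nonnegD a b : nonneg a -> nonneg b -> nonneg (a + b).
Proof.
move=> [m -> m0] [m' -> m'0]; exists (fun i => m i + m' i) => [|i].
  by rewrite /simple_expansion -big_split; apply: eq_bigr => i _; rewrite scalerDl.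
exact: addr_ge0.
Qed.

Lemma nonneg_simple i : nonneg (simple_root X l i).
Proof.
exists (fun j => (j == i)%:R) => [|j]; last by case: eqP.
rewrite /simple_expansion (bigD1 i) //= eqxx scale1r big1 ?addr0 // => j.
by move=> /negbTE->; rewrite scale0r.
Qed.

Lemma simple_root_diff (k : 'I_l) :
  (k.+1 < n)%N -> simple_root X l k = e k - e k.+1.
Proof. by rewrite /simple_root; case: X => //= ltk; rewrite ltn_eqF. Qed.

Lemma nonneg_diff i j : (i <= j)%N -> (j < n)%N -> nonneg (e i - e j).
Proof.
elim: j => [|j IHj].
  by rewrite leqn0 => /eqP-> _; rewrite subrr; apply: nonneg0.
rewrite leq_eqVlt => /orP[/eqP-> _|leij ltj].
  by rewrite subrr; apply: nonneg0.
have ltjl : (j < l)%N.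
  by move: ltj; rewrite /coord_dim; case: (X) => // /ltnW.
have -> : e i - e j.+1 = (e i - e j) + simple_root X l (Ordinal ltjl).
  by rewrite simple_root_diff //= addrA subrK.
by apply: nonnegD; [apply: IHj => //; apply: ltnW|apply: nonneg_simple].
Qed.

Lemma height_nonneg a : nonneg a -> 0 <= height a.
Proof.
have hsimple i : 0 <= height (simple_root X l i).
  rewrite /simple_root; have := ltn_ord i; rewrite /coord_dim; case: (X) => lti; last 3 first.
  - by case: eqP => ?; rewrite ?heightD ?heightN ?height_evec; lia.
  - by case: eqP => ?; rewrite ?mulr2n ?heightD ?heightN ?height_evec; lia.
  - by case: eqP => ?; rewrite ?heightD ?heightN ?height_evec; lia.
  by rewrite heightD heightN !height_evec; lia.
case=> m -> m0; elim/big_rec: _ => [|i x _ x0].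
  by rewrite /height big1 // => j _; rewrite mxE mul0r.
by rewrite heightD heightZ; apply: addr_ge0 => //; apply: mulr_ge0.
Qed.

Lemma highest_root_height amax b :
  @highest_root X l amax -> Phi b -> height b <= height amax.
Proof.
case=> _ hb /hb /height_nonneg; rewrite heightD heightN; lia.
Qed.

(** The coefficient at the first simple root is the first coordinate: no other
    simple root involves it. *)
Lemma simple_expansion_m1 (z : 'I_n) (i : 'I_l) a m :
  (1 < l)%N -> (X = TypeD -> (2 < l)%N) -> z = 0%N :> nat -> i = 0%N :> nat ->
  @simple_expansion X l a m -> m i = a 0 z.
Proof.
move=> l1 lD z0 i0 ->; rewrite summxE (bigD1 i) //= mxE big1 ?addr0.
  have -> : simple_root X l i = e i - e i.+1.
    by apply: simple_root_diff; rewrite i0 /coord_dim; case: (X) => //; lia.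
  by rewrite !mxE z0 i0 /= subr0 mulr1.
move=> j; rewrite -val_eqE /= i0 => j0; rewrite mxE.
suff -> : simple_root X l j 0 z = 0 by rewrite mulr0.
rewrite /simple_root; move: z z0 lD; have:= ltn_ord j.
rewrite /coord_dim; case: (X) => ltj z z0 lD; rewrite ?mxE.
- by rewrite z0 /= [0%N == j]eq_sym (negbTE j0).
- by case: ifP => _; rewrite !mxE z0 /= [0%N == j]eq_sym (negbTE j0).
- by case: ifP => _; rewrite ?mulr2n !mxE z0 /= [0%N == j]eq_sym (negbTE j0).
have := lD erefl => l2; case: ifP => [/eqP jl|_]; rewrite !mxE z0 /=.
  rewrite [0%N == j]eq_sym (negbTE j0) addr0.
  by have -> : (0%N == j.-1) = false by apply/eqP; lia.
by rewrite [0%N == j]eq_sym (negbTE j0).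
Qed.

Section FirstCoordinate.
Variable z : 'I_n.
Hypotheses (l1 : (1 < l)%N) (lD : X = TypeD -> (2 < l)%N) (z0 : z = 0%N :> nat).

Lemma m1_eqP a k : @m1_eq X l a k -> k = a 0 z.
Proof.
have l0 : (0 < l)%N by lia.
case=> m am mk; rewrite -(mk (Ordinal l0) erefl).
exact: (simple_expansion_m1 l1 lD z0).
Qed.

Lemma nonneg_m1 a : nonneg a -> @m1_eq X l a (a 0 z).
Proof. by case=> m am _; exists m => // i i0; apply: simple_expansion_m1 am. Qed.

Lemma Sigma1_pos_nonneg a : Phi a -> nonneg a -> 0 < a 0 z -> Sigma1_pos X l a.
Proof. by move=> Pa na a0; split=> //; exists (a 0 z) => //; apply: nonneg_m1. Qed.

Lemma Delta1_nonneg a : Phi a -> nonneg a -> a 0 z = 0 -> Delta1 X l a.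
Proof. by move=> Pa na a0; split=> //; rewrite -a0; apply: nonneg_m1. Qed.

Lemma coord_support_Delta1 :
  (forall i : 'I_n, i != z -> exists a,
     [/\ Phi a, nonneg a, a 0 z = 0 & a 0 i != 0]) ->
  coord_support (Delta1 X l) = [set i | i != z].
Proof.
move=> ex; apply/seteqP; split=> i /=.
  case=> a [_ /m1_eqP a0]; apply: contraNneq => ->.
  by rewrite -a0.
move=> /ex[a [Pa na a0 ai]]; exists a => //; exact: Delta1_nonneg.
Qed.

End FirstCoordinate.

Lemma D_rootsP (i j : 'I_n) (s t : bool) : i != j ->
  D_roots ((-1) ^+ s *: e i + (-1) ^+ t *: e j).
Proof. by move=> ij; exists i, j, s, t. Qed.

Lemma D_roots_add (i j : 'I_n) : i != j -> D_roots (e i + e j).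
Proof. by move/(D_rootsP false false); rewrite !scale1r. Qed.

Lemma D_roots_sub (i j : 'I_n) : i != j -> D_roots (e i - e j).
Proof. by move/(D_rootsP false true); rewrite scale1r scaleN1r. Qed.

Lemma root_diff (i j : 'I_n) : i != j -> Phi (e i - e j).
Proof.
move=> ij; have Dij := D_roots_sub ij; have Aij : A_roots (e i - e j) by exists i, j.
move: Dij Aij; move: (e i - e j); rewrite /root_system /coord_dim.
by case: (X) => //= a; left.
Qed.

Lemma root_opp a : Phi a -> Phi (- a).
Proof.
have Aopp m (b : 'rV[int]_m) : A_roots b -> A_roots (- b).
  by case=> i [j [ij ->]]; exists j, i; rewrite eq_sym opprB.
have sgnN (s : bool) m (b : 'rV[int]_m) : - ((-1) ^+ s *: b) = (-1) ^+ (~~ s) *: b.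
  by case: s; rewrite ?scaleN1r ?scale1r ?opprK.
have Dopp m (b : 'rV[int]_m) : D_roots b -> D_roots (- b).
  case=> i [j [s [t [ij ->]]]]; exists i, j, (~~ s), (~~ t).
  by rewrite opprD !sgnN.
move: a; rewrite /root_system /coord_dim; case: (X) => a.
- exact: Aopp.
- case=> [/Dopp|[i [s ->]]]; [by left|right].
  by exists i, (~~ s); rewrite sgnN.
- case=> [/Dopp|[i [s ->]]]; [by left|right].
  by exists i, (~~ s); rewrite sgnN.
- exact: Dopp.
Qed.

Lemma positive_diff (i j : 'I_n) : (i < j)%N -> positive_roots X l (e i - e j).
Proof.
move=> ij; split; last exact/nonneg_diff/ltn_ord/ltnW.
by apply: root_diff; rewrite -val_eqE ltn_eqF.
Qed.

Lemma negative_diff (i j : 'I_n) : (j < i)%N -> negative_roots X l (e i - e j).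
Proof. by move=> ji; rewrite /negative_roots /= opprB; apply: positive_diff. Qed.

End Roots.

Section NonnegativeSums.
Variable l : nat.
Implicit Types i j : 'I_l.

Lemma nonneg_B i : nonneg_combination (X := TypeB) (evec l i).
Proof.
have ll : (l.-1 < l)%N by have := ltn_ord i; lia.
have -> : evec l i = (evec l i - evec l l.-1) + simple_root TypeB l (Ordinal ll).
  by rewrite /simple_root /= prednK ?eqxx ?subrK //; have := ltn_ord i; lia.
apply: nonnegD; last exact: nonneg_simple.
by apply: nonneg_diff => //; have := ltn_ord i; rewrite /=; lia.
Qed.

Lemma nonneg_sum_B i j : nonneg_combination (X := TypeB) (evec l i + evec l j).
Proof. exact: (nonnegD (nonneg_B i) (nonneg_B j)). Qed.

Lemma nonneg_sum_C i j : nonneg_combination (X := TypeC) (evec l i + evec l j).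
Proof.
have ll : (l.-1 < l)%N by have := ltn_ord i; lia.
have -> : evec l i + evec l j = (evec l i - evec l l.-1)
    + ((evec l j - evec l l.-1) + simple_root TypeC l (Ordinal ll)).
  rewrite /simple_root /= prednK ?eqxx; last by have := ltn_ord i; lia.
  by apply/rowP => k; rewrite mulr2n !mxE; ring.
apply: nonnegD; last apply: nonnegD; last exact: nonneg_simple.
  by apply: nonneg_diff => //; have := ltn_ord i; rewrite /=; lia.
by apply: nonneg_diff => //; have := ltn_ord j; rewrite /=; lia.
Qed.

Lemma nonneg_sum_D i j : i != j -> nonneg_combination (X := TypeD) (evec l i + evec l j).
Proof.
wlog ij : i j / (i < j)%N => [hw ij|_].
  have [lt|gt|/val_inj e] := ltngtP i j; first exact: hw.
    by rewrite addrC; apply: hw => //; rewrite eq_sym.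
  by rewrite e eqxx in ij.
have ll : (l.-1 < l)%N by have := ltn_ord i; lia.
have -> : evec l i + evec l j = (evec l i - evec l l.-2)
    + ((evec l j - evec l l.-1) + simple_root TypeD l (Ordinal ll)).
  rewrite /simple_root /= prednK ?eqxx; last by have := ltn_ord i; lia.
  by apply/rowP => k; rewrite !mxE; ring.
apply: nonnegD; last apply: nonnegD; last exact: nonneg_simple.
  by apply: nonneg_diff => //; have := ltn_ord j; rewrite /=; lia.
by apply: nonneg_diff => //; have := ltn_ord j; rewrite /=; lia.
Qed.

End NonnegativeSums.

Lemma height_sgn n (s : bool) (a : 'rV[int]_n) :
  height ((-1) ^+ s *: a) = if s then - height a else height a.
Proof. by rewrite heightZ; case: s; rewrite ?mulN1r ?mul1r. Qed.

Lemma highest_root_A l amax : highest_root (X := TypeA) (l := l) amax ->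
  (0 < l)%N -> amax = evec l.+1 0 - evec l.+1 l.
Proof.
move=> hmax l0; have [[i [j [ij e]]] _] := hmax.
have : height (evec l.+1 0 - evec l.+1 l) <= height amax.
  apply: (highest_root_height hmax); exists ord0, ord_max; split=> //.
  by rewrite -val_eqE /= ltn_eqF.
rewrite e !(heightD, heightN) !height_evec //= => h.
by have [-> ->] : i = 0%N :> nat /\ j = l :> nat
  by have /= := ltn_ord i; have /= := ltn_ord j; lia.
Qed.

Lemma highest_root_C l amax : highest_root (X := TypeC) (l := l) amax ->
  (0 < l)%N -> amax = evec l 0 *+ 2.
Proof.
move=> hmax l0; have : height (evec l 0 *+ 2) <= height amax.
  apply: (highest_root_height hmax); right; exists (Ordinal l0), false.
  by rewrite scale1r.
case: hmax => /= + _; rewrite mulr2n heightD height_evec //.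
case=> [[i [j [s [t [ij ->]]]]]|[i [s ->]]] h.
  exfalso; move: h ij; rewrite heightD !height_sgn !height_evec // -val_eqE /=.
  by case: s; case: t; have /= := ltn_ord i; have /= := ltn_ord j; lia.
have [-> ->] : s = false /\ i = 0%N :> nat; last by rewrite scale1r.
move: h; rewrite height_sgn mulr2n heightD height_evec //.
by case: s; have /= := ltn_ord i; lia.
Qed.

Lemma highest_root_BD X l (amax : 'rV[int]_(coord_dim X l)) :
  X = TypeB \/ X = TypeD -> highest_root amax -> (1 < l)%N ->
  amax = evec (coord_dim X l) 0 + evec (coord_dim X l) 1.
Proof.
move=> XBD hmax l1; have l0 : (0 < l)%N by apply: ltnW.
have DE : @D_roots l (evec l 0 + evec l 1).
  exact: (@D_roots_add TypeD l (Ordinal l0) (Ordinal l1)).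
have case_D a : @D_roots l a -> height (evec l 0 + evec l 1) <= height a ->
    a = evec l 0 + evec l 1.
  case=> i [j [s [t [ij ->]]]]; move: ij.
  rewrite !heightD !height_sgn !height_evec // -val_eqE /=.
  move=> ij h; have [s0 t0 e] : [/\ s = false, t = false &
      (i = 0%N :> nat /\ j = 1%N :> nat) \/ (i = 1%N :> nat /\ j = 0%N :> nat)].
    by move: h; case: (s); case: (t); have /= := ltn_ord i; have /= := ltn_ord j;
      split=> //; lia.
  by rewrite s0 t0 !scale1r; case: e => [[-> ->]|[-> ->]] //; rewrite addrC.
case: XBD hmax => eX; subst X; move: amax => /= amax hmax.
  have := highest_root_height hmax (or_introl DE).
  case: hmax => -[/case_D //|[i [s ->]]] _.
  rewrite heightD height_sgn !height_evec // => h.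
  by exfalso; move: h; case: s; have /= := ltn_ord i; lia.
by have := highest_root_height hmax DE; case: hmax => /case_D.
Qed.

(** * Congruence subgroups and products of unipotent subgroups *)

Section CongruenceMatrices.
Variables (R : comPzRingType) (I : set R).
Hypothesis idI : is_ideal I.

Definition mx_in m n (A : 'M[R]_(m, n)) : Prop := forall i j, I (A i j).

Lemma mx_in0 m n : mx_in (0 : 'M[R]_(m, n)).
Proof. by move=> i j; rewrite mxE; apply: ideal0. Qed.

Lemma mx_inD m n (A B : 'M[R]_(m, n)) : mx_in A -> mx_in B -> mx_in (A + B).
Proof. by move=> IA IB i j; rewrite mxE; apply: idealD. Qed.

Lemma mx_inN m n (A : 'M[R]_(m, n)) : mx_in A -> mx_in (- A).
Proof. by move=> IA i j; rewrite mxE; apply: idealN. Qed.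

Lemma mx_inB m n (A B : 'M[R]_(m, n)) : mx_in A -> mx_in B -> mx_in (A - B).
Proof. by move=> IA IB; apply: mx_inD => //; apply: mx_inN. Qed.

Lemma mx_inMl m n p (A : 'M[R]_(m, n)) (B : 'M[R]_(n, p)) :
  mx_in B -> mx_in (A *m B).
Proof.
by move=> IB i j; rewrite mxE; apply: ideal_sum => // k _; apply: idealMl.
Qed.

Lemma mx_inMr m n p (A : 'M[R]_(m, n)) (B : 'M[R]_(n, p)) :
  mx_in A -> mx_in (A *m B).
Proof.
by move=> IA i j; rewrite mxE; apply: ideal_sum => // k _; apply: idealMr.
Qed.

Lemma mx_inZ m n s (A : 'M[R]_(m, n)) : I s -> mx_in (s *: A).
Proof. by move=> Is i j; rewrite mxE; apply: idealMr. Qed.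

Lemma mx_in_trans m n (A B C : 'M[R]_(m, n)) :
  mx_in (A - B) -> mx_in (B - C) -> mx_in (A - C).
Proof. by move=> IA IB; rewrite -(subrK B A) -addrA; apply: mx_inD. Qed.

End CongruenceMatrices.

Definition col_act (R : comPzRingType) X l (h : 'M[R]_(rep_dim X l))
    (x y : 'cV[R]_(rep_dim X l)) : Prop := h *m x = y.

Lemma col_actM (R : comPzRingType) X l (g h : 'M[R]_(rep_dim X l)) x y z :
  col_act h x y -> col_act g y z -> col_act (g *m h) x z.
Proof. by move=> hx gy; rewrite /col_act -mulmxA hx. Qed.

Lemma col_actV (R : comPzRingType) X l (g h : 'M[R]_(rep_dim X l)) x y :
  g *m h = 1%:M -> col_act g x y -> col_act h y x.
Proof. by move=> gh gx; rewrite /col_act -gx mulmxA (mulmx1C gh) mul1mx. Qed.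

Section Groups.
Variables (R : comPzRingType) (X : classical_type) (l : nat) (I : set R).
Hypothesis idI : is_ideal I.
Local Notation Mat := 'M[R]_(rep_dim X l).
Local Notation root := 'rV[int]_(coord_dim X l).
Local Notation Phi := (root_system X l).
Local Notation is_subgroup := (@is_subgroup R X l).
Local Notation U := (@unipotent_subgroup R X l).
Implicit Types (g h u : Mat) (Sigma : set root).

Lemma unipotent_subgroup_gen Sigma a s :
  Sigma a -> I s -> U Sigma I (root_unipotent a s).
Proof. by move=> Sa Is H [_ sub]; apply: sub; exists a, s. Qed.

Lemma unipotent_subgroup1 Sigma : U Sigma I 1%:M.
Proof. by move=> H [[H1 _ _] _]. Qed.

Lemma unipotent_subgroupM Sigma g h :
  U Sigma I g -> U Sigma I h -> U Sigma I (g *m h).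
Proof.
by move=> Ug Uh H CH; have [[_ HM _] _] := CH; apply: HM; [apply: Ug|apply: Uh].
Qed.

Lemma unipotent_subgroupV Sigma g h :
  U Sigma I g -> g *m h = 1%:M -> U Sigma I h.
Proof.
by move=> Ug gh H CH; have [[_ _ HV] _] := CH; apply: HV gh; apply: Ug.
Qed.

Lemma unipotent_subgroup_sub Sigma H :
  is_subgroup H -> (forall a s, Sigma a -> I s -> H (root_unipotent a s)) ->
  U Sigma I `<=` H.
Proof. by move=> sgH genH g; apply; split=> // _ [a [s [Sa Is ->]]]; apply: genH. Qed.

(** Elements [1 + B i] with [B i *m B j = 0] multiply by adding the [B i]: this
    is how the unipotent elements of the proof are factored into root
    elements. *)
Lemma unipotent_subgroup_sum Sigma (J : finType) (D : pred J) (B : J -> Mat) :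
  (forall i j, D i -> D j -> B i *m B j = 0) ->
  (forall i, D i -> U Sigma I (1%:M + B i)) ->
  U Sigma I (1%:M + \sum_(i | D i) B i).
Proof.
move=> BB UB.
suff [] : U Sigma I (1%:M + \sum_(i | D i) B i)
    /\ forall j, D j -> B j *m \sum_(i | D i) B i = 0 by [].
elim/big_rec: _ => [|i S Di [US BS]].
  by rewrite addr0; split=> [|j _]; [exact: unipotent_subgroup1|rewrite mulmx0].
split=> [|j Dj]; last by rewrite mulmxDr BB // BS // addr0.
rewrite addrA; have -> : 1%:M + B i + S = (1%:M + B i) *m (1%:M + S).
  by rewrite mulmxDl mul1mx mulmxDr mulmx1 BS // addr0 addrAC.
by apply: unipotent_subgroupM => //; apply: UB.
Qed.

Lemma root_unipotent0 (a : root) : root_unipotent a (0 : R) = 1%:M.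
Proof. by rewrite /root_unipotent scale0r addr0. Qed.

Lemma congruence_is_subgroup (G : set Mat) :
  is_subgroup G -> is_subgroup (congruence_subgroup G I).
Proof.
case=> G1 GM GV; split=> [|g h [Gg Ig] [Gh Ih]|g h [Gg Ig] gh].
- by split=> // i j; rewrite subrr mxE; apply: ideal0.
- split; first exact: GM.
  apply: (mx_in_trans idI (B := h)) => //.
  by rewrite -{2}[h]mul1mx -mulmxBl; apply: mx_inMr.
- split; first exact: GV gh.
  move=> i j; rewrite -opprB mxE; apply: idealN => //; move: i j.
  rewrite -gh -{2}[h]mul1mx -mulmxBl; exact: mx_inMr.
Qed.

(** The hypotheses below reduce the decomposition of the congruence subgroup to
    two facts about its action on a set with a base point [x0]: the points [x] of
    the orbit of [x0] can be moved by [U(Phi^+, I)] and [U(Phi^-, I)] into the image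
    of [x0] under the two middle factors, and an element of the stabiliser of
    [x0] belongs to [GDelta] after multiplication by an element of
    [U(Sigma_1^+, I)].  [act g x y] says that [g] maps [x] to [y]. *)
Section Decomposition.
Variable amax : root.
Local Notation G := (chevalley_group R X l).
Local Notation GDelta := (chevalley_group_Delta1 R X l).
Hypothesis G_subgroup : is_subgroup G.
Hypothesis root_vector_sq : forall a : root, Phi a ->
  root_vector R a *m root_vector R a = 0.
Hypothesis G_root : forall (a : root) s, Phi a -> G (root_unipotent a s).
Hypothesis GDelta_sub : GDelta `<=` G.
Hypothesis Phi_amax : Phi amax.

Local Notation GI := (congruence_subgroup G I).

Lemma root_unipotentD (a : root) s t : Phi a ->
  root_unipotent a s *m root_unipotent a t = root_unipotent (R := R) a (s + t).
Proof.
move=> Pa; rewrite /root_unipotent mulmxDl mul1mx mulmxDr mulmx1.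
rewrite -scalemxAl -scalemxAr root_vector_sq // !scaler0 addr0 scalerDl addrA.
by rewrite addrAC.
Qed.

Lemma root_unipotentK (a : root) s : Phi a ->
  root_unipotent a s *m root_unipotent a (- s) = 1%:M :> Mat.
Proof. by move=> Pa; rewrite root_unipotentD // subrr root_unipotent0. Qed.

Lemma unipotent_subgroup_inv Sigma g : Sigma `<=` Phi -> U Sigma I g ->
  exists2 h, U Sigma I h & g *m h = 1%:M.
Proof.
move=> sP Ug.
suff [] : [set g | U Sigma I g /\ exists2 h, U Sigma I h & g *m h = 1%:M] g by [].
apply: (unipotent_subgroup_sub (Sigma := Sigma)) Ug => [|a s Sa Is].
  split=> [|g1 g2 [U1 [h1 V1 e1]] [U2 [h2 V2 e2]]|g1 g2 [U1 [h1 V1 e1]] e2].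
  - split; first exact: unipotent_subgroup1.
    by exists 1%:M; [exact: unipotent_subgroup1|rewrite mulmx1].
  - split; first exact: unipotent_subgroupM.
    exists (h2 *m h1); first exact: unipotent_subgroupM.
    by rewrite mulmxA -(mulmxA g1) e2 mulmx1.
  - split; first exact: unipotent_subgroupV e2.
    by exists g1 => //; apply: mulmx1C.
split; first exact: unipotent_subgroup_gen.
exists (root_unipotent a (- s)); last exact/root_unipotentK/sP.
by apply: unipotent_subgroup_gen => //; apply: idealN.
Qed.

Lemma unipotent_subgroup_cong Sigma : Sigma `<=` Phi -> U Sigma I `<=` GI.
Proof.
move=> sP; apply: unipotent_subgroup_sub => [|a s Sa Is].
  exact: congruence_is_subgroup.
split; first exact/G_root/sP.
by rewrite /root_unipotent addrC addKr; apply: mx_inZ.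
Qed.

Lemma z_elt_cong r : I r -> GI (z_elt (- amax) r 1).
Proof.
move=> Ir; rewrite /z_elt opprK; have PN := root_opp Phi_amax.
have [_ GM _] := G_subgroup.
split; first by apply: (GM); [apply: (GM)|]; apply: G_root.
apply: (mx_in_trans idI (B := root_unipotent amax (- 1) *m root_unipotent amax 1)).
  rewrite -mulmxBl; apply: mx_inMr => //.
  rewrite -{2}[root_unipotent amax (- 1)]mulmx1 -mulmxBr; apply: mx_inMl => //.
  by rewrite /root_unipotent addrC addKr; apply: mx_inZ.
rewrite root_unipotentD // addNr root_unipotent0 subrr.
exact: mx_in0.
Qed.

Lemma positive_root_sub : positive_roots X l `<=` Phi. Proof. by move=> a []. Qed.

Lemma negative_root_sub : negative_roots X l `<=` Phi.
Proof. by move=> a [/root_opp]; rewrite opprK. Qed.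

Lemma Sigma1_pos_sub : Sigma1_pos X l `<=` Phi. Proof. by move=> a []. Qed.

Lemma Sigma1_neg_sub : Sigma1_neg X l `\ (- amax) `<=` Phi.
Proof. by move=> a [[/root_opp]]; rewrite opprK. Qed.

Variables (T : Type) (act : Mat -> T -> T -> Prop) (x0 : T).
Hypothesis actM : forall g h x y z, act h x y -> act g y z -> act (g *m h) x z.
Hypothesis actV : forall g h x y, g *m h = 1%:M -> act g x y -> act h y x.
Hypothesis act_dom : forall g, GI g -> exists x, act g x0 x.

Definition reach (Sigma : set root) (x y : T) : Prop :=
  exists2 u, U Sigma I u & act u x y.

Lemma reach_trans Sigma x y z : reach Sigma x y -> reach Sigma y z -> reach Sigma x z.
Proof.
move=> [u Uu uxy] [v Uv vyz]; exists (v *m u); last exact: actM vyz.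
exact: unipotent_subgroupM.
Qed.

Hypothesis moves : forall g x, GI g -> act g x0 x ->
  exists y z, [/\ reach (positive_roots X l) x y, reach (negative_roots X l) y z &
    exists r w, [/\ I r, U (Sigma1_neg X l `\ (- amax)) I w &
      act (z_elt (- amax) r 1 *m w) x0 z]].
Hypothesis stabilizer : forall g, GI g -> act g x0 x0 ->
  exists2 s, U (Sigma1_pos X l) I s & GI (s *m g) -> GDelta (s *m g).

Definition decomposes_at : Prop :=
  GI = U (positive_roots X l) I :*m: U (negative_roots X l) I
    :*m: Z_set amax I :*m: U (Sigma1_neg X l `\ (- amax)) I
    :*m: U (Sigma1_pos X l) I :*m: congruence_subgroup GDelta I.

Lemma congruence_decomposition : decomposes_at.
Proof.
have [_ GIM GIV] := congruence_is_subgroup G_subgroup.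
have Upos := unipotent_subgroup_cong positive_root_sub.
have Uneg := unipotent_subgroup_cong negative_root_sub.
have Vneg := unipotent_subgroup_cong Sigma1_neg_sub.
have Spos := unipotent_subgroup_cong Sigma1_pos_sub.
apply/seteqP; split=> [g GIg|_ [_ [_ [_ [_ [u Uu [v Uv <-]] [_ [r Ir <-] <-]]
    [w Uw <-]] [s Us <-]] [d [GDd Id] <-]]]; last first.
  apply: (GIM); last by split=> //; apply: GDelta_sub.
  apply: (GIM); last exact: Spos.
  apply: (GIM); last exact: Vneg.
  apply: (GIM); last exact: z_elt_cong.
  by apply: (GIM); [apply: Upos|apply: Uneg].
have [x gx] := act_dom GIg.
have [y [z [[u Uu uxy] [v Uv vyz] [r [w [Ir Uw zwz]]]]]] := moves GIg gx.
have [u' Uu' uu'] := unipotent_subgroup_inv positive_root_sub Uu.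
have [v' Uv' vv'] := unipotent_subgroup_inv negative_root_sub Uv.
have [w' Uw' ww'] := unipotent_subgroup_inv Sigma1_neg_sub Uw.
set t := z_elt (- amax) r 1 in zwz.
pose t' : Mat := z_elt (- amax) (- r) 1.
have tt' : t *m t' = 1%:M.
  rewrite /t /t' /z_elt opprK -!mulmxA.
  rewrite [root_unipotent amax 1 *m _]mulmxA root_unipotentK // mul1mx.
  rewrite [root_unipotent (- amax) r *m _]mulmxA root_unipotentK ?mul1mx //.
    by rewrite root_unipotentD // addNr root_unipotent0.
  exact: root_opp.
have GIt : GI t by apply: z_elt_cong.
have GIt' : GI t' by apply: z_elt_cong; apply: idealN.
pose h := w' *m (t' *m (v *m (u *m g))).
have tw : (t *m w) *m (w' *m t') = 1%:M.
  by rewrite mulmxA -(mulmxA t) ww' mulmx1.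
have GIh : GI h.
  apply: (GIM); first exact: Vneg.
  apply: (GIM) => //; apply: (GIM); first exact: Uneg.
  by apply: (GIM) => //; apply: Upos.
have [|s Us GDs] := stabilizer GIh.
  rewrite /h mulmxA; apply: (actM (y := z)); last exact: actV tw zwz.
  by apply: actM vyz; apply: actM uxy.
have [s' Us' ss'] := unipotent_subgroup_inv Sigma1_pos_sub Us.
have GIs : GI (s *m h) by apply: (GIM) => //; apply: Spos.
have gE : g = u' *m (v' *m (t *m (w *m h))).
  rewrite /h (mulmxA w) ww' mul1mx (mulmxA t) tt' mul1mx.
  by rewrite (mulmxA v') (mulmx1C vv') mul1mx mulmxA (mulmx1C uu') mul1mx.
exists (u' *m v' *m t *m w *m s'); last first.
  exists (s *m h); first by split; [apply: GDs|case: GIs].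
  by rewrite gE (mulmxA _ s) -(mulmxA _ s') (mulmx1C ss') mulmx1 !mulmxA.
exists (u' *m v' *m t *m w); last by exists s'.
exists (u' *m v' *m t); last by exists w.
exists (u' *m v'); first by exists u' => //; exists v'.
by exists t => //; exists r.
Qed.

End Decomposition.
End Groups.

(** * Comparison of roots *)

Section RootEquality.
Variable n : nat.
Implicit Types i j a b : 'I_n.
Local Notation e := (evec n).

Lemma evec_sub_eq i j a b : i != j ->
  (e i - e j == e a - e b) = (a == i) && (b == j).
Proof.
move=> ij; apply/eqP/andP => [/rowP E|[/eqP-> /eqP->]//].
have := E i; have := E j; rewrite !mxE !eqxx !val_eqE (negbTE ij).
rewrite ![_ == i]eq_sym ![_ == j]eq_sym [j == i]eq_sym (negbTE ij).
by case: (i == a); case: (i == b); case: (j == a); case: (j == b).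
Qed.

Lemma evec_inj i j : e i = e j -> i = j.
Proof.
by move/rowP/(_ i); rewrite !mxE eqxx val_eqE; case: eqVneq.
Qed.

Lemma evec_add_eq i j a b :
  (e i + e j == e a + e b) = (a == i) && (b == j) || (a == j) && (b == i).
Proof.
apply/eqP/orP => [E|[]/andP[/eqP-> /eqP->]//]; last by rewrite addrC.
case: (eqVneq a i) E => [->|ai] E; first by left; rewrite (evec_inj (addrI _ E)) !eqxx.
right; have aj : a = j.
  have /rowP/(_ a) := E; rewrite !mxE !eqxx !val_eqE (negbTE ai) add0r.
  by case: (eqVneq a j); case: (a == b).
by rewrite aj eqxx; move: E; rewrite aj addrC => /addrI/evec_inj->; rewrite eqxx.
Qed.

(** It takes the values 0, 2, -2, 1, -1 at the roots of different shapes. *)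
Definition coord_sum (a : 'rV[int]_n) : int := \sum_j a 0 j.

Lemma coord_sumD u v : coord_sum (u + v) = coord_sum u + coord_sum v.
Proof. by rewrite -big_split; apply: eq_bigr => i _; rewrite mxE. Qed.

Lemma coord_sumN u : coord_sum (- u) = - coord_sum u.
Proof. by rewrite -sumrN; apply: eq_bigr => i _; rewrite mxE. Qed.

Lemma coord_sum_evec i : coord_sum (e i) = 1.
Proof.
rewrite /coord_sum (bigD1 i) //= evecE eqxx big1 ?addr0 // => j.
by rewrite evecE val_eqE => /negbTE->.
Qed.

Lemma coord_sum_neq u v : coord_sum u != coord_sum v -> (u == v) = false.
Proof. by move=> ne; apply/eqP => uv; rewrite uv eqxx in ne. Qed.

Definition coord_sumE := (coord_sumD, coord_sumN, coord_sum_evec).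

End RootEquality.

Lemma natr_bool (R : comPzRingType) : ((true%:R = 1 :> R) * (false%:R = 0 :> R))%type.
Proof. by []. Qed.

(** * Type A *)

Section TypeA.
Variables (R : comPzRingType) (l : nat) (I : set R).
Hypothesis idI : is_ideal I.
Hypothesis l_ge2 : (2 <= l)%N.
Local Notation Mat := 'M[R]_l.+1.
Local Notation e := (evec l.+1).
Local Notation U := (@unipotent_subgroup R TypeA l).
Local Notation G := (chevalley_group R TypeA l).
Local Notation E i j := (delta_mx i j : Mat).
Implicit Types i j : 'I_l.+1.

Lemma root_vector_A i j : i != j ->
  root_vector (X := TypeA) R (e i - e j) = E i j.
Proof.
by move=> ij; apply/matrixP => a b; rewrite !mxE (evec_sub_eq _ _ ij).
Qed.

Lemma root_unipotent_A i j (s : R) : i != j ->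
  root_unipotent (X := TypeA) (l := l) (e i - e j) s = 1%:M + s *: E i j.
Proof. by move=> ij; rewrite /root_unipotent root_vector_A. Qed.

Lemma transvection_col i j s (v : 'cV[R]_l.+1) :
  (1%:M + s *: E i j) *m v = v + (s * v j 0) *: delta_mx i 0.
Proof.
rewrite mulmxDl mul1mx -scalemxAl; congr (_ + _).
apply/colP => a; rewrite !mxE (bigD1 j) //= mxE eqxx andbT big1 => [|b bj].
  by rewrite addr0; case: (a == i); rewrite ?mul1r ?mul0r ?mulr1 ?mulr0.
by rewrite mxE (negbTE bj) andbF mul0r.
Qed.

Lemma det_transvection i j (s : R) : i != j -> \det (1%:M + s *: E i j) = 1.
Proof.
have low (a b : 'I_l.+1) : (a < b)%N -> \det (1%:M + s *: E b a) = 1.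
  move=> ab; rewrite det_trig.
    rewrite big1 // => k _; rewrite !mxE eqxx; case: eqP => [->|]; last by rewrite mulr0 addr0.
    by rewrite -val_eqE /= gtn_eqF // mulr0 addr0.
  apply/is_trig_mxP => a' b' ab'; rewrite !mxE.
  have -> : (a' == b') = false by rewrite -val_eqE ltn_eqF.
  case: eqP => [ea|]; last by rewrite mulr0 addr0.
  by case: eqP => [eb|]; rewrite ?mulr0 ?addr0 //; move: ab'; rewrite ea eb; lia.
rewrite -val_eqE neq_ltn => /orP[ij|/low //].
rewrite -det_tr linearD linearZ /= trmx1 trmx_delta; exact: low.
Qed.

Lemma chevalley_A_subgroup : @is_subgroup R TypeA l G.
Proof.
split=> [|g h [dg _] [dh _]|g h [dg _] gh]; split=> //.
- exact: det1.
- by move=> i j [].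
- by rewrite det_mulmx dg dh mulr1.
- by move=> i j [].
- by rewrite -(mul1r (\det h)) -dg -det_mulmx gh det1.
- by move=> i j [].
Qed.

Lemma chevalley_A_root (a : 'rV[int]_l.+1) (s : R) : root_system TypeA l a ->
  G (root_unipotent (X := TypeA) a s).
Proof.
case=> i [j [ij ->]]; rewrite root_unipotent_A //.
by split; [apply: det_transvection|move=> ? ? []].
Qed.

Lemma root_vector_sq_A (a : 'rV[int]_l.+1) : root_system TypeA l a ->
  root_vector (X := TypeA) R a *m root_vector (X := TypeA) R a = 0.
Proof.
by case=> i [j [ij ->]]; rewrite root_vector_A // mul_delta_mx_0 // eq_sym.
Qed.

Lemma unipotent_col_A Sigma (k : 'I_l.+1) (D : pred 'I_l.+1) (b : 'I_l.+1 -> R) :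
  (forall i, D i -> i != k) -> (forall i, D i -> Sigma (e i - e k)) ->
  (forall i, I (b i)) ->
  U Sigma I (1%:M + \sum_(i | D i) b i *: E i k).
Proof.
move=> Dk DS Ib; apply: unipotent_subgroup_sum => [i j Di Dj|i Di].
  by rewrite -scalemxAl -scalemxAr mul_delta_mx_0 ?scaler0 // eq_sym Dk.
by rewrite -root_unipotent_A ?Dk //; apply: unipotent_subgroup_gen => //; apply: DS.
Qed.

Lemma unipotent_row_A Sigma (k : 'I_l.+1) (D : pred 'I_l.+1) (b : 'I_l.+1 -> R) :
  (forall i, D i -> i != k) -> (forall i, D i -> Sigma (e k - e i)) ->
  (forall i, D i -> I (b i)) ->
  U Sigma I (1%:M + \sum_(i | D i) b i *: E k i).
Proof.
move=> Dk DS Ib; apply: unipotent_subgroup_sum => [i j Di Dj|i Di].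
  by rewrite -scalemxAl -scalemxAr mul_delta_mx_0 ?scaler0 // Dk.
rewrite -root_unipotent_A; last by rewrite eq_sym Dk.
by apply: unipotent_subgroup_gen; [apply: DS|apply: Ib].
Qed.

Local Notation e0 := (delta_mx ord0 0 : 'cV[R]_l.+1).

Lemma col_sum_A (k : 'I_l.+1) (D : pred 'I_l.+1) b (v : 'cV[R]_l.+1) i :
  ((1%:M + \sum_(j | D j) b j *: E j k) *m v) i 0
  = v i 0 + (if D i then b i * v k 0 else 0).
Proof.
rewrite mulmxDl mul1mx mulmx_suml mxE summxE; congr (_ + _).
have entry j : (b j *: E j k *m v) i 0 = (i == j)%:R * (b j * v k 0).
  have := transvection_col j k (b j) v.
  rewrite mulmxDl mul1mx => /addrI->; rewrite !mxE andbT mulrC //.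
under eq_bigr do rewrite entry.
case: ifP => Di.
  rewrite (bigD1 i) //= eqxx mul1r big1 ?addr0 // => j /andP[_ ji].
  by rewrite eq_sym (negbTE ji) mul0r.
by rewrite big1 // => j Dj; case: eqP => [ij|]; rewrite ?mul0r //; rewrite ij Dj in Di.
Qed.

Lemma row_sum_A (k : 'I_l.+1) (D : pred 'I_l.+1) b (v : 'cV[R]_l.+1) :
  (1%:M + \sum_(j | D j) b j *: E k j) *m v
  = v + (\sum_(j | D j) b j * v j 0) *: delta_mx k 0.
Proof.
rewrite mulmxDl mul1mx mulmx_suml scaler_suml; congr (_ + _).
apply: eq_bigr => j _; have := transvection_col k j (b j) v.
by rewrite mulmxDl mul1mx => /addrI.
Qed.

Lemma mulmx_e0 (A : Mat) i : (A *m e0) i 0 = A i ord0.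
Proof. by rewrite -colE mxE. Qed.

Lemma ord0_neq i : i != ord0 -> (0%N == i :> nat) = false.
Proof. by rewrite -val_eqE /= eq_sym => /negbTE. Qed.

(** A vector is in the image of [e0] under the two middle factors if its first
    and last coordinates add up to 1, the others being arbitrary elements of
    [I].  The stable rank condition makes the coordinates other than the last
    one comaximal by adding to them multiples of the last one, in [U(Phi^+, I)];
    a Bezout relation then gives the last coordinate the required value, in
    [U(Phi^-, I)]. *)
Lemma moves_A (g : Mat) x : SR_on I 'I_l.+1 -> congruence_subgroup G I g ->
  g *m e0 = x ->
  let act := @col_act R TypeA l in
  let amax := e (ord0 : 'I_l.+1) - e (ord_max : 'I_l.+1) in
  exists y z, [/\ reach I act (positive_roots TypeA l) x y,
    reach I act (negative_roots TypeA l) y z &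
    exists r w, [/\ I r, U (Sigma1_neg TypeA l `\ (- amax)) I w &
      act (z_elt (R := R) (X := TypeA) (- amax) r 1 *m w) e0 z]].
Proof.
move=> sr [[dg _] Ig] gx act amax.
pose k : 'I_l.+1 := ord_max.
have k0 : ord0 != k by rewrite -val_eqE /= eq_sym -lt0n ltnW.
have ltk i : i != k -> (i < k)%N.
  by rewrite -val_eqE /= => ik; rewrite ltn_neqAle ik -ltnS ltn_ord.
have xE i : x i 0 = g i ord0.
  by rewrite -gx mulmx_e0.
have Ix i : I (x i 0 - (i == ord0)%:R).
  by have := Ig i ord0; rewrite !mxE xE.
have Ixk : I (x k 0) by have := Ix k; rewrite eq_sym (negbTE k0) subr0.
have unim K : is_ideal K -> (forall j, j != k -> K (x j 0)) -> K (x k 0) -> K 1.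
  move=> idK Kx Kk.
  have <- : (\adj g *m g) ord0 ord0 = 1 by rewrite mul_adj_mx dg mxE.
  rewrite mxE; apply: ideal_sum => // j _; apply: idealMl => //; rewrite -xE.
  by case: (eqVneq j k) => [->|/Kx].
have [b Ib b1] := sr k ord0 (fun j => x j 0) (x k 0) k0 (fun j _ => Ix j) Ixk unim.
have [d d1] := comaximal_coef (D := fun j => j != k) b1.
have [y yx] : exists y, (1%:M + \sum_(j | j != k) b j *: E j k) *m x = y by eexists.
have yE i : y i 0 = if i == k then x k 0 else x i 0 + b i * x k 0.
  by rewrite -yx col_sum_A; case: (eqVneq i k) => [->|]; rewrite ?addr0.
(* The value of the last coordinate of [z]. *)
pose r := 1 - y ord0 0.
have Iy0 : I r.
  rewrite /r yE (negbTE k0) -opprB; apply: idealN => //.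
  rewrite addrAC; apply: idealD; [exact: idI|exact: (Ix ord0)|exact: idealMl].
pose t j := (r - x k 0) * d j.
have [z zy] : exists z, (1%:M + \sum_(j | j != k) t j *: E k j) *m y = z by eexists.
have zE i : z i 0 = if i == k then r else y i 0.
  rewrite -zy row_sum_A !mxE andbT; case: (eqVneq i k) => [->|_].
    rewrite yE eqxx mulr1 /t.
    under eq_bigr => j jk do rewrite yE (negbTE jk) -mulrA.
    by rewrite -mulr_sumr d1 mulr1 addrC subrK.
  by rewrite mulr0 addr0.
pose D := [pred i : 'I_l.+1 | (i != k) && (i != ord0)].
exists y, z; split.
- eexists; last exact: yx.
  apply: unipotent_col_A => // i ik; by apply: (@positive_diff TypeA l); apply: ltk.
- eexists; last exact: zy.
  apply: unipotent_row_A => // i ik; first by apply: (@negative_diff TypeA l); apply: ltk.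
  by apply: idealMr => //; apply: idealB.
have Iyi i : D i -> I (y i 0).
  move=> /andP[ik i0]; rewrite yE (negbTE ik); apply: idealD => //.
    by have := Ix i; rewrite (negbTE i0) subr0.
  exact: idealMl.
pose W : Mat := 1%:M + \sum_(i | D i) (if D i then y i 0 else 0) *: E i ord0.
exists r, W; split=> //.
  apply: unipotent_col_A => [i /andP[_ i0] //|i /andP[ik i0]|i]; last first.
    by case: ifP => [/Iyi//|_]; apply: ideal0.
  split; last first.
    rewrite /amax opprB => /eqP; rewrite evec_sub_eq // eqxx andbT eq_sym.
    by rewrite (negbTE ik).
  rewrite /Sigma1_neg /= opprB.
  apply: (@Sigma1_pos_nonneg TypeA l (ord0 : 'I_l.+1)) => //.
  - by apply: (@root_diff TypeA l (ord0 : 'I_l.+1) i); rewrite eq_sym.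
  - by apply: (@nonneg_diff TypeA l (ord0 : 'I_l.+1) i).
  - by rewrite !mxE /= ord0_neq.
rewrite /act /col_act /z_elt opprK -!mulmxA.
have [w wW] : exists w, W *m e0 = w by eexists.
have wE i : w i 0 = if i == ord0 then 1 else if i == k then 0 else y i 0.
  rewrite -wW col_sum_A !mxE /D /= andbT; case: (eqVneq i ord0) => [->|i0].
    by rewrite andbF addr0.
  by case: (eqVneq i k) => ik; rewrite /= ?addr0 // add0r mulr1.
have ru q : root_unipotent (X := TypeA) (l := l) amax q = 1%:M + q *: E ord0 k.
  exact: root_unipotent_A.
have ruN q : root_unipotent (X := TypeA) (l := l) (- amax) q = 1%:M + q *: E k ord0.
  by rewrite /amax opprB; apply: root_unipotent_A; rewrite eq_sym.
rewrite [W *m _]wW !ru !ruN !transvection_col.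
apply/colP => i; rewrite zE !mxE !andbT !wE !eqxx [k == ord0]eq_sym (negbTE k0) /=.
case: (eqVneq i ord0) => [->|i0].
  by rewrite (negbTE k0) !natr_bool /r; ring.
by case: (eqVneq i k) => [_|ik] /=; rewrite !natr_bool; ring.
Qed.

(** The first row of [g^-1] begins with 1; the row transvection [s'] with the
    same first row makes the first row of [s' *m g] equal to that of the
    identity matrix. *)
Lemma stabilizer_A (g : Mat) : congruence_subgroup G I g -> g *m e0 = e0 ->
  exists2 s : Mat, U (Sigma1_pos TypeA l) I s &
    congruence_subgroup G I (s *m g) -> chevalley_group_Delta1 R TypeA l (s *m g).
Proof.
move=> GIg ge0; have [[dg _] Ig] := GIg.
have [_ _ GIV] := congruence_is_subgroup idI chevalley_A_subgroup.
have [h gh] : exists h, g *m h = 1%:M by exists (\adj g); rewrite mul_mx_adj dg.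
have [_ Ih] := GIV _ _ GIg gh.
pose s' : Mat := 1%:M + \sum_(j | j != ord0) h ord0 j *: E ord0 j.
have Us' : U (Sigma1_pos TypeA l) I s'.
  apply: unipotent_row_A => // [i i0|i i0].
    apply: (@Sigma1_pos_nonneg TypeA l (ord0 : 'I_l.+1)) => //.
    - by apply: (@root_diff TypeA l); rewrite eq_sym.
    - by apply: (@nonneg_diff TypeA l).
    - by rewrite !mxE /= ord0_neq.
  by have := Ih ord0 i; rewrite !mxE eq_sym (negbTE i0) subr0.
have h00 : h ord0 ord0 = 1.
  have he0 : h *m e0 = e0 by rewrite -{1}ge0 mulmxA (mulmx1C gh) mul1mx.
  by rewrite -mulmx_e0 he0 mxE.
pose d := s' *m g; exists s' => // -[[dd _] _].
have de0 : d *m e0 = e0.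
  rewrite /d -mulmxA ge0 row_sum_A big1 ?scale0r ?addr0 // => j j0.
  by rewrite mxE (negbTE j0) mulr0.
have row_d j : d ord0 j = (ord0 == j)%:R.
  have -> : d ord0 j = (s' *m col j g) ord0 0 by rewrite colE mulmxA -colE [RHS]mxE.
  rewrite row_sum_A !mxE eqxx mulr1.
  have <- : (h *m g) ord0 j = (ord0 == j)%:R by rewrite (mulmx1C gh) mxE.
  rewrite [RHS]mxE [RHS](bigD1 ord0) //= h00 mul1r; congr (_ + _).
  by apply: eq_bigr => i _; rewrite mxE.
split=> //.
rewrite (@coord_support_Delta1 TypeA l (ord0 : 'I_l.+1)) // => [i j nij|i i0].
  have [i0|i0] := eqVneq i ord0; first by rewrite i0 row_d.
  have [j0|j0] := eqVneq j ord0; last by case: nij.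
  by rewrite j0 -mulmx_e0 de0 mxE andbT.
have [j [j0 ij]] : exists j : 'I_l.+1, j != ord0 /\ i != j.
  case: (eqVneq i (inord 1)) => [->|i1].
    exists (inord 2); rewrite -!val_eqE /= !inordK //; lia.
  by exists (inord 1); split=> //; rewrite -!val_eqE /= !inordK //; lia.
have [lt|gt|/val_inj eij] := ltngtP i j; last by rewrite eij eqxx in ij.
  exists (e i - e j); split.
  - exact: (@root_diff TypeA l).
  - by apply: (@nonneg_diff TypeA l); rewrite ?(ltnW lt).
  - by rewrite !mxE /= !ord0_neq.
  - by rewrite !mxE eqxx val_eqE (negbTE ij).
exists (e j - e i); split.
- by apply: (@root_diff TypeA l); rewrite eq_sym.
- by apply: (@nonneg_diff TypeA l); rewrite ?(ltnW gt).
- by rewrite !mxE /= !ord0_neq.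
- by rewrite !mxE eqxx val_eqE (negbTE ij).
Qed.

Lemma congruence_decomposition_A amax :
  highest_root (X := TypeA) amax -> sr_le I l ->
  decomposes_at (X := TypeA) (l := l) I amax.
Proof.
move=> hmax srI; have [Pmax _] := hmax.
have amaxE := highest_root_A hmax (ltnW l_ge2).
apply: (@congruence_decomposition R TypeA l I idI amax _ _ _ _ _ _
  (@col_act R TypeA l) e0) => //.
- exact: chevalley_A_subgroup.
- exact: root_vector_sq_A.
- by move=> a s; apply: chevalley_A_root.
- by move=> g [dg _]; split=> // i j [].
- exact: col_actM.
- exact: col_actV.
- by move=> g _; exists (g *m e0).
- move=> g x Gg gx; rewrite amaxE; apply: (moves_A _ Gg gx).
  exact: SR_onP srI (card_ord _).
- exact: stabilizer_A.
Qed.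

End TypeA.

(** * Type C *)

Section TypeC.
Variables (R : comPzRingType) (l : nat) (I : set R).
Hypothesis idI : is_ideal I.
Hypothesis l_ge2 : (2 <= l)%N.
Local Notation Mat := 'M[R]_(l + l).
Local Notation e := (evec l).
Local Notation U := (@unipotent_subgroup R TypeC l).
Local Notation G := (chevalley_group R TypeC l).
Local Notation J := (symplectic_form R l).
Local Notation E i j := (delta_mx i j : 'M[R]_l).
Implicit Types i j : 'I_l.

(** For [i = j] the entry is 1, not 2, as in the root vector of a long root. *)
Definition sym_delta i j : 'M[R]_l :=
  \matrix_(a, b) ((a == i) && (b == j) || (a == j) && (b == i))%:R.

Lemma sym_deltaT i j s : (s *: sym_delta i j)^T = s *: sym_delta i j.
Proof. by apply/matrixP => a b; rewrite !mxE orbC andbC [X in _ || X]andbC. Qed.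

Lemma root_vector_C_diff i j : i != j ->
  root_vector (X := TypeC) R (e i - e j) = block_mx (E i j) 0 0 (- E j i).
Proof.
move=> ij; rewrite /root_vector; congr block_mx; apply/matrixP => a b; rewrite !mxE.
- by rewrite evec_sub_eq.
- by rewrite coord_sum_neq // !coord_sumE.
- by rewrite coord_sum_neq // !coord_sumE.
- by rewrite evec_sub_eq // andbC.
Qed.

Lemma root_vector_C_sum i j :
  root_vector (X := TypeC) R (e i + e j) = block_mx 0 (sym_delta i j) 0 0.
Proof.
rewrite /root_vector; congr block_mx; apply/matrixP => a b; rewrite !mxE.
- by rewrite coord_sum_neq // !coord_sumE.
- by rewrite evec_add_eq.
- by rewrite coord_sum_neq // !coord_sumE.
- by rewrite coord_sum_neq ?oppr0 // !coord_sumE.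
Qed.

Lemma root_vector_C_opp i j :
  root_vector (X := TypeC) R (- (e i + e j)) = block_mx 0 0 (sym_delta i j) 0.
Proof.
rewrite /root_vector; congr block_mx; apply/matrixP => a b; rewrite !mxE.
- by rewrite coord_sum_neq // !coord_sumE.
- by rewrite coord_sum_neq // !coord_sumE.
- by rewrite eqr_opp evec_add_eq.
- by rewrite coord_sum_neq ?oppr0 // !coord_sumE.
Qed.

Lemma root_C_cases (a : 'rV[int]_l) : root_system TypeC l a ->
  [\/ exists i j, i != j /\ a = e i - e j, exists i j, a = e i + e j |
      exists i j, a = - (e i + e j)].
Proof.
case=> [[i [j [s [t [ij ->]]]]]|[i [s ->]]].
  case: s; case: t; rewrite ?scaleN1r ?scale1r.
  - by constructor 3; exists i, j; rewrite opprD.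
  - by constructor 1; exists j, i; rewrite eq_sym addrC.
  - by constructor 1; exists i, j.
  - by constructor 2; exists i, j.
case: s; rewrite ?scaleN1r ?scale1r mulr2n.
  by constructor 3; exists i, i.
by constructor 2; exists i, i.
Qed.

Lemma root_vector_sq_C (a : 'rV[int]_l) : root_system TypeC l a ->
  root_vector (X := TypeC) R a *m root_vector (X := TypeC) R a = 0.
Proof.
case/root_C_cases => [[i [j [ij ->]]]|[i [j ->]]|[i [j ->]]].
- rewrite root_vector_C_diff // mulmx_block !(mulmx0, mul0mx, addr0, add0r).
  rewrite mulNmx mulmxN !mul_delta_mx_0 ?oppr0 ?block_mx0 // eq_sym //.
- by rewrite root_vector_C_sum mulmx_block !(mulmx0, mul0mx, addr0) block_mx0.
- by rewrite root_vector_C_opp mulmx_block !(mulmx0, mul0mx, addr0) block_mx0.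
Qed.

Lemma chevalley_C_subgroup : @is_subgroup R TypeC l G.
Proof.
split=> [|g h [Jg _] [Jh _]|g h [Jg _] gh]; split=> //.
- by rewrite trmx1 mul1mx mulmx1.
- by move=> i j [].
- have -> : (g *m h)^T *m J *m (g *m h) = h^T *m (g^T *m J *m g) *m h.
    by rewrite trmx_mul !mulmxA.
  by rewrite Jg.
- by move=> i j [].
- by rewrite -{1}Jg !mulmxA -trmx_mul gh trmx1 mul1mx -mulmxA gh mulmx1.
- by move=> i j [].
Qed.

Lemma chevalley_C_root (a : 'rV[int]_l) (s : R) : root_system TypeC l a ->
  G (root_unipotent (X := TypeC) a s).
Proof.
move=> Pa; split; last by move=> ? ? [].
rewrite /root_unipotent /symplectic_form.
case/root_C_cases: Pa => [[i [j [ij ->]]]|[i [j ->]]|[i [j ->]]].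
- rewrite root_vector_C_diff // scalar_mx_block scale_block_mx add_block_mx.
  rewrite !scaler0 !addr0 scalerN.
  have AD : (1%:M + s *: E i j)^T *m (1%:M - s *: E j i) = 1%:M.
    have -> : (1%:M + s *: E i j)^T = 1%:M + s *: E j i.
      by apply/matrixP => i0 j0; rewrite !mxE eq_sym andbC.
    rewrite mulmxDl mul1mx mulmxBr mulmx1.
    by rewrite -scalemxAl -scalemxAr mul_delta_mx_0 // !scaler0 subr0 subrK.
  have DA := congr1 trmx AD; rewrite trmx_mul trmxK trmx1 in DA.
  rewrite tr_block_mx !mulmx_block !(mulmx0, mul0mx, addr0, add0r, trmx0).
  by rewrite !(mulmx1, mulmxN, mulNmx) AD DA.
- rewrite root_vector_C_sum scalar_mx_block scale_block_mx add_block_mx.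
  rewrite !scaler0 !addr0 tr_block_mx !mulmx_block.
  rewrite !(mulmx0, mul0mx, addr0, add0r, mulmx1, mul1mx, trmx0, trmx1, mulmxN, mulNmx).
  by rewrite sym_deltaT ?(addNr, subrr) !oppr0 ?add0r ?addr0.
- rewrite root_vector_C_opp scalar_mx_block scale_block_mx add_block_mx.
  rewrite !scaler0 !addr0 tr_block_mx !mulmx_block.
  rewrite !(mulmx0, mul0mx, addr0, add0r, mulmx1, mul1mx, trmx0, trmx1, mulmxN, mulNmx).
  by rewrite sym_deltaT addNr.
Qed.

Lemma sum_sym_delta (M : 'M[R]_l) : (forall i j, M i j = M j i) ->
  \sum_(q : 'I_l * 'I_l | (q.1 <= q.2)%N) M q.1 q.2 *: sym_delta q.1 q.2 = M.
Proof.
move=> symM; apply/matrixP => a b.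
wlog ab : a b / (a <= b)%N => [hw|].
  have [/hw//|/ltnW/hw e'] := leqP a b; rewrite symM -e' !summxE.
  by apply: eq_bigr => q _; rewrite !mxE orbC andbC [X in _ || X]andbC.
rewrite summxE (bigD1 (a, b)) //= !mxE !eqxx mulr1 big1 ?addr0 // => -[i j] /=.
case/andP=> ij ne; rewrite !mxE.
have [/orP[]/andP[/eqP ea /eqP eb]|_] := boolP (_ || _); last exact: mulr0.
  by rewrite ea eb eqxx in ne.
have /val_inj eij : i = j :> nat by apply/eqP; rewrite eqn_leq ij -ea -eb ab.
by rewrite ea eb eij eqxx in ne.
Qed.

Definition up (M : 'M[R]_l) : Mat := block_mx 1%:M M 0 1%:M.
Definition lo (M : 'M[R]_l) : Mat := block_mx 1%:M 0 M 1%:M.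

(** The positive and the negative roots of the shape [e i + e j] are treated
    together: [F] is the embedding of one of the off-diagonal blocks. *)
Lemma unipotent_block Sigma (F : 'M[R]_l -> Mat) (a : 'I_l -> 'I_l -> 'rV[int]_l)
    (M : 'M[R]_l) :
  (forall A B, F (A + B) = F A + F B) -> (forall k A, F (k *: A) = k *: F A) ->
  (forall A B, F A *m F B = 0) ->
  (forall i j, root_vector (X := TypeC) R (a i j) = F (sym_delta i j)) ->
  (forall i j, M i j = M j i) -> (forall i j, I (M i j)) ->
  (forall i j, Sigma (a i j) \/ M i j = 0) -> U Sigma I (1%:M + F M).
Proof.
move=> FD FZ FM rvE symM IM SM.
have -> : F M = \sum_(q : 'I_l * 'I_l | (q.1 <= q.2)%N)
    M q.1 q.2 *: root_vector (X := TypeC) R (a q.1 q.2).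
  rewrite -{1}(sum_sym_delta symM).
  apply: (big_rec2 (fun A B => F A = B)) => [|q A B _ <-].
    by rewrite -[X in F X](scale0r 0) FZ scale0r.
  by rewrite FD FZ rvE.
apply: unipotent_subgroup_sum => [p q _ _|q _].
  by rewrite -scalemxAl -scalemxAr !rvE FM !scaler0.
have [Sq|->] := SM q.1 q.2; last by rewrite scale0r addr0; apply: unipotent_subgroup1.
exact: unipotent_subgroup_gen.
Qed.

Lemma unipotent_up Sigma (M : 'M[R]_l) : (forall i j, M i j = M j i) ->
  (forall i j, I (M i j)) -> (forall i j, Sigma (e i + e j) \/ M i j = 0) ->
  U Sigma I (up M).
Proof.
have -> : up M = 1%:M + block_mx 0 M 0 0.
  by rewrite scalar_mx_block add_block_mx !(addr0, add0r).
apply: (unipotent_block (F := fun A => block_mx 0 A 0 0) (a := fun i j => e i + e j)).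
- by move=> A B; rewrite add_block_mx !addr0.
- by move=> k A; rewrite scale_block_mx !scaler0.
- by move=> A B; rewrite mulmx_block !(mulmx0, mul0mx, addr0) block_mx0.
- exact: root_vector_C_sum.
Qed.

Lemma unipotent_lo Sigma (M : 'M[R]_l) : (forall i j, M i j = M j i) ->
  (forall i j, I (M i j)) -> (forall i j, Sigma (- (e i + e j)) \/ M i j = 0) ->
  U Sigma I (lo M).
Proof.
have -> : lo M = 1%:M + block_mx 0 0 M 0.
  by rewrite scalar_mx_block add_block_mx !(addr0, add0r).
apply: (unipotent_block (F := fun A => block_mx 0 0 A 0) (a := fun i j => - (e i + e j))).
- by move=> A B; rewrite add_block_mx !addr0.
- by move=> k A; rewrite scale_block_mx !scaler0.
- by move=> A B; rewrite mulmx_block !(mulmx0, mul0mx, addr0) block_mx0.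
- exact: root_vector_C_opp.
Qed.

Definition vec (p n : 'I_l -> R) : 'cV[R]_(l + l) :=
  col_mx (\col_i p i) (\col_i n i).

Lemma eq_vec p n p' n' : p =1 p' -> n =1 n' -> vec p n = vec p' n'.
Proof. by move=> /funext-> /funext->. Qed.

Lemma up_vec M p n : up M *m vec p n = vec (fun i => p i + \sum_j M i j * n j) n.
Proof.
rewrite /up /vec mul_block_col !mul1mx mul0mx add0r; congr col_mx.
by apply/colP => i; rewrite !mxE; congr (_ + _); apply: eq_bigr => j _; rewrite mxE.
Qed.

Lemma lo_vec M p n : lo M *m vec p n = vec p (fun i => n i + \sum_j M i j * p j).
Proof.
rewrite /lo /vec mul_block_col !mul1mx mul0mx addr0 addrC; congr col_mx.
by apply/colP => i; rewrite !mxE; congr (_ + _); apply: eq_bigr => j _; rewrite mxE.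
Qed.

Variable o : 'I_l.
Hypothesis o0 : o = 0%N :> nat.

(** Elements of the Levi subgroup of the matrices [diag (A, A^-T)], where
    [A] differs from the identity in the row [o] only, respectively in the
    column [o] only. *)
Definition lev (t : 'I_l -> R) : Mat :=
  1%:M + \sum_(j | j != o) t j *: root_vector (X := TypeC) R (e o - e j).
Definition lev' (t : 'I_l -> R) : Mat :=
  1%:M + \sum_(j | j != o) t j *: root_vector (X := TypeC) R (e j - e o).

Lemma unipotent_lev Sigma t : (forall j, j != o -> Sigma (e o - e j)) ->
  (forall j, j != o -> I (t j)) -> U Sigma I (lev t).
Proof.
move=> St It; apply: unipotent_subgroup_sum => [i j io jo|j jo].
  rewrite -scalemxAl -scalemxAr !root_vector_C_diff 1?eq_sym //.
  rewrite mulmx_block !(mulmx0, mul0mx, addr0, add0r) mulNmx mulmxN opprK.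
  by rewrite !mul_delta_mx_0 ?block_mx0 ?scaler0 // eq_sym.
by apply: unipotent_subgroup_gen; [apply: St|apply: It].
Qed.

Lemma unipotent_lev' Sigma t : (forall j, j != o -> Sigma (e j - e o)) ->
  (forall j, j != o -> I (t j)) -> U Sigma I (lev' t).
Proof.
move=> St It; apply: unipotent_subgroup_sum => [i j io jo|j jo].
  rewrite -scalemxAl -scalemxAr !root_vector_C_diff //.
  rewrite mulmx_block !(mulmx0, mul0mx, addr0, add0r) mulNmx mulmxN opprK.
  by rewrite !mul_delta_mx_0 ?block_mx0 ?scaler0 // eq_sym.
by apply: unipotent_subgroup_gen; [apply: St|apply: It].
Qed.

Lemma delta_mul_col i j (v : 'I_l -> R) a :
  (E i j *m (\col_i v i)) a 0 = (a == i)%:R * v j.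
Proof.
rewrite mxE (bigD1 j) //= !mxE eqxx andbT big1 ?addr0 // => b bj.
by rewrite !mxE (negbTE bj) andbF mul0r.
Qed.

Lemma sum_col_mx (P : pred 'I_l) (A B : 'I_l -> 'cV[R]_l) :
  \sum_(j | P j) col_mx (A j) (B j)
  = col_mx (\sum_(j | P j) A j) (\sum_(j | P j) B j).
Proof.
elim/big_rec3: _ => [|j u v w _ ->]; first by rewrite col_mx0.
by rewrite add_col_mx.
Qed.

Lemma lev_vec t p n : lev t *m vec p n =
  vec (fun i => p i + (i == o)%:R * \sum_(j | j != o) t j * p j)
      (fun i => n i - (if i == o then 0 else t i * n o)).
Proof.
rewrite /lev mulmxDl mul1mx mulmx_suml /vec.
rewrite (eq_bigr (fun j => col_mx (t j *: (E o j *m \col_i p i))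
    (- (t j *: (E j o *m \col_i n i))))) => [|j jo]; last first.
  rewrite root_vector_C_diff 1?eq_sym // -scalemxAl mul_block_col.
  by rewrite !mul0mx addr0 add0r mulNmx scale_col_mx scalerN.
rewrite sum_col_mx add_col_mx; congr col_mx; apply/colP => i; rewrite !mxE summxE.
  congr (_ + _); rewrite mulr_sumr; apply: eq_bigr => j _.
  by rewrite mxE delta_mul_col mulrCA.
congr (_ + _); rewrite (eq_bigr (fun j => - ((i == j)%:R * (t j * n o)))); last first.
  by move=> j _; rewrite 2!mxE delta_mul_col mulrCA.
rewrite sumrN; congr (- _); case: (eqVneq i o) => [->|io].
  by rewrite big1 // => j jo; rewrite eq_sym (negbTE jo) mul0r.
rewrite (bigD1 i) //= eqxx mul1r big1 ?addr0 // => j /andP[_ ji].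
by rewrite eq_sym (negbTE ji) mul0r.
Qed.

Lemma lev'_vec t p n : lev' t *m vec p n =
  vec (fun i => p i + (if i == o then 0 else t i * p o))
      (fun i => n i - (i == o)%:R * \sum_(j | j != o) t j * n j).
Proof.
rewrite /lev' mulmxDl mul1mx mulmx_suml /vec.
rewrite (eq_bigr (fun j => col_mx (t j *: (E j o *m \col_i p i))
    (- (t j *: (E o j *m \col_i n i))))) => [|j jo]; last first.
  rewrite root_vector_C_diff // -scalemxAl mul_block_col.
  by rewrite !mul0mx addr0 add0r mulNmx scale_col_mx scalerN.
rewrite sum_col_mx add_col_mx; congr col_mx; apply/colP => i; rewrite !mxE summxE.
  congr (_ + _); rewrite (eq_bigr (fun j => (i == j)%:R * (t j * p o))); last first.
    by move=> j _; rewrite mxE delta_mul_col mulrCA.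
  case: (eqVneq i o) => [->|io].
    by rewrite big1 // => j jo; rewrite eq_sym (negbTE jo) mul0r.
  rewrite (bigD1 i) //= eqxx mul1r big1 ?addr0 // => j /andP[_ ji].
  by rewrite eq_sym (negbTE ji) mul0r.
congr (_ + _); rewrite (eq_bigr (fun j => - ((i == o)%:R * (t j * n j)))); last first.
  by move=> j _; rewrite 2!mxE delta_mul_col mulrCA.
by rewrite sumrN mulr_sumr.
Qed.

Local Notation act := (@col_act R TypeC l).
Local Notation reach := (reach I act).
Local Notation Pos := (positive_roots TypeC l).
Local Notation Neg := (negative_roots TypeC l).
Local Notation dot u v := (\sum_(j | j != o) u j * v j).

Lemma dotZl k (u v : 'I_l -> R) : dot (fun j => k * u j) v = k * dot u v.
Proof. by rewrite mulr_sumr; apply: eq_bigr => j _; rewrite mulrA. Qed.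

Lemma neq_o i : i != o -> (o < i)%N.
Proof. by rewrite -val_eqE /= o0 lt0n. Qed.

Lemma root_C_sum i j : root_system TypeC l (e i + e j).
Proof.
case: (eqVneq i j) => [->|ij]; first by right; exists j, false; rewrite scale1r mulr2n.
by left; apply: (@D_roots_add TypeC l).
Qed.

Lemma positive_C_sum i j : Pos (e i + e j).
Proof. by split; [apply: root_C_sum|apply: nonneg_sum_C]. Qed.

Lemma reach_up p n (M : 'M[R]_l) : (forall i j, M i j = M j i) ->
  (forall i j, I (M i j)) ->
  reach Pos (vec p n) (vec (fun i => p i + \sum_j M i j * n j) n).
Proof.
move=> symM IM; exists (up M); last exact: up_vec.
by apply: unipotent_up => // i j; left; apply: positive_C_sum.
Qed.

Lemma reach_lo p n (M : 'M[R]_l) : (forall i j, M i j = M j i) ->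
  (forall i j, I (M i j)) ->
  reach Neg (vec p n) (vec p (fun i => n i + \sum_j M i j * p j)).
Proof.
move=> symM IM; exists (lo M); last exact: lo_vec.
apply: unipotent_lo => // i j; left; rewrite /negative_roots /= opprK.
exact: positive_C_sum.
Qed.

Lemma reach_lev p n t : (forall j, j != o -> I (t j)) ->
  reach Pos (vec p n)
    (vec (fun i => p i + (i == o)%:R * dot t p)
         (fun i => n i - (if i == o then 0 else t i * n o))).
Proof.
move=> It; exists (lev t); last exact: lev_vec.
by apply: unipotent_lev => // j jo; apply: (@positive_diff TypeC l); apply: neq_o.
Qed.

Lemma reach_lev' p n t : (forall j, j != o -> I (t j)) ->
  reach Neg (vec p n)
    (vec (fun i => p i + (if i == o then 0 else t i * p o))
         (fun i => n i - (i == o)%:R * dot t n)).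
Proof.
move=> It; exists (lev' t); last exact: lev'_vec.
by apply: unipotent_lev' => // j jo; apply: (@negative_diff TypeC l); apply: neq_o.
Qed.

(** The border moves the coordinate [o]; as the matrix has to be symmetric it
    also moves the other coordinates, by multiples of [s], and the rank one part
    serves to cancel this. *)
Definition bordered m (s : 'I_l -> R) c (v : 'I_l -> R) : 'M[R]_l :=
  \matrix_(i, j) (if i == o then if j == o then m else s j
                  else if j == o then s i else c * (v i * v j)).

Lemma bordered_sym m s c v i j : bordered m s c v i j = bordered m s c v j i.
Proof. by rewrite !mxE; do 2!case: ifP => _ //; rewrite [v i * _]mulrC. Qed.

Lemma bordered_in m s c v : I m -> (forall j, j != o -> I (s j)) -> I c ->
  forall i j, I (bordered m s c v i j).
Proof.
move=> Im Is Ic i j; rewrite mxE.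
by case: (eqVneq i o) => [_|/Is Isi]; case: (eqVneq j o) => [_|/Is Isj] //; apply: idealMr.
Qed.

Lemma bordered_mul m s c v (n : 'I_l -> R) i :
  \sum_j bordered m s c v i j * n j
  = if i == o then m * n o + dot s n else s i * n o + c * (v i * dot v n).
Proof.
rewrite (bigD1 o) //= mxE eqxx; case: ifP => io; congr (_ + _).
  by apply: eq_bigr => j jo; rewrite mxE io (negbTE jo).
rewrite !mulr_sumr; apply: eq_bigr => j jo.
by rewrite mxE io (negbTE jo) -!mulrA.
Qed.

Definition congr_e0 (p n : 'I_l -> R) : Prop :=
  (forall i, I (p i - (i == o)%:R)) /\ (forall i, I (n i)).

Lemma congr_e0_p p n j : congr_e0 p n -> j != o -> I (p j).
Proof. by case=> Ip _ /negbTE jo; have := Ip j; rewrite jo subr0. Qed.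

Lemma congr_e0_o p n : congr_e0 p n -> I (1 - p o).
Proof.
by case=> Ip _; rewrite -opprB; apply: idealN => //; have := Ip o; rewrite eqxx.
Qed.

(** The row to which the stable rank condition is applied ends with [n o]. *)
Definition comaximal_but_last (p n : 'I_l -> R) : Prop := forall K, is_ideal K ->
  (forall i, K (p i)) -> (forall j, j != o -> K (n j)) -> K 1.

(** The stable rank condition asks for multiples of [n o] to be added to all the
    other coordinates.  A symmetric matrix does this for the [p i], and an
    element of the Levi factor for the [n j].  The coordinate [p o] is changed by
    both; for a suitable corner entry [m] of the matrix this change is the
    required one modulo the ideal of the other new coordinates. *)
Lemma SR_move p n : SR_on I ('I_l + 'I_l)%type -> congr_e0 p n ->
  (forall K, is_ideal K -> (forall i, K (p i)) -> (forall i, K (n i)) -> K 1) ->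
  exists p' n', [/\ reach Pos (vec p n) (vec p' n'), congr_e0 p' n' &
    comaximal_but_last p' n'].
Proof.
move=> sr cpn unim; have [Ip In] := cpn.
pose a (q : 'I_l + 'I_l) := match q with inl i => p i | inr i => n i end.
have [|||b Ib b1] := sr (inr o) (inl o) a (n o) isT.
- by move=> [i|i] ne; rewrite /a ?subr0 //; apply: Ip.
- exact: In.
- move=> K idK Ka Kno; apply: unim => // i; first exact: (Ka (inl i)).
  by case: (eqVneq i o) => [->//|io]; apply: (Ka (inr i)); apply: contra io => /eqP[->].
pose bp i := b (inl i); pose bn i := b (inr i).
pose m := bp o + dot bp bn.
have Im : I m.
  by apply: (idealD idI); [exact: Ib|apply: ideal_sum => // j _; apply: (idealMl _ idI); exact: Ib].
pose M := bordered m bp 0 bp.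
have IM : forall i j, I (M i j).
  by apply: bordered_in => // [j _|]; [apply: Ib|apply: ideal0].
have It j : j != o -> I (- bn j) by move=> _; apply: idealN => //; apply: Ib.
have r1 := reach_up p n (bordered_sym m bp 0 bp) IM.
have r2 := reach_lev (fun i => p i + \sum_j M i j * n j) n It.
have dotM i : \sum_j M i j * n j
    = if i == o then m * n o + dot bp n else bp i * n o.
  by rewrite bordered_mul mul0r addr0.
pose p1 i := p i + \sum_j M i j * n j.
have p1E i : i != o -> p1 i = p i + bp i * n o by move=> io; rewrite /p1 dotM (negbTE io).
exists (fun i => p1 i + (i == o)%:R * dot (fun j => - bn j) p1).
exists (fun i => n i - (if i == o then 0 else - bn i * n o)).
split; first exact: (reach_trans (@col_actM R TypeC l) r1 r2).
  have Ip1 i : I (p1 i - (i == o)%:R).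
    rewrite /p1 addrAC; apply: (idealD idI) => //.
    by apply: ideal_sum => // j _; apply: idealMr.
  split=> i; last first.
    apply: (idealB idI) => //; case: ifP => _; first exact: ideal0.
    exact: idealMl.
  rewrite addrAC; apply: (idealD idI) => //; apply: idealMl => //.
  apply: ideal_sum => // j jo; apply: idealMr => //; exact: It.
move=> K idK Kp Kn; apply: b1 => // -[i|i] iNo; last first.
  have io : i != o by apply: contra iNo => /eqP->.
  by have := Kn i io; rewrite /a (negbTE io) mulNr opprK.
have Kp' j : j != o -> K (p j + bp j * n o).
  by move=> jo; have := Kp j; rewrite (negbTE jo) mul0r addr0 p1E.
have Kn' j : j != o -> K (n j + bn j * n o).
  by move=> jo; have := Kn j jo; rewrite (negbTE jo) mulNr opprK.
rewrite /a -/(bp i); case: (eqVneq i o) => [->|]; last exact: Kp'.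
have -> : p o + bp o * n o
    = p1 o + dot (fun j => - bn j) p1
      - dot bp (fun j => n j + bn j * n o)
      + dot bn (fun j => p j + bp j * n o).
  rewrite /p1 dotM eqxx /m.
  have -> : dot (fun j => - bn j) p1 = - dot bn (fun j => p j + bp j * n o).
    by rewrite -sumrN; apply: eq_bigr => j jo; rewrite mulNr p1E.
  have -> : dot bp (fun j => n j + bn j * n o) = dot bp n + dot bp bn * n o.
    rewrite mulr_suml -big_split; apply: eq_bigr => j _; rewrite /=; ring.
  by rewrite mulrDl; ring.
apply: (idealD idK); first apply: (idealB idK).
- by have := Kp o; rewrite eqxx mul1r.
- by apply: ideal_sum => // j jo; apply: idealMl => //; apply: Kn'.
- by apply: ideal_sum => // j jo; apply: idealMl => //; apply: Kp'.
Qed.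

(** A border with the entries [mu * q * p j], where [q = - dot p n], changes [p o]
    as required; it adds [mu * q * p j * n o] to [p j], which the rank one part
    of the matrix takes away again. *)
Lemma first_move p n mu : congr_e0 p n -> I mu ->
  reach Pos (vec p n)
    (vec (fun i => if i == o then p o - mu * (dot p n) ^+ 2 else p i) n).
Proof.
move=> cpn Imu; pose q := - dot p n.
have Iq : I (mu * q) by apply: idealMr.
have IM i j : I (bordered 0 (fun j => mu * q * p j) (mu * n o) p i j).
  apply: bordered_in => [|k _|]; [exact: ideal0|exact: idealMr|exact: idealMr].
have := reach_up p n (bordered_sym _ _ _ _) IM.
congr (reach Pos (vec p n) _); apply: eq_vec => // i.
rewrite bordered_mul mul0r add0r; case: eqVneq => [->|_].
  have -> : dot (fun j => mu * q * p j) n = mu * q * dot p n.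
    exact: dotZl.
  by rewrite /q; ring.
by rewrite /q; ring.
Qed.

(** In a Bezout relation [1 = y o * p o + A + B], where [A] and [B] are the
    contributions of the coordinates [p j] and [n j], one may pass to [p o],
    [A ^+ 2], [B ^+ 2].  A multiple of [A ^+ 2] is added to [n o] by a symmetric matrix
    whose rank one part restores the [n j]; a multiple of [B ^+ 2] is added
    by an element of the Levi factor, the change of the [p j] being
    anticipated in [U(Phi^+, I)]. *)
Lemma last_move p n nu : congr_e0 p n -> comaximal_but_last p n -> I nu ->
  exists p', reach Pos (vec p n) (vec p' n) /\
    reach Neg (vec p' n) (vec p (fun i => if i == o then nu else n i)).
Proof.
move=> cpn unim Inu; have [_ In] := cpn.
pose a (q : 'I_l + 'I_l) := match q with inl i => p i | inr i => n i end.
have [d d1] : exists d, \sum_(q | q != inr o) d q * a q = 1.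
  apply: comaximal_coef => K idK Ka; apply: unim => // [i|j jo].
    exact: (Ka (inl i)).
  by apply: (Ka (inr j)); apply: contra jo => /eqP[->].
pose y j := d (inl j); pose y' j := d (inr j).
pose c := p o; pose A := dot y p; pose B := dot y' n.
have {}d1 : y o * c + A + B = 1.
  rewrite -d1 big_sumType /= (bigD1 o) //=; congr (_ + _ + _).
pose D := nu - n o; have ID : I D by apply: idealB.
(* With [u = y o * c], 1 is the sum of [1 - (1 - u) ^+ 3], a multiple of [c], and
   [(A + B) ^+ 3 = A ^+ 2 * (A + 3 * B) + B ^+ 2 * (B + 3 * A)]. *)
pose tau := D * (A + 3 * B); pose sg := - (D * (B + 3 * A)).
pose m := D * (y o * (3 - 3 * (y o * c) + (y o * c) ^+ 2)).
have Itau : I tau by apply: idealMr.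
have Isg : I sg by apply: idealN => //; apply: idealMr.
have Im : I m by apply: idealMr.
have DE : m * c + tau * A ^+ 2 - sg * B ^+ 2 = D.
  have -> : D = D * (1 - (1 - (y o * c + A + B)) ^+ 3) by rewrite d1; ring.
  have -> : 1 - (y o * c + A + B) = 0 by rewrite d1 subrr.
  rewrite expr0n subr0.
  have E : 1 - y o * c = A + B by rewrite -d1; ring.
  rewrite /m /tau /sg.
  have -> : D * 1 = D * ((1 - (1 - y o * c) ^+ 3) + (A + B) ^+ 3) by rewrite E; ring.
  ring.
pose p' i := p i - (if i == o then 0 else c * sg * (y' i * B)).
exists p'; split.
  have IM i j : I (bordered 0 (fun=> 0) (- (c * sg)) y' i j).
    apply: bordered_in => [|j0 _|]; [exact: ideal0|exact: ideal0|].
    by apply: idealN => //; apply: idealMl.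
  have := reach_up p n (bordered_sym _ _ _ _) IM.
  congr (reach Pos (vec p n) _); apply: eq_vec => // i.
  rewrite bordered_mul /p' -/B; case: ifP => _; last by rewrite mul0r add0r mulNr.
  by rewrite mul0r add0r big1 ?subr0 ?addr0 // => j _; rewrite mul0r.
have It j : j != o -> I (sg * B * y' j).
  by move=> _; rewrite -mulrA; apply: idealMr.
have r1 := reach_lev' p' n It.
set n1 := fun i => n i - _ in r1.
have IM i j : I (bordered m (fun j => tau * A * y j) (- (tau * c)) y i j).
  apply: bordered_in => // [k _|]; first by rewrite -mulrA; apply: idealMr.
  by apply: idealN => //; apply: idealMr.
have r2 := reach_lo (fun i => p' i + (if i == o then 0 else sg * B * y' i * p' o))
  n1 (bordered_sym _ _ _ _) IM.
have := reach_trans (@col_actM R TypeC l) r1 r2.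
have pE i : p' i + (if i == o then 0 else sg * B * y' i * p' o) = p i.
  rewrite /p' eqxx subr0 -/c; case: ifP => _; first by rewrite subr0 addr0.
  by ring.
congr (reach Neg (vec p' n) _); apply: eq_vec => i; first exact: pE.
under eq_bigr => j _ do rewrite pE.
rewrite bordered_mul -/A -/c /n1; case: eqVneq => [->|_].
  have -> : dot (fun j => tau * A * y j) p = tau * A * A.
    exact: dotZl.
  have -> : dot (fun j => sg * B * y' j) n = sg * B * B by exact: dotZl.
  by rewrite -(subrKC (n o) nu) -/D -DE !natr_bool; ring.
by rewrite natr_bool; ring.
Qed.

Local Notation e0 := (delta_mx (lshift l o) 0 : 'cV[R]_(l + l)).
Local Notation f0 := (delta_mx (rshift l o) 0 : 'cV[R]_(l + l)).
Local Notation amax := (e o + e o).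

Lemma vecP (x : 'cV[R]_(l + l)) :
  x = vec (fun i => x (lshift l i) 0) (fun i => x (rshift l i) 0).
Proof.
by apply/colP => i; rewrite mxE; case: split_ordP => j ->; rewrite mxE.
Qed.

Lemma e0_vec : e0 = vec (fun i => (i == o)%:R) (fun=> 0).
Proof.
rewrite [LHS]vecP; apply: eq_vec => i; rewrite mxE andbT.
  by rewrite (inj_eq (@lshift_inj _ _)).
by rewrite eq_rlshift.
Qed.

Lemma f0_vec : f0 = vec (fun=> 0) (fun i => (i == o)%:R).
Proof.
rewrite [LHS]vecP; apply: eq_vec => i; rewrite mxE andbT.
  by rewrite eq_lrshift.
by rewrite (inj_eq (@rshift_inj _ _)).
Qed.

Lemma up_root q : root_unipotent (X := TypeC) (l := l) amax q
  = up (bordered q (fun=> 0) 0 (fun=> 0)).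
Proof.
rewrite /root_unipotent root_vector_C_sum scalar_mx_block scale_block_mx add_block_mx.
rewrite !scaler0 !addr0 add0r; congr block_mx; apply/matrixP => i j; rewrite !mxE.
by case: eqP => _; case: eqP => _; rewrite ?mul0r ?mulr0 ?mulr1.
Qed.

Lemma lo_root q : root_unipotent (X := TypeC) (l := l) (- amax) q
  = lo (bordered q (fun=> 0) 0 (fun=> 0)).
Proof.
rewrite /root_unipotent root_vector_C_opp scalar_mx_block scale_block_mx add_block_mx.
rewrite !scaler0 !addr0 add0r; congr block_mx; apply/matrixP => i j; rewrite !mxE.
by case: eqP => _; case: eqP => _; rewrite ?mul0r ?mulr0 ?mulr1.
Qed.

Lemma dot0 (u : 'I_l -> R) : dot (fun=> 0) u = 0.
Proof. by rewrite big1 // => j _; rewrite mul0r. Qed.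

Lemma up_root_vec q p n : root_unipotent (X := TypeC) (l := l) amax q *m vec p n
  = vec (fun i => p i + (i == o)%:R * (q * n o)) n.
Proof.
rewrite up_root up_vec; apply: eq_vec => // i; rewrite bordered_mul !dot0.
by case: eqP => _; rewrite natr_bool; ring.
Qed.

Lemma lo_root_vec q p n : root_unipotent (X := TypeC) (l := l) (- amax) q *m vec p n
  = vec p (fun i => n i + (i == o)%:R * (q * p o)).
Proof.
rewrite lo_root lo_vec; apply: eq_vec => // i; rewrite bordered_mul !dot0.
by case: eqP => _; rewrite natr_bool; ring.
Qed.

Lemma chevalley_C_inv (g : Mat) : G g -> exists h, h *m g = 1%:M.
Proof.
case=> Jg _; exists (- (J *m g^T *m J)).
rewrite mulNmx -!mulmxA [g^T *m _]mulmxA Jg /symplectic_form mulmx_block.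
by rewrite !(mulmx0, mul0mx, mulmx1, mulmxN, addr0, add0r) opp_block_mx !oppr0 opprK
  -scalar_mx_block.
Qed.

Lemma Sigma1_neg_C a : Sigma1_pos TypeC l (- a) -> a != - amax ->
  (Sigma1_neg TypeC l `\ (- amax)) a.
Proof. by move=> Sa ne; split=> // ea; rewrite ea eqxx in ne. Qed.

Lemma Sigma1_pos_C_diff j : j != o -> Sigma1_pos TypeC l (e o - e j).
Proof.
move=> jo; apply: (@Sigma1_pos_nonneg TypeC l o) => //.
- by apply: (@root_diff TypeC l); rewrite eq_sym.
- by apply: (@nonneg_diff TypeC l) => //; apply: ltnW; apply: neq_o.
- by rewrite !mxE eqxx val_eqE eq_sym (negbTE jo).
Qed.

Lemma Sigma1_pos_C_sum j : Sigma1_pos TypeC l (e o + e j).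
Proof.
apply: (@Sigma1_pos_nonneg TypeC l o) => //.
- exact: root_C_sum.
- exact: nonneg_sum_C.
- by rewrite !mxE eqxx; case: (_ == _).
Qed.

(** The middle factor [w] in [U(Sigma_1^-, I)] can be chosen with [w e0] having
    the coordinates [p j], [n j] for [j != o], 1 at [p o] and therefore
    [q = - dot p n] at [n o].  Then [z(r) w e0] has [p o = 1 - r (1 + q)] and
    [n o = 1 - p o + q].  With [r0 = 1 - p o] for the given vector, division by
    [1 + q] is replaced by [r = r0 (1 - q)]: it suffices to add [r0 q ^+ 2] to
    [p o], by [first_move], and then to adjust [n o], by [last_move]. *)
Lemma moves_C (g : Mat) x : SR_on I ('I_l + 'I_l)%type -> congruence_subgroup G I g ->
  g *m e0 = x ->
  exists y z, [/\ reach Pos x y, reach Neg y z &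
    exists r w, [/\ I r, U (Sigma1_neg TypeC l `\ (- amax)) I w &
      act (z_elt (R := R) (X := TypeC) (- amax) r 1 *m w) e0 z]].
Proof.
move=> sr [Gg Ig] gx.
have xE (i : 'I_(l + l)) : x i 0 = g i (lshift l o) by rewrite -gx -colE mxE.
pose p (i : 'I_l) := x (lshift l i) 0; pose n (i : 'I_l) := x (rshift l i) 0.
have cpn : congr_e0 p n.
  split=> i; have := Ig (lshift l i) (lshift l o); have := Ig (rshift l i) (lshift l o).
    by rewrite !mxE /p xE (inj_eq (@lshift_inj _ _)).
  by rewrite !mxE /n xE eq_rlshift subr0.
have [|p1 [n1 [r1 c1 unim]]] := SR_move sr cpn.
  move=> K idK Kp Kn; have [h hg] := chevalley_C_inv Gg.
  have <- : (h *m g) (lshift l o) (lshift l o) = 1 by rewrite hg mxE eqxx.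
  rewrite mxE; apply: ideal_sum => // j _; apply: idealMl => //; rewrite -xE.
  by case: (split_ordP j) => i ->; [apply: Kp|apply: Kn].
pose r0 := 1 - p1 o; have Ir0 : I r0 by apply: congr_e0_o c1.
have Imu : I (- r0) by apply: idealN.
have r2 := first_move c1 Imu; set p2 := (fun i => _) in r2.
pose q := - dot p1 n1.
have Iq : I q by apply: idealN => //; apply: ideal_sum => // j jo;
  apply: idealMr => //; apply: congr_e0_p c1 jo.
have p2E i : i != o -> p2 i = p1 i by move=> /negbTE io; rewrite /p2 io.
have p2o : p2 o = p1 o + r0 * q ^+ 2 by rewrite /p2 eqxx /q; ring.
have dot2 : dot p2 n1 = - q.
  by rewrite /q opprK; apply: eq_bigr => j jo; rewrite p2E.
have c2 : congr_e0 p2 n1.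
  case: c1 => Ip1 In1; split=> // i; case: (eqVneq i o) => [->|io].
    rewrite p2o addrAC; apply: (idealD idI); last exact: idealMr.
    by have := Ip1 o; rewrite eqxx.
  by rewrite p2E //; have := Ip1 i; rewrite (negbTE io).
have unim2 : comaximal_but_last p2 n1.
  move=> K idK Kp Kn; apply: unim => // i; case: (eqVneq i o) => [->|io]; last first.
    by rewrite -p2E.
  have -> : p1 o = p2 o + r0 * q * dot p2 n1 by rewrite p2o dot2; ring.
  apply: (idealD idK) => //; apply: idealMl => //; apply: ideal_sum => // j jo.
  by apply: idealMl => //; apply: Kn.
pose nu := 1 - p2 o + q.
have Inu : I nu by apply: (idealD idI) => //; apply: congr_e0_o c2.
have [p3 [r3 r4]] := last_move c2 unim2 Inu.
pose r := r0 * (1 - q).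
exists (vec p3 n1); eexists; split; last first.
- pose w := lev' p2 *m lo (bordered 0 n1 0 (fun=> 0)).
  exists r, w; split; first exact: idealMr.
    apply: unipotent_subgroupM.
      apply: unipotent_lev' => [j jo|j]; last exact: congr_e0_p c2.
      apply: Sigma1_neg_C; first by rewrite opprB; apply: Sigma1_pos_C_diff.
      by rewrite coord_sum_neq // !coord_sumE.
    apply: unipotent_lo => [i j|i j|i j].
    - exact: bordered_sym.
    - apply: bordered_in; [exact: ideal0| |exact: ideal0].
      by move=> k _; case: c2.
    rewrite mxE; case: (eqVneq i o) => [->|io]; case: (eqVneq j o) => [->|jo];
      rewrite ?mul0r; try by right.
      left; apply: Sigma1_neg_C; first by rewrite opprK; apply: Sigma1_pos_C_sum.
      by rewrite eqr_opp evec_add_eq eq_sym (negbTE jo) andbF.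
    left; apply: Sigma1_neg_C.
      by rewrite opprK addrC; apply: Sigma1_pos_C_sum.
    by rewrite eqr_opp evec_add_eq ![o == i]eq_sym (negbTE io) andbF.
  rewrite /col_act /z_elt opprK /w e0_vec -!mulmxA lo_vec lev'_vec.
  by rewrite up_root_vec lo_root_vec up_root_vec.
- have BE i : \sum_j bordered 0 n1 0 (fun=> 0) i j * (j == o)%:R
      = if i == o then 0 else n1 i.
    rewrite (bigD1 o) //= !mxE eqxx mulr1 big1 ?addr0 // => j /negbTE->.
    exact: mulr0.
  have dE : \sum_(j | j != o)
      p2 j * (0 + \sum_k bordered 0 n1 0 (fun=> 0) j k * (k == o)%:R)
      = - q.
    by rewrite -dot2; apply: eq_bigr => j /negbTE jo; rewrite BE jo add0r.
  move: r4; congr (reach Neg (vec p3 n1) _).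
  apply: eq_vec => i; rewrite dE !BE !eqxx !natr_bool;
    case: eqVneq => [io|io]; rewrite ?io ?natr_bool.
  - by rewrite /r p2o /r0; ring.
  - by ring.
  - by rewrite /nu /r p2o /r0; ring.
  - by ring.
apply: (reach_trans (@col_actM R TypeC l)) r3.
by rewrite [x]vecP; apply: (reach_trans (@col_actM R TypeC l) r1).
Qed.

Lemma symplectic_row_r (d : Mat) : G d -> d *m e0 = e0 -> f0^T *m d = f0^T.
Proof.
case=> Jd _ de0; have e0J : e0^T *m J = f0^T.
  rewrite e0_vec f0_vec /vec !tr_col_mx mul_row_block !mulmx0 mulmxN !mulmx1.
  rewrite add0r addr0; congr row_mx; apply/rowP => i; rewrite !mxE ?oppr0 //.
by rewrite -e0J -{1}de0 trmx_mul -!mulmxA [d^T *m _]mulmxA Jd.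
Qed.

Lemma symplectic_row_l (d : Mat) : G d -> d *m f0 = f0 -> e0^T *m d = e0^T.
Proof.
case=> Jd _ df0; have f0J : f0^T *m J = - e0^T.
  rewrite e0_vec f0_vec /vec !tr_col_mx mul_row_block !mulmx0 mulmxN !mulmx1.
  rewrite add0r addr0 opp_row_mx; congr row_mx; apply/rowP => i; rewrite !mxE ?oppr0 //.
apply: oppr_inj; rewrite -mulNmx -f0J.
by rewrite -{1}df0 trmx_mul -!mulmxA [d^T *m _]mulmxA Jd.
Qed.

(** An element that fixes [e0] sends [f0] to a vector with coordinate 1 at [f0];
    elements of [U(Sigma_1^+, I)] bring this vector back to [f0].  An element
    that fixes [e0] and [f0] also fixes the dual coordinates. *)
Lemma stabilizer_C (g : Mat) : congruence_subgroup G I g -> g *m e0 = e0 ->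
  exists2 s : Mat, U (Sigma1_pos TypeC l) I s &
    congruence_subgroup G I (s *m g) -> chevalley_group_Delta1 R TypeC l (s *m g).
Proof.
move=> GIg ge0; have [Gg Ig] := GIg.
pose f i := g (lshift l i) (rshift l o); pose f' i := g (rshift l i) (rshift l o).
have gf0 : g *m f0 = vec f f'.
  by rewrite [LHS]vecP; apply: eq_vec => i; rewrite -colE mxE.
have f'o : f' o = 1.
  have := symplectic_row_r Gg ge0 => /matrixP/(_ 0 (rshift l o)).
  rewrite !mxE !eqxx (bigD1 (rshift l o)) //= !mxE !eqxx mul1r big1 ?addr0 //.
  by move=> j jo; rewrite !mxE (negbTE jo) mul0r.
have If i : I (f i).
  by have := Ig (lshift l i) (rshift l o); rewrite !mxE eq_lrshift subr0.
have If' i : i != o -> I (f' i).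
  have := Ig (rshift l i) (rshift l o).
  by rewrite !mxE (inj_eq (@rshift_inj _ _)) => h /negbTE io; rewrite io subr0 in h.
pose f1 := f o + dot f' f.
have If1 : I f1.
  by apply: (idealD idI) => //; apply: ideal_sum => // j _; apply: idealMl.
pose s' := up (bordered (- f1) (fun j => - f j) 0 (fun=> 0)) *m lev f'.
have Us' : U (Sigma1_pos TypeC l) I s'.
  apply: unipotent_subgroupM.
    apply: unipotent_up => [i j|i j|i j].
    - exact: bordered_sym.
    - apply: bordered_in => [|k _|]; [exact: idealN|exact: idealN|exact: ideal0].
    rewrite mxE; case: (eqVneq i o) => [->|io]; first by left; apply: Sigma1_pos_C_sum.
    case: (eqVneq j o) => [->|jo]; last by right; rewrite mul0r.
    by left; rewrite addrC; apply: Sigma1_pos_C_sum.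
  by apply: unipotent_lev => // j; apply: Sigma1_pos_C_diff.
pose d := s' *m g; exists s' => // -[Gd _].
have s'e0 : s' *m e0 = e0.
  have -> : s' *m e0 = up (bordered (- f1) (fun j => - f j) 0 (fun=> 0)) *m e0.
    rewrite /s' -mulmxA; congr (_ *m _); rewrite e0_vec lev_vec.
    apply: eq_vec => i; last by rewrite mulr0 if_same subr0.
    by rewrite big1 ?mulr0 ?addr0 // => j /negbTE->; rewrite mulr0.
  rewrite e0_vec up_vec; apply: eq_vec => // i.
  by rewrite big1 ?addr0 // => j _; rewrite mulr0.
have s'f0 : s' *m vec f f' = f0.
  have lf : lev f' *m vec f f'
      = vec (fun i => if i == o then f1 else f i) (fun i => (i == o)%:R).
    rewrite lev_vec; apply: eq_vec => i; last first.
      by case: eqVneq => [->|io]; rewrite f'o ?subr0 // mulr1 subrr.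
    by rewrite /f1; case: eqVneq => [->|_]; rewrite ?mul1r // mul0r addr0.
  rewrite /s' -mulmxA lf f0_vec up_vec; apply: eq_vec => // i.
  rewrite (bigD1 o) //= big1 ?addr0 => [|j /negbTE jo]; last by rewrite jo mulr0.
  by rewrite !mxE eqxx mulr1; case: eqVneq => _; rewrite subrr.
have de0 : d *m e0 = e0 by rewrite /d -mulmxA ge0.
have df0 : d *m f0 = f0 by rewrite /d -mulmxA gf0.
have [Jd _] := Gd; split=> //.
rewrite (@coord_support_Delta1 TypeC l o) // => [i j nij|i io].
  have entry_c (k : 'I_(l + l)) : d *m delta_mx k 0 = delta_mx k 0 :> 'cV[R]__ ->
      d i k = (i == k)%:R.
    by rewrite -colE => /colP/(_ i); rewrite !mxE andbT.
  have entry_r (k : 'I_(l + l)) : (delta_mx k 0 : 'cV[R]__)^T *m d = (delta_mx k 0)^T ->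
      d k j = (k == j)%:R.
    by rewrite trmx_delta -rowE => /rowP/(_ j); rewrite !mxE /= eq_sym.
  have coord k : symplectic_coord k = o -> k = lshift l o \/ k = rshift l o.
    rewrite /symplectic_coord; case: split_ordP => k' -> ->; [by left|by right].
  have [/coord[]->|iNo] := eqVneq (symplectic_coord i) o.
  - exact/entry_r/symplectic_row_l.
  - exact/entry_r/symplectic_row_r.
  have [/coord[]->|jNo] := eqVneq (symplectic_coord j) o.
  - exact: entry_c.
  - exact: entry_c.
  by case: nij.
exists (e i + e i); split.
- exact: root_C_sum.
- exact: nonneg_sum_C.
- by rewrite !mxE val_eqE eq_sym (negbTE io).
- by rewrite !mxE eqxx.
Qed.

End TypeC.

Lemma congruence_decomposition_C (R : comPzRingType) (l : nat) (I : set R) amax :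
  is_ideal I -> (2 <= l)%N -> highest_root (X := TypeC) (l := l) amax ->
  sr_le I (2 * l - 1)%N ->
  decomposes_at (X := TypeC) (l := l) I amax.
Proof.
move=> idI l2 hmax srI; have l0 : (0 < l)%N by apply: ltnW.
pose o : 'I_l := Ordinal l0; have [Pmax _] := hmax.
have amaxE : amax = evec l o + evec l o by rewrite (highest_root_C hmax l0) mulr2n.
apply: (@congruence_decomposition R TypeC l I idI amax
  _ _ _ _ _ _ (@col_act R TypeC l) (delta_mx (lshift l o) 0)) => //.
- exact: chevalley_C_subgroup.
- exact: root_vector_sq_C.
- by move=> a s; apply: chevalley_C_root.
- by move=> g [Jg _]; split=> // i j [].
- exact: col_actM.
- exact: col_actV.
- by move=> g _; exists (g *m delta_mx (lshift l o) 0).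
- move=> g x Gg gx; rewrite amaxE; apply: (moves_C idI l2 _ _ Gg gx) => //.
  by apply: SR_onP srI _; rewrite // card_sum !card_ord; lia.
- exact: (stabilizer_C idI l2).
Qed.

(** * Clifford relations *)

Section Clifford.
Variables (R : comPzRingType) (l : nat).
Local Notation Mat := 'M[R]_#|{: {set 'I_l}}|.
Local Notation w := (@wedge R l).
Local Notation c := (@contr R l).
Local Notation p := (parity R l).
Implicit Types (i j : 'I_l) (S : {set 'I_l}).

Definition basis_col S : 'cV[R]_#|{: {set 'I_l}}| := delta_mx (enum_rank S) 0.

Definition wedge_sign S i : R := (-1) ^+ #|[set j in S | (j < i)%N]%SET|.

Lemma mx_basis_ext (A B : Mat) :
  (forall S, A *m basis_col S = B *m basis_col S) -> A = B.
Proof.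
move=> AB; apply/matrixP => a b; have := AB (enum_val b).
by rewrite /basis_col enum_valK -!colE => /colP/(_ a); rewrite !mxE.
Qed.

Lemma wedge_basis i S : w i *m basis_col S =
  if i \in S then 0 else wedge_sign S i *: basis_col (i |: S)%SET.
Proof.
apply/colP => a; rewrite -colE !mxE enum_rankK.
case: (boolP (i \in S)) => iS; rewrite !mxE /= ?iS //= andbT -[a in RHS]enum_valK.
rewrite (can_eq enum_rankK).
by case: eqP; rewrite ?mulr1 ?mulr0.
Qed.

Lemma contr_basis i S : c i *m basis_col S =
  if i \in S then wedge_sign S i *: basis_col (S :\ i)%SET else 0.
Proof.
apply/colP => a; rewrite -colE !mxE /= enum_rankK.
have -> : (i \notin enum_val a) && (S == (i |: enum_val a)%SET)
    = (i \in S) && (enum_val a == (S :\ i)%SET).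
  apply/andP/andP => -[ia /eqP e].
    by rewrite e finset.setU11 finset.setU1K.
  by rewrite e finset.setD11 finset.setD1K.
case: (boolP (i \in S)) => iS /=; last by rewrite mxE.
rewrite !mxE andbT -[a in RHS]enum_valK (can_eq enum_rankK).
have [e|] := eqVneq; last by rewrite mulr0.
rewrite mulr1 /wedge_sign; congr (_ ^+ #|pred_of_set _|).
rewrite e.
apply/setP => j; rewrite !inE; case: (eqVneq j i) => [->|//].
by rewrite ltnn !andbF.
Qed.

Lemma parity_basis S : p *m basis_col S = (-1) ^+ #|S| *: basis_col S.
Proof.
apply/colP => a; rewrite -colE !mxE.
case: (eqVneq a (enum_rank S)) => [->|]; last by rewrite !mulr0n mulr0.
by rewrite enum_rankK mulr1.
Qed.

Lemma wedge_signU S i j : j \notin S ->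
  wedge_sign (j |: S)%SET i = (-1) ^+ (j < i)%N * wedge_sign S i.
Proof.
move=> jS; rewrite /wedge_sign -exprD; congr (_ ^+ _).
case: (boolP (j < i)%N) => ji.
  have -> : [set k in (j |: S)%SET | (k < i)%N]%SET = (j |: [set k in S | (k < i)%N])%SET.
    by apply/setP => k; rewrite !inE; case: (eqVneq k j) => [->|].
  by rewrite cardsU1 !inE (negbTE jS).
rewrite add0n; congr #|pred_of_set _|; apply/setP => k; rewrite !inE.
by case: (eqVneq k j) => [->|//]; rewrite (negbTE ji) !andbF.
Qed.

Lemma wedge_signD S i j : j \in S ->
  wedge_sign (S :\ j)%SET i = (-1) ^+ (j < i)%N * wedge_sign S i.
Proof.
move=> jS; rewrite -{2}(finset.setD1K jS) wedge_signU ?finset.setD11 //.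
by rewrite mulrA -expr2 sqrr_sign mul1r.
Qed.

Lemma wedge_sign_sq S i : wedge_sign S i * wedge_sign S i = 1.
Proof. by rewrite -expr2 sqrr_sign. Qed.

Lemma sign_ltn i j : i != j ->
  (-1) ^+ (i < j)%N + (-1) ^+ (j < i)%N = 0 :> R.
Proof.
by rewrite -val_eqE neq_ltn => /orP[] ij; rewrite ij ltnNge (ltnW ij) expr1 expr0 ?addNr ?subrr.
Qed.

Lemma wedge_sq i : w i *m w i = 0.
Proof.
apply: mx_basis_ext => S; rewrite -mulmxA wedge_basis mul0mx.
case: ifP => iS; first by rewrite mulmx0.
by rewrite -scalemxAr wedge_basis finset.setU11 scaler0.
Qed.

Lemma wedge_anti i j : w i *m w j + w j *m w i = 0.
Proof.
have [->|ij] := eqVneq i j; first by rewrite !wedge_sq addr0.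
apply: mx_basis_ext => S; rewrite mulmxDl -!mulmxA !wedge_basis mul0mx.
case: (boolP (j \in S)) => jS; case: (boolP (i \in S)) => iS;
  rewrite ?mulmx0 -?scalemxAr ?wedge_basis ?inE ?iS ?jS ?orbT ?scaler0 ?addr0 //.
rewrite [j == i]eq_sym (negbTE ij) (negbTE iS) (negbTE jS) /= !scalerA !wedge_signU //.
rewrite finset.setUCA -scalerDl.
have -> : wedge_sign S j * ((-1) ^+ (j < i)%N * wedge_sign S i)
    + wedge_sign S i * ((-1) ^+ (i < j)%N * wedge_sign S j)
  = wedge_sign S i * wedge_sign S j * ((-1) ^+ (i < j)%N + (-1) ^+ (j < i)%N).
  by ring.
by rewrite sign_ltn // mulr0 scale0r.
Qed.

Lemma contr_anti i j : c i *m c j + c j *m c i = 0.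
Proof.
by rewrite /contr -!trmx_mul -raddfD /= addrC wedge_anti; apply: trmx0.
Qed.

Lemma contr_sq i : c i *m c i = 0.
Proof. by rewrite /contr -trmx_mul wedge_sq trmx0. Qed.

Lemma wedge_contr i j : w i *m c j + c j *m w i = (i == j)%:R%:M.
Proof.
apply: mx_basis_ext => S; rewrite mulmxDl -!mulmxA wedge_basis contr_basis.
rewrite mul_scalar_mx; have [<-{j}|ij] := eqVneq i j.
  case: (boolP (i \in S)) => iS.
    rewrite mulmx0 addr0 -scalemxAr wedge_basis finset.setD11 scalerA finset.setD1K //.
    by rewrite wedge_signD // ltnn mul1r wedge_sign_sq.
  rewrite mulmx0 add0r -scalemxAr contr_basis finset.setU11 scalerA finset.setU1K //.
  by rewrite wedge_signU // ltnn mul1r wedge_sign_sq.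
rewrite scale0r.
case: (boolP (j \in S)) => jS; case: (boolP (i \in S)) => iS;
  rewrite ?mulmx0 -?scalemxAr ?wedge_basis ?contr_basis ?inE ?iS ?jS ?ij ?andbF
    ?scaler0 ?addr0 //=; last first.
  by rewrite [j == i]eq_sym (negbTE ij) (negbTE jS) scaler0 addr0.
rewrite (negbTE iS) orbT !scalerA wedge_signD // wedge_signU //.
have -> : (i |: S :\ j = (i |: S) :\ j)%SET.
  by apply/setP => k; rewrite !inE; case: (eqVneq k i) => [->|]; rewrite ?ij.
rewrite -scalerDl.
have -> : wedge_sign S j * ((-1) ^+ (j < i)%N * wedge_sign S i)
    + wedge_sign S i * ((-1) ^+ (i < j)%N * wedge_sign S j)
  = wedge_sign S i * wedge_sign S j * ((-1) ^+ (i < j)%N + (-1) ^+ (j < i)%N).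
  by ring.
by rewrite sign_ltn // mulr0 scale0r.
Qed.

Lemma parity_sq : p *m p = 1%:M.
Proof.
apply: mx_basis_ext => S; rewrite -mulmxA parity_basis -scalemxAr parity_basis.
by rewrite scalerA -expr2 sqrr_sign scale1r mul1mx.
Qed.

Lemma wedge_parity i : w i *m p + p *m w i = 0.
Proof.
apply: mx_basis_ext => S; rewrite mulmxDl -!mulmxA parity_basis -scalemxAr wedge_basis mul0mx.
case: ifP => [iS|/negbT iS]; first by rewrite mulmx0 scaler0 addr0.
rewrite -scalemxAr parity_basis cardsU1 iS exprS !scalerA -scalerDl.
by rewrite mulN1r mulrN [wedge_sign _ _ * _]mulrC subrr scale0r.
Qed.

Lemma contr_parity i : c i *m p + p *m c i = 0.
Proof.
have pT : p^T = p by rewrite /parity tr_diag_mx.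
by rewrite /contr -{1 2}pT -!trmx_mul -raddfD /= addrC wedge_parity; apply: trmx0.
Qed.

(** The operator of the vector with coordinates [x], [y], [z]. *)
Definition cvec (x y : 'I_l -> R) (z : R) : Mat :=
  \sum_i (x i *: w i + y i *: c i) + z *: p.

Definition qform (x y : 'I_l -> R) (z : R) : R := \sum_i x i * y i + z ^+ 2.

Lemma eq_cvec x y z x' y' z' : x =1 x' -> y =1 y' -> z = z' ->
  cvec x y z = cvec x' y' z'.
Proof. by move=> /funext-> /funext-> ->. Qed.

Lemma cvecD x y z x' y' z' : cvec x y z + cvec x' y' z' =
  cvec (fun i => x i + x' i) (fun i => y i + y' i) (z + z').
Proof.
rewrite /cvec addrACA -big_split scalerDl; congr (_ + _).
by apply: eq_bigr => i _; rewrite /= !scalerDl addrACA.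
Qed.

Lemma cvecZ k x y z :
  k *: cvec x y z = cvec (fun i => k * x i) (fun i => k * y i) (k * z).
Proof.
rewrite /cvec scalerDr scalerA scaler_sumr; congr (_ + _).
by apply: eq_bigr => i _; rewrite scalerDr !scalerA.
Qed.

Lemma wedge_cvec k : w k = cvec (fun i => (i == k)%:R) (fun=> 0) 0.
Proof.
rewrite /cvec scale0r addr0 (bigD1 k) //= eqxx scale1r scale0r addr0.
by rewrite big1 ?addr0 // => i /negbTE->; rewrite !scale0r addr0.
Qed.

Lemma contr_cvec k : c k = cvec (fun=> 0) (fun i => (i == k)%:R) 0.
Proof.
rewrite /cvec scale0r addr0 (bigD1 k) //= eqxx scale1r scale0r add0r.
by rewrite big1 ?addr0 // => i /negbTE->; rewrite !scale0r addr0.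
Qed.

Lemma parity_cvec : p = cvec (fun=> 0) (fun=> 0) 1.
Proof. by rewrite /cvec scale1r big1 ?add0r // => i _; rewrite !scale0r addr0. Qed.

Lemma anti_cvec (u : Mat) (a b : 'I_l -> R) d x y z :
  (forall i, u *m w i + w i *m u = (a i)%:M) ->
  (forall i, u *m c i + c i *m u = (b i)%:M) ->
  u *m p + p *m u = d%:M ->
  u *m cvec x y z + cvec x y z *m u
  = (\sum_i (x i * a i + y i * b i) + z * d)%:M.
Proof.
move=> uw uc up; rewrite /cvec mulmxDl mulmxDr addrACA mulmx_sumr mulmx_suml.
rewrite -big_split -scalemxAr -scalemxAl -scalerDr up raddfD /= scale_scalar_mx.
congr (_ + _); rewrite raddf_sum; apply: eq_bigr => i _ /=.
rewrite mulmxDl mulmxDr -!scalemxAr -!scalemxAl addrACA -!scalerDr uw uc.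
by rewrite !scale_scalar_mx -raddfD.
Qed.

Lemma sum_delta (f : 'I_l -> R) k : \sum_i f i * (i == k)%:R = f k.
Proof.
rewrite (bigD1 k) //= eqxx mulr1 big1 ?addr0 // => i /negbTE->.
exact: mulr0.
Qed.

Lemma anti_wedge k x y z : w k *m cvec x y z + cvec x y z *m w k = (y k)%:M.
Proof.
rewrite (@anti_cvec _ (fun=> 0) (fun i => (i == k)%:R) 0) ?wedge_parity ?raddf0 //.
- by congr _%:M; rewrite mulr0 addr0 -[RHS](sum_delta y k); apply: eq_bigr => i _;
    rewrite mulr0 add0r.
- by move=> i; rewrite wedge_anti ?raddf0.
- by move=> i; rewrite wedge_contr eq_sym.
Qed.

Lemma anti_contr k x y z : c k *m cvec x y z + cvec x y z *m c k = (x k)%:M.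
Proof.
rewrite (@anti_cvec _ (fun i => (i == k)%:R) (fun=> 0) 0) ?contr_parity ?raddf0 //.
- by congr _%:M; rewrite mulr0 addr0 -[RHS](sum_delta x k); apply: eq_bigr => i _;
    rewrite mulr0 addr0.
- by move=> i; rewrite addrC wedge_contr.
- by move=> i; rewrite contr_anti ?raddf0.
Qed.

Lemma anti_parity x y z : p *m cvec x y z + cvec x y z *m p = (z * 2)%:M.
Proof.
rewrite (@anti_cvec _ (fun=> 0) (fun=> 0) 2).
- by rewrite big1 ?add0r // => i _; rewrite !mulr0 addr0.
- by move=> i; rewrite addrC wedge_parity raddf0.
- by move=> i; rewrite addrC contr_parity raddf0.
- by rewrite parity_sq -raddfD.
Qed.

Lemma anti_cvec2 x y z x' y' z' :
  cvec x y z *m cvec x' y' z' + cvec x' y' z' *m cvec x y z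
  = (\sum_i (x' i * y i + y' i * x i) + z' * (z * 2))%:M.
Proof.
apply: anti_cvec => [i|i|]; first by rewrite addrC anti_wedge.
  by rewrite addrC anti_contr.
by rewrite addrC anti_parity.
Qed.

Lemma cvec_sq x y z : cvec x y z *m cvec x y z = (qform x y z)%:M.
Proof.
have [u u_def] : exists u, forall i, x i *: w i + y i *: c i = u i by eexists.
have uE i : u i = cvec (fun j => x j * (j == i)%:R) (fun j => y j * (j == i)%:R) 0.
  rewrite -u_def /cvec scale0r addr0 (bigD1 i) //= eqxx !mulr1 big1 ?addr0 // => j /negbTE->.
  by rewrite !mulr0 !scale0r addr0.
have uu i : u i *m u i = (x i * y i)%:M.
  rewrite -u_def mulmxDl !mulmxDr -!scalemxAl -!scalemxAr wedge_sq contr_sq !scaler0.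
  rewrite add0r addr0 !scalerA [y i * x i]mulrC -scalerDr wedge_contr eqxx.
  by rewrite scale_scalar_mx mulr1.
have uup i : u i *m p + p *m u i = 0.
  by rewrite uE addrC anti_parity mul0r raddf0.
have uij i j : i != j -> u i *m u j + u j *m u i = 0.
  move=> ij; rewrite !uE anti_cvec2 !mul0r addr0 big1 ?raddf0 // => k _.
  case: (eqVneq k i) => [->|ki]; first by rewrite (negbTE ij) !mulr0 !mul0r addr0.
  by rewrite !mulr0 addr0.
have sum_sq (r : seq 'I_l) : uniq r -> (\sum_(i <- r) u i) *m (\sum_(i <- r) u i)
    = (\sum_(i <- r) x i * y i)%:M.
  elim: r => [|i r IHr]; first by rewrite !big_nil mul0mx raddf0.
  rewrite !big_cons => /andP[ir /IHr e]; rewrite mulmxDl !mulmxDr e uu raddfD /=.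
  rewrite -addrA; congr (_ + _); rewrite addrA -[RHS]add0r; congr (_ + _).
  rewrite mulmx_sumr mulmx_suml -big_split big_seq big1 // => j jr.
  by apply: uij; apply: contraNneq ir => ->.
rewrite /cvec; under eq_bigr do rewrite u_def.
rewrite mulmxDl !mulmxDr sum_sq ?index_enum_uniq // -!scalemxAl.
rewrite -!scalemxAr parity_sq scalerA -addrA [X in _ + X]addrA.
have -> : z *: ((\sum_i u i) *m p) + z *: (p *m \sum_i u i) = 0.
  rewrite -scalerDr mulmx_suml mulmx_sumr -big_split big1 ?scaler0 // => i _.
  exact: uup.
by rewrite add0r scale_scalar_mx mulr1 -raddfD.
Qed.

Local Notation d0 := (enum_rank (finset.set0 : {set 'I_l})).

Lemma scalar_entry s : (s%:M : Mat) d0 d0 = s.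
Proof. by rewrite mxE eqxx. Qed.

Lemma spinor_scalar_inj s t : s%:M = t%:M :> Mat -> s = t.
Proof. by move=> e; rewrite -(scalar_entry s) e scalar_entry. Qed.

(** The operators of wedge product and contraction have zero diagonals. *)
Lemma cvec_entry x y z :
  cvec x y z d0 d0 = z.
Proof.
rewrite /cvec mxE summxE big1 => [|i _]; last first.
  rewrite !mxE /= enum_rankK.
  have -> : (finset.set0 == i |: finset.set0 :> {set 'I_l})%SET = false.
    by apply/negbTE/eqP => /setP/(_ i); rewrite !inE eqxx.
  by rewrite !andbF !mulr0 addr0.
by rewrite !mxE eqxx enum_rankK cards0 mulr1n mulr1 add0r.
Qed.

End Clifford.

(** * Centraliser of a hyperbolic plane in the even Clifford algebra *)

(** [E] is the even algebra of a quadratic module [X] over the scalars [Sc]; [w]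
    and [c] span a hyperbolic plane orthogonal to [X].  Odd elements are
    described by their products with [X]: the hyperbolic pair [a], [b] in [X]
    makes this sufficient. *)
Section HyperbolicPlane.
Variable P : pzRingType.
Variables (Sc E X : P -> Prop) (w c a b : P).
Hypothesis Sc_central : forall s x, Sc s -> s * x = x * s.
Hypothesis Sc_E : forall s, Sc s -> E s.
Hypothesis E1 : E 1.
Hypothesis EN : forall x, E x -> E (- x).
Hypothesis ED : forall x y, E x -> E y -> E (x + y).
Hypothesis EM : forall x y, E x -> E y -> E (x * y).
Hypothesis XE : forall u v, X u -> X v -> E (u * v).
Hypothesis E_ind : forall Q : P -> Prop, (forall s, Sc s -> Q s) ->
  (forall u v, X u -> X v -> Q (u * v)) ->
  (forall x y, E x -> E y -> Q x -> Q y -> Q (x + y)) ->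
  (forall x y, E x -> E y -> Q x -> Q y -> Q (x * y)) ->
  forall x, E x -> Q x.
Hypotheses (Xa : X a) (Xb : X b) (ab1 : a * b + b * a = 1).
Hypotheses (ww : w * w = 0) (cc : c * c = 0) (wc : w * c + c * w = 1).
Hypothesis wX : forall v, X v -> w * v = - (v * w).
Hypothesis cX : forall v, X v -> c * v = - (v * c).

Definition odd_elt (x : P) : Prop := forall v, X v -> E (x * v) /\ E (v * x).

Lemma E0 : E 0.
Proof. by rewrite -(subrr 1); apply: ED => //; apply: EN. Qed.

(** [1] is inserted between two factors in the form [a * b + b * a]. *)
Lemma insert1 x y : x * y = x * a * (b * y) + x * b * (a * y).
Proof. by rewrite !mulrA -mulrDl -!(mulrA x) -mulrDr ab1 mulr1. Qed.

Lemma E_conj x u v : E x -> X u -> X v -> E (u * x * v).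
Proof.
move=> Ex; move: x Ex u v; apply: E_ind => [s Ss u v Xu Xv|u' v' Xu' Xv' u v Xu Xv
  |x y _ _ IHx IHy u v Xu Xv|x y _ _ IHx IHy u v Xu Xv].
- by rewrite -(Sc_central u Ss) -mulrA; apply: EM; [apply: Sc_E|apply: XE].
- by rewrite mulrA -mulrA; apply: EM; apply: XE.
- by rewrite mulrDr mulrDl; apply: ED; [apply: IHx|apply: IHy].
- rewrite mulrA -mulrA insert1.
  by apply: ED; apply: EM; rewrite ?mulrA; do ?[apply: IHx | apply: IHy].
Qed.

Lemma E_comm x : E x -> w * x = x * w /\ c * x = x * c.
Proof.
have comm t u v : X u -> X v -> (forall v, X v -> t * v = - (v * t)) ->
    t * (u * v) = u * v * t.
  by move=> Xu Xv tX; rewrite mulrA tX // mulNr -!mulrA tX // mulrN opprK.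
move: x; apply: E_ind => [s Ss|u v Xu Xv|x y _ _ [wx cx] [wy cy]|x y _ _ [wx cx] [wy cy]].
- by rewrite !(Sc_central _ Ss).
- by split; apply: comm.
- by rewrite !mulrDr !mulrDl wx cx wy cy.
- by rewrite !mulrA wx cx -!mulrA wy cy.
Qed.

Lemma odd_X v : X v -> odd_elt v.
Proof. by move=> Xv u Xu; split; apply: XE. Qed.

Lemma oddN x : odd_elt x -> odd_elt (- x).
Proof. by move=> Ox v /Ox[Exv Evx]; rewrite mulNr mulrN; split; apply: EN. Qed.

Lemma oddD x y : odd_elt x -> odd_elt y -> odd_elt (x + y).
Proof.
move=> Ox Oy v Xv; have [xv vx] := Ox v Xv; have [yv vy] := Oy v Xv.
by rewrite mulrDl mulrDr; split; apply: ED.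
Qed.

Lemma odd0 : odd_elt 0.
Proof. by move=> v _; rewrite mul0r mulr0; split; apply: E0. Qed.

Lemma odd_odd x y : odd_elt x -> odd_elt y -> E (x * y).
Proof.
move=> Ox Oy; rewrite insert1; have [xa _] := Ox a Xa; have [xb _] := Ox b Xb.
have [_ ay] := Oy a Xa; have [_ by_] := Oy b Xb.
by apply: ED; apply: EM.
Qed.

Lemma E_odd x y : E x -> odd_elt y -> odd_elt (x * y).
Proof.
move=> Ex Oy v Xv; have [yv vy] := Oy v Xv; split; first by rewrite -mulrA; apply: EM.
rewrite mulrA insert1; have [_ ay] := Oy a Xa; have [_ by_] := Oy b Xb.
by apply: ED; apply: EM => //; apply: E_conj.
Qed.

Lemma odd_E x y : odd_elt x -> E y -> odd_elt (x * y).
Proof.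
move=> Ox Ey v Xv; have [xv vx] := Ox v Xv; split; last by rewrite mulrA; apply: EM.
rewrite -mulrA insert1; have [xa _] := Ox a Xa; have [xb _] := Ox b Xb.
by apply: ED; apply: EM => //; rewrite mulrA; apply: E_conj.
Qed.

Lemma odd_anti x : odd_elt x -> w * x = - (x * w) /\ c * x = - (x * c).
Proof.
move=> Ox; have [xa _] := Ox a Xa; have [xb _] := Ox b Xb.
have [wxa cxa] := E_comm xa; have [wxb cxb] := E_comm xb.
have -> : x = x * a * b + x * b * a by rewrite -!mulrA -mulrDr ab1 mulr1.
have F (t y u : P) : t * y = y * t -> t * u = - (u * t) -> t * (y * u) = - (y * u * t).
  by move=> ty tu; rewrite mulrA ty -mulrA tu mulrN mulrA.
rewrite !mulrDr !mulrDl !opprD (F _ _ _ wxa (wX Xb)) (F _ _ _ wxb (wX Xa)).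
by rewrite (F _ _ _ cxa (cX Xb)) (F _ _ _ cxb (cX Xa)).
Qed.

Lemma cwE : c * w = 1 - w * c.
Proof. by rewrite -wc addrAC subrr add0r. Qed.

Lemma wcw : w * (c * w) = w.
Proof. by rewrite cwE mulrBr mulr1 mulrA ww mul0r subr0. Qed.

(** The even algebra of the plane plus [X], in terms of the algebra of [X]. *)
Definition split_elt (x : P) : Prop := exists A B C D,
  [/\ E A, odd_elt B, odd_elt C, E D & x = A + w * B + c * C + w * (c * D)].

Lemma splitE x : E x -> split_elt x.
Proof.
move=> Ex; exists x, 0, 0, 0; split=> //; try exact: odd0; try exact: E0.
by rewrite !mulr0 !addr0.
Qed.

Lemma split_w x : odd_elt x -> split_elt (w * x).
Proof.
move=> Ox; exists 0, x, 0, 0; split=> //; try exact: odd0; try exact: E0.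
by rewrite !mulr0 !addr0 add0r.
Qed.

Lemma split_c x : odd_elt x -> split_elt (c * x).
Proof.
move=> Ox; exists 0, 0, x, 0; split=> //; try exact: odd0; try exact: E0.
by rewrite !mulr0 !addr0 add0r.
Qed.

Lemma split_wc x : E x -> split_elt (w * (c * x)).
Proof.
move=> Ex; exists 0, 0, 0, x; split=> //; try exact: odd0; try exact: E0.
by rewrite !mulr0 !add0r.
Qed.

Lemma splitD x y : split_elt x -> split_elt y -> split_elt (x + y).
Proof.
move=> [A [B [C [D [EA OB OC ED' ->]]]]] [A' [B' [C' [D' [EA' OB' OC' ED'' ->]]]]].
exists (A + A'), (B + B'), (C + C'), (D + D').
split; [exact: ED|exact: oddD|exact: oddD|exact: ED|].
rewrite !mulrDr addrACA; congr (_ + _); rewrite addrACA; congr (_ + _).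
by rewrite addrACA.
Qed.

Lemma splitN x : split_elt x -> split_elt (- x).
Proof.
move=> [A [B [C [D [EA OB OC ED' ->]]]]]; exists (- A), (- B), (- C), (- D).
split; [exact: EN|exact: oddN|exact: oddN|exact: EN|].
by rewrite !mulrN !opprD.
Qed.

(** [w] and [c] commute with even elements and anticommute with odd ones, so that
    they can be collected on the left of a product. *)
Lemma splitM x y : split_elt x -> split_elt y -> split_elt (x * y).
Proof.
move=> [A [B [C [D [EA OB OC ED' ->]]]]] sy.
have ww0 t : w * (w * t) = 0 by rewrite mulrA ww mul0r.
have cc0 t : c * (c * t) = 0 by rewrite mulrA cc mul0r.
have cw t : c * (w * t) = t - w * (c * t).
  by rewrite mulrA cwE mulrBl mul1r mulrA.
have wcwc t : w * (c * (w * t)) = w * t by rewrite cw mulrBr ww0 subr0.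
have cwc t : c * (w * (c * t)) = c * t by rewrite cw cc0 mulr0 subr0.
have ME z t : E z -> split_elt t -> split_elt (z * t).
  move=> Ez [A' [B' [C' [D' [EA' OB' OC' ED'' ->]]]]]; have [wz cz] := E_comm Ez.
  have zw u : z * (w * u) = w * (z * u) by rewrite !mulrA wz.
  have zc u : z * (c * u) = c * (z * u) by rewrite !mulrA cz.
  rewrite !mulrDr !zw !zc; apply: splitD; last by apply: split_wc; apply: EM.
  apply: splitD; last by apply: split_c; apply: E_odd.
  by apply: splitD; [apply: splitE; apply: EM|apply: split_w; apply: E_odd].
have odd_comm z : odd_elt z ->
    (forall u, z * (w * u) = - (w * (z * u))) /\ (forall u, z * (c * u) = - (c * (z * u))).
  move=> /odd_anti[wz cz].
  by split=> u; rewrite !mulrA ?wz ?cz mulNr opprK.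
have Mw z t : odd_elt z -> split_elt t -> split_elt (w * z * t).
  move=> Oz [A' [B' [C' [D' [EA' OB' OC' ED'' ->]]]]]; have [zw zc] := odd_comm z Oz.
  rewrite -mulrA !mulrDr !zw !zc !mulrN !ww0 !oppr0 !addr0.
  apply: splitD; first by apply: split_w; apply: odd_E.
  by apply: splitN; apply: split_wc; apply: odd_odd.
have Mc z t : odd_elt z -> split_elt t -> split_elt (c * z * t).
  move=> Oz [A' [B' [C' [D' [EA' OB' OC' ED'' ->]]]]]; have [zw zc] := odd_comm z Oz.
  rewrite -mulrA !mulrDr !zw !zc !mulrN opprK cc0 oppr0 addr0 cwc cw.
  apply: splitD; last by apply: split_c; apply: odd_E.
  apply: splitD; first by apply: split_c; apply: odd_E.
  apply: splitN; apply: splitD; first by apply: splitE; apply: odd_odd.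
  by apply: splitN; apply: split_wc; apply: odd_odd.
have Mwc z t : E z -> split_elt t -> split_elt (w * (c * z) * t).
  move=> Ez st; rewrite -!mulrA.
  have [A' [B' [C' [D' [EA' OB' OC' ED'' ->]]]]] := ME _ _ Ez st.
  rewrite !mulrDr cc0 mulr0 addr0 !wcwc.
  apply: splitD; last exact: split_wc.
  by apply: splitD; [apply: split_wc|apply: split_w].
rewrite !mulrDl; apply: splitD; last exact: Mwc.
apply: splitD; last exact: Mc.
by apply: splitD; [apply: ME|apply: Mw].
Qed.

Lemma split_vec_mul u s t u' s' t' : X u -> X u' -> Sc s -> Sc t -> Sc s' -> Sc t' ->
  split_elt ((u + s * w + t * c) * (u' + s' * w + t' * c)).
Proof.
move=> Xu Xu' Ss St Ss' St'.
have Ou := odd_X Xu; have Ou' := odd_X Xu'.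
have sw v : X v -> split_elt (v * w).
  move=> Xv; have -> : v * w = w * - v by rewrite mulrN wX ?opprK.
  by apply: split_w; apply: oddN; apply: odd_X.
have sc v : X v -> split_elt (v * c).
  move=> Xv; have -> : v * c = c * - v by rewrite mulrN cX ?opprK.
  by apply: split_c; apply: oddN; apply: odd_X.
have swc : split_elt (w * c) by rewrite -[c]mulr1; apply: split_wc.
have scw : split_elt (c * w).
  by rewrite cwE; apply: splitD; [apply: splitE|apply: splitN].
have s0 : split_elt 0 by apply: splitE; apply: E0.
have Sl z v v' : Sc z -> split_elt (v * v') -> split_elt (z * v * v').
  by move=> Sz sv; rewrite -mulrA; apply: splitM => //; apply: splitE; apply: Sc_E.
have Sr z v v' : Sc z -> split_elt (v * v') -> split_elt (v * (z * v')).
  by move=> Sz sv; rewrite mulrA -(Sc_central v Sz); apply: Sl.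
rewrite !mulrDl !mulrDr; apply: splitD; [apply: splitD|];
  (apply: splitD; [apply: splitD|]);
  do ?[apply: Sr => // | apply: Sl => //]; rewrite ?ww ?cc //.
- by apply: splitE; apply: XE.
- exact: sw.
- exact: sc.
- exact: split_w.
- exact: split_c.
Qed.

(** In the decomposition of [x], commutation with [w] gives [C = w * D], whence
    [C = D = 0] by multiplication by [w] and [w * c + c * w = 1]; then commutation
    with [c] gives [B = 0]. *)
Lemma split_centraliser x :
  split_elt x -> x * w = w * x -> x * c = c * x -> E x.
Proof.
move=> [A [B [C [D [EA OB OC ED' ->]]]]].
have [wA cA] := E_comm EA; have [wB cB] := odd_anti OB.
have [wC cC] := odd_anti OC; have [wD cD] := E_comm ED'.
move=> xw xc.
have CE : w * D = C.
  have Bw' : B * w = - (w * B) by rewrite wB opprK.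
  have Cw' : C * w = - (w * C) by rewrite wC opprK.
  have Bw : w * B * w = 0 by rewrite -mulrA Bw' mulrN mulrA ww mul0r oppr0.
  have Cw : c * C * w = w * (c * C) - C.
    rewrite -mulrA Cw' mulrN mulrA cwE.
    by rewrite mulrBl mul1r opprB mulrA.
  have Dw : w * (c * D) * w = w * D.
    by rewrite -!mulrA -wD (mulrA c) mulrA wcw.
  move: xw; rewrite !mulrDl !mulrDr Bw Cw Dw -wA (mulrA w w B) (mulrA w w) ww !mul0r.
  rewrite !addr0 -!addrA => /addrI; rewrite -[RHS]addr0 => /addrI.
  by rewrite addrC => /subr0_eq.
have wC0 : w * C = 0 by rewrite -CE mulrA ww mul0r.
have C0 : C = 0.
  by rewrite -[C]mul1r -wc mulrDl -!mulrA cC wC0 mulr0 addr0 mulrN mulrA wC0 mul0r oppr0.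
have D0 : D = 0.
  by rewrite -[D]mul1r -wc mulrDl -!mulrA cD mulrA CE C0 mul0r mulr0 addr0.
move: xc; rewrite C0 D0 !mulr0 !addr0 => xc.
have -> : B = 0.
  move: xc; rewrite mulrDl mulrDr -!mulrA.
  have -> : B * c = - (c * B) by rewrite cB opprK.
  rewrite cA => /addrI; rewrite mulrN => e.
  by rewrite -[B]mul1r -wc mulrDl -!mulrA -e addrC addNr.
by rewrite mulr0 addr0.
Qed.

End HyperbolicPlane.

(** * Spin groups *)

Section Reversal.
Variables (R : comPzRingType) (l : nat).
Local Notation Mat := 'M[R]_#|{: {set 'I_l}}|.
Implicit Types (V : set Mat) (g h : Mat).

Lemma reversal_sym V g h : reversal V g h -> reversal V h g.
Proof.
elim=> {g h} [s|v w Vv Vw|g g' h h' _ IH _ IH'|g g' h h' _ IH _ IH'].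
- exact: reversal_scalar.
- exact: reversal_pair.
- exact: reversal_add.
- exact: reversal_mul.
Qed.

Lemma reversal_mono V V' g h : V `<=` V' -> reversal V g h -> reversal V' g h.
Proof.
move=> sV; elim=> {g h} [s|v w Vv Vw|g g' h h' _ IH _ IH'|g g' h h' _ IH _ IH'].
- exact: reversal_scalar.
- by apply: reversal_pair; apply: sV.
- exact: reversal_add.
- exact: reversal_mul.
Qed.

Lemma spin_group1 V : spin_group V 1%:M.
Proof.
exists 1%:M; split; rewrite ?mulmx1 //; first exact: reversal_scalar.
  by move=> v; rewrite mul1mx mulmx1.
by move=> v; rewrite mul1mx mulmx1.
Qed.

Lemma spin_groupM V g g' : spin_group V g -> spin_group V g' -> spin_group V (g *m g').
Proof.
move=> [h [rg gh hg Vg Vh]] [h' [rg' gh' hg' Vg' Vh']]; exists (h' *m h).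
split; first exact: reversal_mul.
- by rewrite mulmxA -(mulmxA g) gh' mulmx1.
- by rewrite mulmxA -(mulmxA h') hg mulmx1.
- move=> v Vv; have -> : g *m g' *m v *m (h' *m h) = g *m (g' *m v *m h') *m h.
    by rewrite !mulmxA.
  exact/Vg/Vg'.
- move=> v Vv; have -> : h' *m h *m v *m (g *m g') = h' *m (h *m v *m g) *m g'.
    by rewrite !mulmxA.
  exact/Vh'/Vh.
Qed.

Lemma spin_groupV V g k : spin_group V g -> g *m k = 1%:M -> spin_group V k.
Proof.
move=> [h [rg gh hg Vg Vh]] gk.
have -> : k = h by rewrite -[k]mul1mx -hg -mulmxA gk mulmx1.
by exists g; split=> //; apply: reversal_sym.
Qed.

(** Conjugation by the element [1 + a *m b], where [a] is a singular vector
    orthogonal to [b], is the Eichler-Siegel transvection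
    [v + B *: a - A *: b - (beta * A) *: a]. *)
Lemma transvection_act (a b v : Mat) A B beta :
  a *m a = 0 -> a *m b + b *m a = 0 -> b *m b = beta%:M ->
  a *m v + v *m a = A%:M -> b *m v + v *m b = B%:M ->
  (1%:M + a *m b) *m v = (v + (B - beta * A) *: a - A *: b) *m (1%:M + a *m b).
Proof.
move=> aa ab bb av bv.
have ba : b *m a = - (a *m b) by apply/eqP; rewrite -addr_eq0 addrC ab.
have avE : a *m v = A%:M - v *m a by rewrite -av addrK.
have bvE : b *m v = B%:M - v *m b by rewrite -bv addrK.
have aab : a *m (a *m b) = 0 by rewrite mulmxA aa mul0mx.
have bab : b *m (a *m b) = - (beta *: a).
  by rewrite mulmxA ba mulNmx -mulmxA bb mul_mx_scalar.
have -> : (1%:M + a *m b) *m v = v + B *: a - A *: b + v *m (a *m b).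
  rewrite mulmxDl mul1mx -mulmxA bvE mulmxBr mul_mx_scalar (mulmxA a v) avE mulmxBl.
  rewrite mul_scalar_mx -mulmxA; move: (v *m (a *m b)) => x.
  by apply/matrixP => i j; rewrite !mxE; ring.
rewrite mulmxDr mulmx1 !mulmxDl mulNmx -!scalemxAl aab bab scaler0 addr0.
move: (v *m (a *m b)) => x.
by apply/matrixP => i j; rewrite !mxE; ring.
Qed.

End Reversal.

Section SpinGroup.
Variables (R : comPzRingType) (l : nat) (with_e0 : bool).
Local Notation Mat := 'M[R]_#|{: {set 'I_l}}|.
Local Notation V := (@clifford_vectors R l with_e0).
Local Notation w := (@wedge R l).
Local Notation c := (@contr R l).
Local Notation p := (parity R l).
Implicit Types (S : set 'I_l) (g h u v : Mat).

Lemma clifford_lin S k m u v : V S u -> V S v -> V S (k *: u + m *: v).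
Proof.
move=> [x [y [z [xy0 z0 ->]]]] [x' [y' [z' [xy'0 z'0 ->]]]].
exists (fun i => k * x i + m * x' i), (fun i => k * y i + m * y' i), (k * z + m * z').
split.
- by move=> i Si; have [-> ->] := xy0 i Si; have [-> ->] := xy'0 i Si; rewrite !mulr0 addr0.
- by move=> b0; rewrite z0 // z'0 // !mulr0 addr0.
- by rewrite -/(cvec x y z) -/(cvec x' y' z') !cvecZ cvecD.
Qed.

Lemma clifford_add S u v : V S u -> V S v -> V S (u + v).
Proof. by move=> Su Sv; rewrite -[u]scale1r -[v]scale1r; apply: clifford_lin. Qed.

Lemma clifford_scale S k u : V S u -> V S (k *: u).
Proof. by move=> Su; rewrite -[_ *: _]addr0 -[0](scale0r u); apply: clifford_lin. Qed.

Lemma clifford_wedge S i : S i -> V S (w i).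
Proof.
move=> Si; exists (fun j => (j == i)%:R), (fun=> 0), 0; split=> //; last exact: wedge_cvec.
by move=> j Sj; case: eqP => // ji; rewrite ji in Sj.
Qed.

Lemma clifford_contr S i : S i -> V S (c i).
Proof.
move=> Si; exists (fun=> 0), (fun j => (j == i)%:R), 0; split=> //; last exact: contr_cvec.
by move=> j Sj; case: eqP => // ji; rewrite ji in Sj.
Qed.

Lemma clifford_parity S : with_e0 -> V S p.
Proof.
move=> e0; exists (fun=> 0), (fun=> 0), 1; split=> //; last exact: parity_cvec.
by rewrite e0.
Qed.

Lemma clifford_anti S u v : V S u -> V S v -> exists s, u *m v + v *m u = s%:M.
Proof.
move=> [x [y [z [_ _ ->]]]] [x' [y' [z' [_ _ ->]]]].
by eexists; apply: anti_cvec2.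
Qed.

Lemma clifford_sq S u : V S u -> exists s, u *m u = s%:M.
Proof. by move=> [x [y [z [_ _ ->]]]]; eexists; apply: cvec_sq. Qed.

Lemma clifford_mono S S' : S `<=` S' -> V S `<=` V S'.
Proof.
move=> sS v [x [y [z [xy0 z0 ->]]]]; exists x, y, z; split=> // i nSi.
by apply: xy0 => /sS.
Qed.

Lemma transvection_inv (a b : Mat) beta : a *m a = 0 -> a *m b + b *m a = 0 ->
  b *m b = beta%:M ->
  (1%:M + a *m b) *m (1%:M + b *m a) = 1%:M /\ (1%:M + b *m a) *m (1%:M + a *m b) = 1%:M.
Proof.
move=> aa ab bb.
have abba : a *m b *m (b *m a) = 0.
  by rewrite -mulmxA (mulmxA b b) bb mul_scalar_mx -scalemxAr aa scaler0.
have baab : b *m a *m (a *m b) = 0.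
  by rewrite -mulmxA (mulmxA a a) aa mul0mx mulmx0.
rewrite !mulmxDl !mulmxDr !mul1mx !mulmx1 abba baab !addr0 -!addrA.
by rewrite [b *m a + _]addrC ab addr0.
Qed.

(** The reversal of [1 + a *m b] is [1 + b *m a], which is also its inverse, and
    conjugation maps vectors to vectors by [transvection_act]. *)
Lemma spin_transvection S (a b : Mat) : V S a -> V S b -> a *m a = 0 ->
  a *m b + b *m a = 0 -> spin_group (V S) (1%:M + a *m b).
Proof.
move=> Sa Sb aa ab; have [beta bb] := clifford_sq Sb.
have [gh hg] := transvection_inv aa ab bb.
exists (1%:M + b *m a); split=> //.
- by apply: reversal_add; [apply: reversal_scalar|apply: reversal_pair].
- move=> v Sv; have [A av] := clifford_anti Sa Sv; have [B bv] := clifford_anti Sb Sv.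
  rewrite (transvection_act aa ab bb av bv) -mulmxA gh mulmx1.
  rewrite -scaleN1r; apply: clifford_add; last by do 2!apply: clifford_scale.
  by apply: clifford_add => //; apply: clifford_scale.
- move=> v Sv; have ba : b *m a = a *m - b.
    by rewrite mulmxN; apply/eqP; rewrite -addr_eq0 addrC ab.
  have Sb' : V S (- b) by rewrite -scaleN1r; apply: clifford_scale.
  have ab' : a *m - b + - b *m a = 0 by rewrite mulmxN mulNmx -opprD ab oppr0.
  have bb' : - b *m - b = beta%:M by rewrite mulmxN mulNmx opprK.
  have [A av] := clifford_anti Sa Sv; have [B bv] := clifford_anti Sb' Sv.
  rewrite ba (transvection_act aa ab' bb' av bv) -ba -mulmxA hg mulmx1.
  rewrite -scaleN1r; apply: clifford_add; last by do 2!apply: clifford_scale.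
  by apply: clifford_add => //; apply: clifford_scale.
Qed.

Variables o k : 'I_l.
Hypothesis ko : k != o.
Local Notation S' := [set i | i != o]%classic.
(** An element and its reversal form a pair in the product of the matrix ring and
    its opposite; the pairs related by [reversal] are a subring, to which the
    abstract argument about the hyperbolic plane applies. *)
Local Notation P := (Mat * Mat^c)%type.

Let Sc (x : P) := exists s : R, x = (s%:M, s%:M).
Let Ev (x : P) := reversal (V S') x.1 x.2.
Let X (x : P) := exists2 v, V S' v & x = (v, v).
Let dg (v : Mat) : P := (v, v).

Lemma clifford_split v : V setT v ->
  exists u s t, V S' u /\ v = u + s *: w o + t *: c o.
Proof.
move=> [x [y [z [_ z0 ->]]]].
exists (cvec (fun i => if i == o then 0 else x i) (fun i => if i == o then 0 else y i) z).
exists (x o), (y o); split.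
  eexists; eexists; eexists; split; last reflexivity; last exact: z0.
  by move=> i /negP; rewrite negbK => /eqP->; rewrite eqxx.
rewrite wedge_cvec contr_cvec !cvecZ !cvecD; apply: eq_cvec => [i|i|].
- by case: eqP => [->|_]; rewrite ?mulr0 ?mulr1 ?addr0 ?add0r.
- by case: eqP => [->|_]; rewrite ?mulr0 ?mulr1 ?addr0 ?add0r.
- by rewrite !mulr0 !addr0.
Qed.

Lemma anti_S' v : V S' v -> w o *m v = - (v *m w o) /\ c o *m v = - (v *m c o).
Proof.
move=> [x [y [z [xy0 _ ->]]]]; have [x0 y0] : x o = 0 /\ y o = 0.
  by apply: xy0; rewrite /= eqxx.
split; apply/eqP; rewrite -addr_eq0 -/(cvec x y z).
  by rewrite anti_wedge y0 raddf0.
by rewrite anti_contr x0 raddf0.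
Qed.

Let Xa : X (dg (w k)). Proof. by exists (w k) => //; apply: clifford_wedge. Qed.
Let Xb : X (dg (c k)). Proof. by exists (c k) => //; apply: clifford_contr. Qed.
Let ab1 : dg (w k) * dg (c k) + dg (c k) * dg (w k) = 1.
Proof.
congr pair; rewrite -?[RHS]/(1%:M); last rewrite addrC.
  by have := wedge_contr R k k; rewrite eqxx.
by have := wedge_contr R k k; rewrite eqxx.
Qed.
Let ww : dg (w o) * dg (w o) = 0.
Proof. by congr pair; apply: wedge_sq. Qed.
Let cc : dg (c o) * dg (c o) = 0.
Proof. by congr pair; apply: contr_sq. Qed.
Let wc : dg (w o) * dg (c o) + dg (c o) * dg (w o) = 1.
Proof.
congr pair; last rewrite addrC.
  by have := wedge_contr R o o; rewrite eqxx.
by have := wedge_contr R o o; rewrite eqxx.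
Qed.
Let wX (v : P) : X v -> dg (w o) * v = - (v * dg (w o)).
Proof.
move=> [u Su ->]; have [wu _] := anti_S' Su; congr pair; first exact: wu.
by apply: oppr_inj; rewrite opprK; exact: (esym wu).
Qed.
Let cX (v : P) : X v -> dg (c o) * v = - (v * dg (c o)).
Proof.
move=> [u Su ->]; have [_ wu] := anti_S' Su; congr pair; first exact: wu.
by apply: oppr_inj; rewrite opprK; exact: (esym wu).
Qed.
Let Sc_central s x : Sc s -> s * x = x * s.
Proof.
move=> [t ->]; case: x => g h; congr pair; first exact: (esym (scalar_mxC t g)).
exact: (scalar_mxC t h).
Qed.
Let Sc_E s : Sc s -> Ev s.
Proof. by move=> [t ->]; apply: reversal_scalar. Qed.
Let E1 : Ev 1. Proof. exact: (reversal_scalar _ 1). Qed.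
Let ED x y : Ev x -> Ev y -> Ev (x + y). Proof. exact: reversal_add. Qed.
Let EM x y : Ev x -> Ev y -> Ev (x * y). Proof. exact: reversal_mul. Qed.
Let EN x : Ev x -> Ev (- x).
Proof.
move=> Ex; rewrite -mulN1r; apply: EM => //.
have -> : -1 = dg ((-1)%:M) by rewrite /dg raddfN.
exact: reversal_scalar.
Qed.
Let XE (u v : P) : X u -> X v -> Ev (u * v).
Proof. by move=> [u' Su ->] [v' Sv ->]; apply: reversal_pair. Qed.
Let E_ind (Q : P -> Prop) : (forall s, Sc s -> Q s) ->
  (forall u v : P, X u -> X v -> Q (u * v)) ->
  (forall x y, Ev x -> Ev y -> Q x -> Q y -> Q (x + y)) ->
  (forall x y, Ev x -> Ev y -> Q x -> Q y -> Q (x * y)) ->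
  forall x, Ev x -> Q x.
Proof.
move=> Qs Qp Qa Qm [g h]; rewrite /Ev /=.
elim=> {g h} [s|v u Vv Vu|g g' h h' r IH r' IH'|g g' h h' r IH r' IH'].
- by apply: Qs; exists s.
- by apply: (Qp (dg v) (dg u)); [exists v|exists u].
- exact: (Qa (g, h) (g', h')).
- exact: (Qm (g, h) (g', h')).
Qed.

Let sE := @splitE P Ev X (dg (w o)) (dg (c o)) E1 EN ED.
Let sD := @splitD P Ev X (dg (w o)) (dg (c o)) ED.
Let sM := splitM Sc_central Sc_E E1 EN ED EM XE E_ind Xa Xb ab1 ww cc wc wX cX.
Let svec := split_vec_mul Sc_central Sc_E E1 EN ED EM XE E_ind Xa Xb ab1 ww cc wc wX cX.
Let scentral := split_centraliser Sc_central E_ind Xa Xb ab1 ww wc wX cX.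
Let scomm := E_comm Sc_central E_ind wX cX.

Let dg_lin u s t : (u + s *: w o + t *: c o, u + s *: w o + t *: c o)
  = dg u + dg s%:M * dg (w o) + dg t%:M * dg (c o) :> P.
Proof.
have el : u + s *: w o + t *: c o = u + s%:M *m w o + t%:M *m c o.
  by rewrite !mul_scalar_mx.
have er : u + s *: w o + t *: c o = u + w o *m s%:M + c o *m t%:M.
  by rewrite !mul_mx_scalar.
exact: (congr2 pair el er).
Qed.

Lemma reversal_split g h : reversal (V setT) g h ->
  split_elt Ev X (dg (w o)) (dg (c o)) (g, h).
Proof.
elim=> {g h} [s|v u Vv Vu|g g' h h' r IH r' IH'|g g' h h' r IH r' IH'].
- by apply: sE; exact: reversal_scalar.
- have [v' [s [t [Sv ->]]]] := clifford_split Vv.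
  have [u' [s' [t' [Su ->]]]] := clifford_split Vu.
  have -> : ((v' + s *: w o + t *: c o) *m (u' + s' *: w o + t' *: c o),
      (u' + s' *: w o + t' *: c o) *m (v' + s *: w o + t *: c o))
    = (dg v' + dg s%:M * dg (w o) + dg t%:M * dg (c o))
      * (dg u' + dg s'%:M * dg (w o) + dg t'%:M * dg (c o)) :> P.
    by rewrite -!dg_lin.
  by apply: svec; [exists v'|exists u'|exists s|exists t|exists s'|exists t'].
- exact: sD IH IH'.
- exact: sM IH IH'.
Qed.

(** The centraliser of a hyperbolic plane in the even Clifford algebra is the
    even Clifford algebra of the complement, and a conjugation that fixes the
    plane preserves its complement. *)
Lemma spin_centraliser g : spin_group (V setT) g ->
  g *m w o = w o *m g -> g *m c o = c o *m g -> spin_group (V S') g.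
Proof.
move=> [h [rg gh hg Vg Vh]] gw gc.
have hw : h *m w o = w o *m h.
  by rewrite -[LHS]mulmx1 -gh mulmxA -(mulmxA h) -gw mulmxA hg mul1mx.
have hc : h *m c o = c o *m h.
  by rewrite -[LHS]mulmx1 -gh mulmxA -(mulmxA h) -gc mulmxA hg mul1mx.
have conj_S' g' h' v : g' *m h' = 1%:M -> g' *m w o = w o *m g' ->
    g' *m c o = c o *m g' -> h' *m w o = w o *m h' -> h' *m c o = c o *m h' ->
    V setT (g' *m v *m h') -> V S' v -> V S' (g' *m v *m h').
  move=> gh' gw' gc' hw' hc' [x [y [z [_ z0 e]]]] Sv.
  have [wv cv] := anti_S' Sv; move: e; rewrite -/(cvec x y z) => e.
  have anti u : u *m v = - (v *m u) -> g' *m u = u *m g' -> h' *m u = u *m h' ->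
      u *m cvec x y z + cvec x y z *m u = 0.
    move=> uv gu hu; rewrite -e !mulmxA -gu -(mulmxA g') uv mulmxN mulNmx.
    by rewrite -(mulmxA _ h') hu !mulmxA addNr.
  exists x, y, z; split=> // i /negP; rewrite negbK => /eqP->.
  have := anti _ wv gw' hw'; rewrite anti_wedge -(raddf0 (@scalar_mx R _)) => /spinor_scalar_inj->.
  have := anti _ cv gc' hc'; rewrite anti_contr -(raddf0 (@scalar_mx R _)) => /spinor_scalar_inj->.
  by [].
have Vmono : V S' `<=` V setT by apply: clifford_mono.
exists h; split=> //.
- have := scentral (reversal_split rg); apply; congr pair => //; exact: esym.
- by move=> v Sv; apply: conj_S' => //; apply/Vg/Vmono.
- by move=> v Sv; apply: conj_S' => //; apply/Vh/Vmono.
Qed.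

Lemma spin_sub g : spin_group (V S') g -> spin_group (V setT) g.
Proof.
move=> [h [rg gh hg Vg Vh]].
have Vmono : V S' `<=` V setT by apply: clifford_mono.
have [e1 e2] := scomm (x := (g, h)) rg.
have wg : w o *m g = g *m w o := congr1 fst e1.
have wh : w o *m h = h *m w o := esym (congr1 snd e1).
have cg : c o *m g = g *m c o := congr1 fst e2.
have ch : c o *m h = h *m c o := esym (congr1 snd e2).
have conj g' h' v : g' *m h' = 1%:M -> w o *m g' = g' *m w o -> c o *m g' = g' *m c o ->
    (forall v, V S' v -> V S' (g' *m v *m h')) -> V setT v -> V setT (g' *m v *m h').
  move=> gh' wg' cg' Vg' /clifford_split[u [s [t [Su ->]]]].
  rewrite !mulmxDr !mulmxDl -!scalemxAr -!scalemxAl -wg' -cg' -!mulmxA gh' !mulmx1.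
  apply: clifford_add; last by apply: clifford_scale; apply: clifford_contr.
  apply: clifford_add; last by apply: clifford_scale; apply: clifford_wedge.
  by apply: Vmono; rewrite mulmxA; apply: Vg'.
exists h; split=> //.
- exact: reversal_mono rg.
- by move=> v; apply: conj.
- by move=> v; apply: conj.
Qed.

End SpinGroup.

(** * Root vectors of types B and D *)

(** The common form of the root vectors of types B and D. *)
Record spin_root_vectors (R : comPzRingType) (l : nat) (with_e0 : bool)
    (rv : 'rV[int]_l -> 'M[R]_#|{: {set 'I_l}}|) : Prop := SpinRootVectors {
  rv_sum : forall i j : 'I_l, (i < j)%N ->
    rv (evec l i + evec l j) = wedge R i *m wedge R j;
  rv_opp : forall i j : 'I_l, (i < j)%N ->
    rv (- (evec l i + evec l j)) = contr R j *m contr R i;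
  rv_diff : forall i j : 'I_l, i != j ->
    rv (evec l i - evec l j) = wedge R i *m contr R j;
  rv_short : with_e0 -> forall i : 'I_l, rv (evec l i) = wedge R i *m parity R l;
  rv_Nshort : with_e0 -> forall i : 'I_l, rv (- evec l i) = parity R l *m contr R i }.

Section SpinRoots.
Variables (R : comPzRingType) (l : nat).
Local Notation Mat := 'M[R]_#|{: {set 'I_l}}|.
Local Notation w := (@wedge R l).
Local Notation c := (@contr R l).
Local Notation p := (parity R l).
Local Notation e := (evec l).
Local Notation rD := (root_vector (X := TypeD) (l := l) R).
Local Notation rB := (root_vector (X := TypeB) (l := l) R).
Implicit Types (i j : 'I_l) (a : 'rV[int]_l).

Lemma sum_pairs0 (P t : rel 'I_l) (F : 'I_l -> 'I_l -> Mat) :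
  (forall i j, P i j -> t i j = false) ->
  \sum_i \sum_(j | P i j) (t i j)%:R *: F i j = 0.
Proof.
by move=> t0; rewrite big1 // => i _; rewrite big1 // => j /t0->; rewrite scale0r.
Qed.

Lemma sum_pairs_delta (P t : rel 'I_l) (F : 'I_l -> 'I_l -> Mat) i0 j0 : P i0 j0 ->
  (forall i j, P i j -> t i j = (i == i0) && (j == j0)) ->
  \sum_i \sum_(j | P i j) (t i j)%:R *: F i j = F i0 j0.
Proof.
move=> P0 tE; rewrite (bigD1 i0) //= [X in _ + X]big1 ?addr0 => [|i /negbTE ne]; last first.
  by rewrite big1 // => j /tE->; rewrite ne scale0r.
rewrite (bigD1 j0) //= [X in _ + X]big1 ?addr0 => [|j /andP[/tE-> /negbTE->]]; last first.
  by rewrite andbF scale0r.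
by rewrite tE // !eqxx scale1r.
Qed.

Lemma root_vector_D_E a : rD a =
  \sum_(i < l) \sum_(j < l | (i < j)%N) (a == e i + e j)%:R *: (w i *m w j)
  + \sum_(i < l) \sum_(j < l | (i < j)%N) (a == - (e i + e j))%:R *: (c j *m c i)
  + \sum_(i < l) \sum_(j < l | i != j) (a == e i - e j)%:R *: (w i *m c j).
Proof.
rewrite /root_vector; congr (_ + _); rewrite -big_split; apply: eq_bigr => i _.
by rewrite -big_split.
Qed.

Lemma root_vector_D_sum i j : (i < j)%N -> rD (e i + e j) = w i *m w j.
Proof.
move=> ij; rewrite root_vector_D_E.
rewrite (@sum_pairs_delta (fun i j : 'I_l => i < j)%N
  (fun i' j' => e i + e j == e i' + e j') (fun i j => w i *m w j) i j) //.
  rewrite (@sum_pairs0 (fun i j : 'I_l => i < j)%N) => [|i' j' _]; last first.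
    by rewrite coord_sum_neq // !coord_sumE.
  rewrite (@sum_pairs0 (fun i j : 'I_l => i != j)) ?addr0 // => i' j' _.
  by rewrite coord_sum_neq // !coord_sumE.
move=> i' j' ij'; rewrite evec_add_eq; case: (_ && _) => //=.
by apply/negbTE/negP => /andP[/eqP e1 /eqP e2]; move: ij ij'; rewrite e1 e2; lia.
Qed.

Lemma root_vector_D_opp i j : (i < j)%N -> rD (- (e i + e j)) = c j *m c i.
Proof.
move=> ij; rewrite root_vector_D_E.
rewrite (@sum_pairs0 (fun i j : 'I_l => i < j)%N) => [|i' j' _]; last first.
  by rewrite coord_sum_neq // !coord_sumE.
rewrite (@sum_pairs_delta (fun i j : 'I_l => i < j)%N
  (fun i' j' => - (e i + e j) == - (e i' + e j')) (fun i j => c j *m c i) i j) //.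
  rewrite (@sum_pairs0 (fun i j : 'I_l => i != j)) ?addr0 ?add0r // => i' j' _.
  by rewrite coord_sum_neq // !coord_sumE.
move=> i' j' ij'; rewrite eqr_opp evec_add_eq; case: (_ && _) => //=.
by apply/negbTE/negP => /andP[/eqP e1 /eqP e2]; move: ij ij'; rewrite e1 e2; lia.
Qed.

Lemma root_vector_D_diff i j : i != j -> rD (e i - e j) = w i *m c j.
Proof.
move=> ij; rewrite root_vector_D_E.
rewrite (@sum_pairs0 (fun i j : 'I_l => i < j)%N) => [|i' j' _]; last first.
  by rewrite coord_sum_neq // !coord_sumE.
rewrite (@sum_pairs0 (fun i j : 'I_l => i < j)%N) => [|i' j' _]; last first.
  by rewrite coord_sum_neq // !coord_sumE.
rewrite !add0r.
rewrite (@sum_pairs_delta (fun i j : 'I_l => i != j)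
  (fun i' j' => e i - e j == e i' - e j') (fun i j => w i *m c j) i j) // => i' j' _.
by rewrite evec_sub_eq.
Qed.

Lemma root_vector_D_odd a : ~~ (2 %| coord_sum a)%Z -> rD a = 0.
Proof.
move=> odd_a.
have neq b : (2 %| coord_sum b)%Z -> (a == b) = false.
  by move=> eb; apply/eqP => ab; rewrite ab eb in odd_a.
by rewrite root_vector_D_E !sum_pairs0 ?addr0 // => i j _; apply: neq; rewrite !coord_sumE.
Qed.

Lemma root_vector_B_E a : rB a = rD a + \sum_(i < l) ((a == e i)%:R *: (w i *m p)
  + (a == - e i)%:R *: (p *m c i)).
Proof. by []. Qed.

Lemma root_vector_B_even a : (2 %| coord_sum a)%Z -> rB a = rD a.
Proof.
move=> even_a; have neq b : ~~ (2 %| coord_sum b)%Z -> (a == b) = false.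
  by apply: contraNF => /eqP<-.
rewrite root_vector_B_E big1 ?addr0 // => i _.
by rewrite !neq ?coord_sumE // !scale0r addr0.
Qed.

Lemma evec_NevecF i j : (e i == - e j) = false.
Proof. by rewrite coord_sum_neq // !coord_sumE. Qed.

Lemma evec_eqE i j : (e i == e j) = (i == j).
Proof. by apply/eqP/eqP => [/evec_inj|->]. Qed.

Lemma root_vector_B_short i : rB (e i) = w i *m p.
Proof.
rewrite root_vector_B_E root_vector_D_odd ?coord_sumE // add0r (bigD1 i) //=.
rewrite big1 => [|j ji]; rewrite evec_NevecF evec_eqE scale0r addr0 ?addr0 ?eqxx ?scale1r //.
by rewrite eq_sym (negbTE ji) scale0r.
Qed.

Lemma root_vector_B_Nshort i : rB (- e i) = p *m c i.
Proof.
rewrite root_vector_B_E root_vector_D_odd ?coord_sumE // add0r (bigD1 i) //=.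
rewrite big1 => [|j ji]; rewrite eqr_opp [- _ == e _]eq_sym evec_NevecF evec_eqE scale0r.
  by rewrite addr0 add0r eqxx scale1r.
by rewrite add0r eq_sym (negbTE ji) scale0r.
Qed.

Lemma spin_root_vectors_D : spin_root_vectors false rD.
Proof.
split=> // [i j|i j|i j]; [exact: root_vector_D_sum|exact: root_vector_D_opp|].
exact: root_vector_D_diff.
Qed.

Lemma spin_root_vectors_B : spin_root_vectors true rB.
Proof.
split=> [i j ij|i j ij|i j ij|_ i|_ i].
- by rewrite root_vector_B_even ?root_vector_D_sum // !coord_sumE.
- by rewrite root_vector_B_even ?root_vector_D_opp // !coord_sumE.
- by rewrite root_vector_B_even ?root_vector_D_diff // !coord_sumE.
- exact: root_vector_B_short.
- exact: root_vector_B_Nshort.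
Qed.

End SpinRoots.

(** The roots of types B and D that occur in the four unipotent factors and are
    used in the proof. *)
Record spin_roots (n : nat) (with_e0 : bool) (o i1 : 'I_n)
    (Pos Neg VN SPos : set 'rV[int]_n) : Prop := SpinRoots {
  Pos_sum : forall i j : 'I_n, i != j -> Pos (evec n i + evec n j);
  Pos_diff : Pos (evec n o - evec n i1);
  Neg_sum : forall i j : 'I_n, i != j -> Neg (- (evec n i + evec n j));
  Neg_diff : forall j : 'I_n, j != o -> j != i1 -> Neg (evec n j - evec n i1);
  VN_diff : forall j : 'I_n, j != o -> VN (evec n j - evec n o);
  VN_sum : forall j : 'I_n, j != o -> j != i1 -> VN (- (evec n o + evec n j));
  VN_short : with_e0 -> VN (- evec n o);
  SPos_sum : forall j : 'I_n, j != o -> SPos (evec n o + evec n j);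
  SPos_diff : forall j : 'I_n, j != o -> SPos (evec n o - evec n j);
  SPos_short : with_e0 -> SPos (evec n o) }.

(** [b] tells type B from type D. *)
Section RootsBD.
Variables (b : bool) (l : nat).
Hypothesis l_ge3 : (3 <= l)%N.
Local Notation X := (if b then TypeB else TypeD).
Local Notation n := (coord_dim X l).
Local Notation e := (evec n).
Variables (o i1 : 'I_n).
Hypotheses (o0 : o = 0%N :> nat) (i11 : i1 = 1%N :> nat).
Implicit Types i j : 'I_n.

Let l1 : (1 < l)%N. Proof. by lia. Qed.
Let lD : X = TypeD -> (2 < l)%N. Proof. by []. Qed.

Lemma root_sum i j : i != j -> root_system X l (e i + e j).
Proof. by move: i j; case: b => i j ij /=; [left|]; apply: (@D_roots_add TypeD l). Qed.

Lemma nonneg_sum i j : i != j -> nonneg_combination (X := X) (e i + e j).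
Proof.
by move: i j; case: b => i j ij; [apply: nonneg_sum_B|apply: nonneg_sum_D].
Qed.

Lemma root_short i : b -> root_system X l (e i).
Proof.
by move: i; case: b => // i _; right; exists i, false; rewrite scale1r.
Qed.

Lemma nonneg_short i : b -> nonneg_combination (X := X) (e i).
Proof. by move: i; case: b => // i _; apply: nonneg_B. Qed.

Lemma positive_sum i j : i != j -> positive_roots X l (e i + e j).
Proof. by move=> ij; split; [apply: root_sum|apply: nonneg_sum]. Qed.

Lemma negative_sum i j : i != j -> negative_roots X l (- (e i + e j)).
Proof. by move=> ij; rewrite /negative_roots /= opprK; apply: positive_sum. Qed.

Lemma first_coord j : j != o -> e j 0 o = 0.
Proof. by move=> /negbTE jo; rewrite evecE eq_sym; have := jo; rewrite -val_eqE => ->. Qed.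

Lemma first_coord_o : e o 0 o = 1.
Proof. by rewrite evecE eqxx. Qed.

Lemma lt_o j : j != o -> (o < j)%N.
Proof. by rewrite -val_eqE /= o0 lt0n. Qed.

Lemma Sigma1_sum j : j != o -> Sigma1_pos X l (e o + e j).
Proof.
move=> jo; have oj : o != j by rewrite eq_sym.
apply: (@Sigma1_pos_nonneg X l o) => //; [exact: root_sum|exact: nonneg_sum|].
by rewrite mxE first_coord_o first_coord.
Qed.

Lemma Sigma1_diff j : j != o -> Sigma1_pos X l (e o - e j).
Proof.
move=> jo; have [Pj nj] : positive_roots X l (e o - e j) by apply/positive_diff/lt_o.
apply: (@Sigma1_pos_nonneg X l o) => //.
by rewrite !mxE; have := first_coord jo; rewrite evecE => ->; rewrite eqxx.
Qed.

Lemma Sigma1_short : b -> Sigma1_pos X l (e o).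
Proof.
move=> bB; apply: (@Sigma1_pos_nonneg X l o) => //.
- exact: root_short.
- exact: nonneg_short.
- by rewrite first_coord_o.
Qed.

Lemma neq_amax (u : 'rV[int]_n) : u 0 i1 != 1 -> - u != - (e o + e i1).
Proof.
by apply: contraNneq => /oppr_inj ->; rewrite mxE !evecE o0 i11.
Qed.

Lemma coord_evec j : e j 0 i1 = (j == i1)%:R.
Proof. by rewrite evecE -val_eqE /= eq_sym. Qed.

Lemma negative_cw j : j != o -> j != i1 -> negative_roots X l (e j - e i1).
Proof.
move=> jo; rewrite -val_eqE /= => ji; apply: negative_diff.
by have := lt_o jo; lia.
Qed.

Local Notation V := (Sigma1_neg X l `\ (- (e o + e i1))).

Lemma o_neq_i1 : (o == i1) = false.
Proof. by rewrite -val_eqE /= o0 i11. Qed.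

Lemma Sigma1_neg_cw j : j != o -> V (e j - e o).
Proof.
move=> jo; split; first by rewrite /Sigma1_neg /= opprB; apply: Sigma1_diff.
rewrite -opprB; apply/eqP/neq_amax; rewrite mxE coord_evec o_neq_i1 mxE coord_evec.
by case: (j == i1).
Qed.

Lemma Sigma1_neg_cc j : j != o -> j != i1 -> V (- (e o + e j)).
Proof.
move=> jo ji; split; first by rewrite /Sigma1_neg /= opprK; apply: Sigma1_sum.
by apply/eqP/neq_amax; rewrite mxE !coord_evec (negbTE ji) o_neq_i1.
Qed.

Lemma Sigma1_neg_short : b -> V (- e o).
Proof.
move=> bB; split; first by rewrite /Sigma1_neg /= opprK; apply: Sigma1_short.
by apply/eqP/neq_amax; rewrite coord_evec o_neq_i1.
Qed.

Lemma spin_rootsP : spin_roots b o i1 (positive_roots X l) (negative_roots X l) V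
  (Sigma1_pos X l).
Proof.
split.
- exact: positive_sum.
- by apply: positive_diff; rewrite o0 i11.
- exact: negative_sum.
- exact: negative_cw.
- exact: Sigma1_neg_cw.
- exact: Sigma1_neg_cc.
- exact: Sigma1_neg_short.
- exact: Sigma1_sum.
- exact: Sigma1_diff.
- exact: Sigma1_short.
Qed.

Lemma coord_support_BD : coord_support (Delta1 X l) = [set i | i != o].
Proof.
apply: coord_support_Delta1 => // i io.
have [j2 j2E] : exists j : 'I_n, j = 2%N :> nat.
  by move: l_ge3; case: (b) => l3; exists (Ordinal l3).
have [j [jo ji]] : exists j : 'I_n, j != o /\ j != i.
  have [->|ni] := eqVneq i i1.
    by exists j2; rewrite -!val_eqE /= j2E o0 i11.
  by exists i1; rewrite eq_sym o_neq_i1 eq_sym.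
have coord a c : a != o -> c != o -> a != c -> (e a - e c) 0 o = 0 /\ (e a - e c) 0 i
    = (i == a)%:R - (i == c)%:R.
  by move=> ao co ac; rewrite mxE first_coord // mxE first_coord // !mxE.
have [ij|ij] := boolP (i < j)%N.
  exists (e i - e j); have [Pij nij] := @positive_diff X l i j ij.
  have [-> ->] := coord i j io jo (negbT (ltn_eqF ij)).
  by split=> //; rewrite eqxx [i == j]eq_sym (negbTE ji).
have {}ij : (j < i)%N by move: ij ji; rewrite -val_eqE /=; lia.
exists (e j - e i); have [Pij nij] := @positive_diff X l j i ij.
have [-> ->] := coord j i jo io ji.
by split=> //; rewrite eqxx [i == j]eq_sym (negbTE ji).
Qed.

End RootsBD.

(** * Transvections in spin groups *)

Section SpinMoves.
Variables (R : comPzRingType) (l : nat) (I : set R) (with_e0 : bool).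
Hypothesis idI : is_ideal I.
Local Notation Mat := 'M[R]_#|{: {set 'I_l}}|.
Local Notation V := (@clifford_vectors R l with_e0 setT).
Local Notation e := (evec l).
Local Notation w := (@wedge R l).
Local Notation c := (@contr R l).
Local Notation p := (parity R l).
Implicit Types (g h u v : Mat) (H : set Mat) (i j k : 'I_l) (x y : 'I_l -> R).

(** [g] is invertible in all uses, so that this is the action by conjugation. *)
Definition conj_act g u v : Prop := g *m u = v *m g.

Lemma conj_actM g h u v t : conj_act h u v -> conj_act g v t -> conj_act (g *m h) u t.
Proof. by rewrite /conj_act => hx gy; rewrite -mulmxA hx mulmxA gy mulmxA. Qed.

Lemma conj_actV g h u v : g *m h = 1%:M -> conj_act g u v -> conj_act h v u.
Proof.
move=> gh gx; have hg := mulmx1C gh; rewrite /conj_act.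
by rewrite -[u]mul1mx -hg -(mulmxA h) gx -!mulmxA gh mulmx1.
Qed.

Definition mul_closed H : Prop := H 1%:M /\ forall g h, H g -> H h -> H (g *m h).

Definition conj_reach H u v : Prop := exists2 g, H g & conj_act g u v.

Lemma conj_reach_trans H u v t : mul_closed H ->
  conj_reach H u v -> conj_reach H v t -> conj_reach H u t.
Proof.
move=> [_ HM] [g Hg guv] [h Hh hvt]; exists (h *m g); first exact: HM.
exact: conj_actM guv hvt.
Qed.

Definition transv_in H (a b : Mat) : Prop :=
  H (1%:M + a *m b) /\ a *m b + b *m a = 0.

Lemma transv_in0 H a : mul_closed H -> transv_in H a 0.
Proof. by move=> [H1 _]; split; rewrite mulmx0 ?mul0mx addr0. Qed.

(** For a fixed isotropic [a], the transvections [1 + a *m b] multiply by adding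
    the [b]: membership in [H] can be tested on the coordinates of [b]. *)
Lemma transv_inD H a b b' : mul_closed H -> a *m a = 0 ->
  transv_in H a b -> transv_in H a b' -> transv_in H a (b + b').
Proof.
move=> [_ HM] aa [Hb ab] [Hb' ab']; split; last first.
  by rewrite mulmxDr mulmxDl addrACA ab ab' addr0.
have -> : 1%:M + a *m (b + b') = (1%:M + a *m b) *m (1%:M + a *m b').
  have ba : b *m a = - (a *m b) by apply/eqP; rewrite -addr_eq0 addrC ab.
  rewrite mulmxDl mul1mx mulmxDr mulmx1 -mulmxA (mulmxA b) ba mulNmx mulmxN.
  by rewrite !mulmxA aa !mul0mx oppr0 addr0 mulmxDr addrA addrAC.
exact: HM.
Qed.

Lemma transv_in_cvec H a x y z : mul_closed H -> a *m a = 0 ->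
  (forall i, transv_in H a (x i *: w i)) -> (forall i, transv_in H a (y i *: c i)) ->
  transv_in H a (z *: p) -> transv_in H a (cvec x y z).
Proof.
move=> cH aa Hx Hy Hz; apply: transv_inD => //.
apply: big_ind => [|b b'|i _]; first exact: transv_in0.
  exact: transv_inD.
exact: transv_inD.
Qed.

Lemma transv_in_wedge H k (bx by_ : 'I_l -> R) bz : mul_closed H ->
  bx k = 0 -> by_ k = 0 ->
  (forall j, j != k -> bx j = 0 \/ H (1%:M + w k *m (bx j *: w j))) ->
  (forall j, j != k -> by_ j = 0 \/ H (1%:M + w k *m (by_ j *: c j))) ->
  bz = 0 \/ H (1%:M + w k *m (bz *: p)) ->
  transv_in H (w k) (cvec bx by_ bz).
Proof.
move=> cH bx0 by0 Hx Hy Hz; apply: transv_in_cvec => //; first exact: wedge_sq.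
- move=> j; case: (eqVneq j k) => [->|jk]; first by rewrite bx0 scale0r; apply: transv_in0.
  have [->|Hj] := Hx j jk; first by rewrite scale0r; apply: transv_in0.
  by split=> //; rewrite -scalemxAr -scalemxAl -scalerDr wedge_anti scaler0.
- move=> j; case: (eqVneq j k) => [->|jk]; first by rewrite by0 scale0r; apply: transv_in0.
  have [->|Hj] := Hy j jk; first by rewrite scale0r; apply: transv_in0.
  split=> //; rewrite -scalemxAr -scalemxAl -scalerDr wedge_contr eq_sym.
  by rewrite (negbTE jk) raddf0 scaler0.
- have [->|Hp] := Hz; first by rewrite scale0r; apply: transv_in0.
  by split=> //; rewrite -scalemxAr -scalemxAl -scalerDr wedge_parity scaler0.
Qed.

Lemma transv_in_contr H k (bx by_ : 'I_l -> R) bz : mul_closed H ->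
  bx k = 0 -> by_ k = 0 ->
  (forall j, j != k -> bx j = 0 \/ H (1%:M + c k *m (bx j *: w j))) ->
  (forall j, j != k -> by_ j = 0 \/ H (1%:M + c k *m (by_ j *: c j))) ->
  bz = 0 \/ H (1%:M + c k *m (bz *: p)) ->
  transv_in H (c k) (cvec bx by_ bz).
Proof.
move=> cH bx0 by0 Hx Hy Hz; apply: transv_in_cvec => //; first exact: contr_sq.
- move=> j; case: (eqVneq j k) => [->|jk]; first by rewrite bx0 scale0r; apply: transv_in0.
  have [->|Hj] := Hx j jk; first by rewrite scale0r; apply: transv_in0.
  split=> //; rewrite -scalemxAr -scalemxAl -scalerDr addrC wedge_contr.
  by rewrite (negbTE jk) raddf0 scaler0.
- move=> j; case: (eqVneq j k) => [->|jk]; first by rewrite by0 scale0r; apply: transv_in0.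
  have [->|Hj] := Hy j jk; first by rewrite scale0r; apply: transv_in0.
  by split=> //; rewrite -scalemxAr -scalemxAl -scalerDr contr_anti scaler0.
- have [->|Hp] := Hz; first by rewrite scale0r; apply: transv_in0.
  by split=> //; rewrite -scalemxAr -scalemxAl -scalerDr contr_parity scaler0.
Qed.

Definition polar (bx by_ : 'I_l -> R) bz x y z : R :=
  \sum_i (x i * by_ i + y i * bx i) + z * (bz * 2).

Lemma act_wedge k bx by_ bz x y z :
  w k *m cvec bx by_ bz + cvec bx by_ bz *m w k = 0 ->
  conj_act (1%:M + w k *m cvec bx by_ bz) (cvec x y z)
    (cvec (fun i => x i + (i == k)%:R *
             (polar bx by_ bz x y z - qform bx by_ bz * y k) - y k * bx i)
          (fun i => y i - y k * by_ i) (z - y k * bz)).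
Proof.
move=> ab; rewrite /conj_act.
rewrite (transvection_act (wedge_sq R k) ab (cvec_sq bx by_ bz) (anti_wedge k x y z)
  (anti_cvec2 bx by_ bz x y z)) -/(polar bx by_ bz x y z).
congr (_ *m _); rewrite {1}(wedge_cvec R k) -scaleNr !cvecZ !cvecD; apply: eq_cvec => [i|i|].
all: ring.
Qed.

Lemma act_contr k bx by_ bz x y z :
  c k *m cvec bx by_ bz + cvec bx by_ bz *m c k = 0 ->
  conj_act (1%:M + c k *m cvec bx by_ bz) (cvec x y z)
    (cvec (fun i => x i - x k * bx i)
          (fun i => y i + (i == k)%:R *
             (polar bx by_ bz x y z - qform bx by_ bz * x k) - x k * by_ i)
          (z - x k * bz)).
Proof.
move=> ab; rewrite /conj_act.
rewrite (transvection_act (contr_sq R k) ab (cvec_sq bx by_ bz) (anti_contr k x y z)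
  (anti_cvec2 bx by_ bz x y z)) -/(polar bx by_ bz x y z).
congr (_ *m _); rewrite {1}(contr_cvec R k) -scaleNr !cvecZ !cvecD; apply: eq_cvec => [i|i|].
all: ring.
Qed.

Lemma polar_x x y z t : polar t (fun=> 0) 0 x y z = \sum_i y i * t i.
Proof.
rewrite /polar mul0r mulr0 addr0; apply: eq_bigr => i _.
by rewrite mulr0 add0r.
Qed.

Lemma polar_y x y z t : polar (fun=> 0) t 0 x y z = \sum_i x i * t i.
Proof.
rewrite /polar mul0r mulr0 addr0; apply: eq_bigr => i _.
by rewrite mulr0 addr0.
Qed.

Lemma qform_x x : qform x (fun=> 0) 0 = 0.
Proof. by rewrite /qform expr0n addr0 big1 // => i _; rewrite mulr0. Qed.

Lemma qform_y y : qform (fun=> 0) y 0 = 0.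
Proof. by rewrite /qform expr0n addr0 big1 // => i _; rewrite mul0r. Qed.

Lemma mx_in_conj g h u : g *m h = 1%:M -> mx_in I (g - 1%:M) ->
  mx_in I (g *m u *m h - u).
Proof.
move=> gh Ig; have hg := mulmx1C gh.
have -> : g *m u *m h - u = (g - 1%:M) *m u *m h - u *m h *m (g - 1%:M).
  rewrite mulmxBl mulmxBl mul1mx mulmxBr mulmx1 -[u *m h *m g]mulmxA hg mulmx1.
  by rewrite opprB addrA subrK.
by apply: mx_inB => //; [apply: mx_inMr => //; apply: mx_inMr|apply: mx_inMl].
Qed.

(** The coordinates [x], [y] are obtained by anticommutation with basis vectors;
    for [z] this would give [2 * z], and a diagonal entry is used instead. *)
Lemma cvec_congr x y z x' y' z' : mx_in I (cvec x y z - cvec x' y' z') ->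
  [/\ forall i, I (x i - x' i), forall i, I (y i - y' i) & I (z - z')].
Proof.
move=> Iv; set v := cvec x y z in Iv; set v' := cvec x' y' z' in Iv.
have anti u s s' : u *m v + v *m u = s%:M -> u *m v' + v' *m u = s'%:M -> I (s - s').
  move=> e1 e2; rewrite -(scalar_entry l (s - s')) raddfB /= -e1 -e2 opprD addrACA.
  rewrite -mulmxBr -mulmxBl; apply: mx_inD => //; first exact: mx_inMl.
  exact: mx_inMr.
split=> [i|i|].
- by apply: anti; apply: anti_contr.
- by apply: anti; apply: anti_wedge.
- rewrite -[z](cvec_entry x y) -[z'](cvec_entry x' y').
  have := Iv (enum_rank (finset.set0 : {set 'I_l})) (enum_rank (finset.set0 : {set 'I_l})).
  by rewrite !mxE.
Qed.

Lemma spin_cvec g h u : (forall v, V v -> V (g *m v *m h)) -> V u ->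
  exists x y z, (with_e0 = false -> z = 0) /\ g *m u *m h = cvec x y z.
Proof. by move=> Vg /Vg[x [y [z [_ z0 e1]]]]; exists x, y, z. Qed.

Variables rv : 'rV[int]_l -> Mat.
Hypothesis rvP : spin_root_vectors with_e0 rv.
Variable Phi : set 'rV[int]_l.
Hypothesis PhiE : forall a, Phi a -> D_roots a \/ with_e0 /\ short_axis_roots a.

(** Root elements are thus transvections. *)
Lemma root_vector_factor a : Phi a -> exists u v,
  [/\ rv a = u *m v, V u, V v, u *m u = 0 \/ v *m v = 0 & u *m v + v *m u = 0].
Proof.
have Vw i : V (w i) by apply: clifford_wedge.
have Vc i : V (c i) by apply: clifford_contr.
have wc i j : i != j -> w i *m c j + c j *m w i = 0.
  by move=> /negbTE ij; rewrite wedge_contr ij raddf0.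
have sqw i : w i *m w i = 0 by apply: wedge_sq.
have sqc i : c i *m c i = 0 by apply: contr_sq.
case/PhiE => [[i [j [s [t [ij ->]]]]]|[e0 [i [s ->]]]].
- wlog lt_ij : i j s t ij / (i < j)%N => [hw|].
    have := ij; rewrite -val_eqE neq_ltn => /orP[lt|gt]; first exact: hw.
    by rewrite addrC; apply: hw => //; rewrite eq_sym.
  case: s t => [] []; rewrite ?scale1r ?scaleN1r.
  + exists (c j), (c i); rewrite -opprD (rv_opp rvP) //; split=> //; first by left.
    exact: contr_anti.
  + exists (w j), (c i); rewrite addrC (rv_diff rvP) 1?eq_sym //; split=> //; first by left.
    by apply: wc; rewrite eq_sym.
  + by exists (w i), (c j); rewrite (rv_diff rvP) //; split=> //; [left|apply: wc].
  + exists (w i), (w j); rewrite (rv_sum rvP) //; split=> //; first by left.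
    exact: wedge_anti.
- have Vp : V p by apply: clifford_parity.
  case: s; rewrite ?scale1r ?scaleN1r.
  + exists p, (c i); rewrite (rv_Nshort rvP) //; split=> //; first by right.
    by rewrite addrC; apply: contr_parity.
  + exists (w i), p; rewrite (rv_short rvP) //; split=> //; first by left.
    exact: wedge_parity.
Qed.

Lemma spin_root_sq a : Phi a -> rv a *m rv a = 0.
Proof.
case/root_vector_factor => u [v [-> _ _ sq uv]].
have -> : u *m v *m (u *m v) = - (u *m u *m (v *m v)).
  have -> : u *m v *m (u *m v) = u *m (v *m u) *m v by rewrite !mulmxA.
  have -> : v *m u = - (u *m v) by apply/eqP; rewrite -addr_eq0 addrC uv.
  by rewrite mulmxN mulNmx !mulmxA.
by case: sq => ->; rewrite ?mul0mx ?mulmx0 oppr0.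
Qed.

Lemma spin_root a s : Phi a -> spin_group V (1%:M + s *: rv a).
Proof.
case/root_vector_factor => u [v [-> Vu Vv sq uv]].
case: sq => sq.
  rewrite scalemxAr; apply: spin_transvection => //; first exact: clifford_scale.
  by rewrite -scalemxAr -scalemxAl -scalerDr uv scaler0.
have -> : s *: (u *m v) = v *m (- s *: u).
  rewrite -scalemxAr scaleNr -scalerN; congr (_ *: _).
  by apply/eqP; rewrite -addr_eq0 uv.
apply: spin_transvection => //; first exact: clifford_scale.
by rewrite -scalemxAr -scalemxAl -scalerDr addrC uv scaler0.
Qed.

Lemma spin_group_closed : [/\ spin_group V 1%:M,
  (forall g h, spin_group V g -> spin_group V h -> spin_group V (g *m h)) &
  (forall g h, spin_group V g -> g *m h = 1%:M -> spin_group V h)].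
Proof. by split; [apply: spin_group1|apply: spin_groupM|apply: spin_groupV]. Qed.

(** Root vectors are products of two basis vectors in one order; the
    transvections that are used have the common axis as the left factor, and
    anticommutation exchanges the factors. *)
Section Generators.
Variables (Sigma : set 'rV[int]_l) (H : set Mat).
Hypothesis genH : forall a s, Sigma a -> I s -> H (1%:M + s *: rv a).

Lemma gen_ww i j t : i != j -> Sigma (e i + e j) -> I t -> H (1%:M + w i *m (t *: w j)).
Proof.
rewrite -val_eqE neq_ltn => /orP[] ij S It; rewrite -scalemxAr.
  by rewrite -(rv_sum rvP) //; apply: genH.
have -> : w i *m w j = - (w j *m w i).
  by apply/eqP; rewrite -addr_eq0 wedge_anti.
rewrite scalerN -scaleNr -(rv_sum rvP) //; apply: genH; first by rewrite addrC.
exact: idealN.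
Qed.

Lemma gen_cc i j t : i != j -> Sigma (- (e i + e j)) -> I t ->
  H (1%:M + c i *m (t *: c j)).
Proof.
rewrite -val_eqE neq_ltn => /orP[] ij S It; rewrite -scalemxAr; last first.
  by rewrite -(rv_opp rvP) //; apply: genH; rewrite // addrC.
have -> : c i *m c j = - (c j *m c i).
  by apply/eqP; rewrite -addr_eq0 contr_anti.
rewrite scalerN -scaleNr -(rv_opp rvP) //; apply: genH => //.
exact: idealN.
Qed.

Lemma gen_wc i j t : i != j -> Sigma (e i - e j) -> I t -> H (1%:M + w i *m (t *: c j)).
Proof. by move=> ij S It; rewrite -scalemxAr -(rv_diff rvP) //; apply: genH. Qed.

Lemma gen_cw i j t : i != j -> Sigma (e j - e i) -> I t -> H (1%:M + c i *m (t *: w j)).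
Proof.
move=> ij S It; have -> : c i *m (t *: w j) = - t *: (w j *m c i).
  rewrite -scalemxAr scaleNr -scalerN; congr (_ *: _); apply/eqP.
  have := wedge_contr R j i; rewrite eq_sym (negbTE ij) raddf0 addrC => cw0.
  by rewrite -addr_eq0 cw0.
by rewrite -(rv_diff rvP) 1?eq_sym //; apply: genH => //; apply: idealN.
Qed.

Lemma gen_wp i t : with_e0 -> Sigma (e i) -> I t -> H (1%:M + w i *m (t *: p)).
Proof. by move=> e0 S It; rewrite -scalemxAr -(rv_short rvP) //; apply: genH. Qed.

Lemma gen_cp i t : with_e0 -> Sigma (- e i) -> I t -> H (1%:M + c i *m (t *: p)).
Proof.
move=> e0 S It; have -> : c i *m (t *: p) = - t *: (p *m c i).
  rewrite -scalemxAr scaleNr -scalerN; congr (_ *: _); apply/eqP.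
  by rewrite -addr_eq0 contr_parity.
by rewrite -(rv_Nshort rvP) //; apply: genH => //; apply: idealN.
Qed.

End Generators.

(** [U Sigma] stands for the subgroup generated by the root elements of level [I]
    for the roots in [Sigma]. *)
Section Subgroups.
Variables (U : set 'rV[int]_l -> set Mat) (o i1 : 'I_l).
Variables Pos Neg VN SPos : set 'rV[int]_l.
Hypothesis o_i1 : o != i1.
Hypothesis U_closed : forall Sigma, mul_closed (U Sigma).
Hypothesis U_gen : forall Sigma a s, Sigma a -> I s -> U Sigma (1%:M + s *: rv a).
Hypothesis U_inv : forall Sigma g, Sigma `<=` Phi -> U Sigma g ->
  exists2 h, U Sigma h & g *m h = 1%:M.
Hypotheses (Pos_sub : Pos `<=` Phi) (Neg_sub : Neg `<=` Phi).
Hypothesis rootsP : spin_roots with_e0 o i1 Pos Neg VN SPos.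

Local Notation UP := (U Pos).
Local Notation UN := (U Neg).
Local Notation VM := (U VN).
Local Notation SP := (U SPos).

Let neq_sym i j : i != j -> j != i. Proof. by rewrite eq_sym. Qed.

Let cUP : mul_closed UP. Proof. exact: U_closed. Qed.
Let cUN : mul_closed UN. Proof. exact: U_closed. Qed.

Let UP_ww i j t : i != j -> I t -> UP (1%:M + w i *m (t *: w j)).
Proof. by move=> ij; apply: (gen_ww (@U_gen _)); last apply: (Pos_sum rootsP). Qed.

Let UP_wc t : I t -> UP (1%:M + w o *m (t *: c i1)).
Proof. by apply: (gen_wc (@U_gen _)); last apply: (Pos_diff rootsP). Qed.

Let UN_cw j t : j != o -> j != i1 -> I t -> UN (1%:M + c i1 *m (t *: w j)).
Proof. by move=> jo ji; apply: (gen_cw (@U_gen _)); [apply: neq_sym|apply: (Neg_diff rootsP)]. Qed.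

Let UN_cc j t : j != i1 -> I t -> UN (1%:M + c i1 *m (t *: c j)).
Proof. by move=> ji; apply: (gen_cc (@U_gen _)); [|apply: (Neg_sum rootsP)]; apply: neq_sym. Qed.

Let VM_cw j t : j != o -> I t -> VM (1%:M + c o *m (t *: w j)).
Proof. by move=> jo; apply: (gen_cw (@U_gen _)); [apply: neq_sym|apply: (VN_diff rootsP)]. Qed.

Let VM_cc j t : j != o -> j != i1 -> I t -> VM (1%:M + c o *m (t *: c j)).
Proof. by move=> jo ji; apply: (gen_cc (@U_gen _)); [apply: neq_sym|apply: (VN_sum rootsP)]. Qed.

Let VM_cp t : with_e0 -> I t -> VM (1%:M + c o *m (t *: p)).
Proof. by move=> e0; apply: (gen_cp (@U_gen _)); last apply: (VN_short rootsP). Qed.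

Let SP_ww j t : j != o -> I t -> SP (1%:M + w o *m (t *: w j)).
Proof. by move=> jo; apply: (gen_ww (@U_gen _)); [apply: neq_sym|apply: (SPos_sum rootsP)]. Qed.

Let SP_wc j t : j != o -> I t -> SP (1%:M + w o *m (t *: c j)).
Proof. by move=> jo; apply: (gen_wc (@U_gen _)); [apply: neq_sym|apply: (SPos_diff rootsP)]. Qed.

Let SP_wp t : with_e0 -> I t -> SP (1%:M + w o *m (t *: p)).
Proof. by move=> e0; apply: (gen_wp (@U_gen _)); last apply: (SPos_short rootsP). Qed.

(** * Isotropic vectors *)

Lemma reach_ww k t x y z : t k = 0 -> (forall i, I (t i)) ->
  conj_reach UP (cvec x y z)
    (cvec (fun i => x i + (i == k)%:R * (\sum_j y j * t j) - y k * t i) y z).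
Proof.
move=> t0 It; have [Hg ab] : transv_in UP (w k) (cvec t (fun=> 0) 0).
  apply: transv_in_wedge => // [j jk|j _|]; [|by left|by left].
  by right; apply: UP_ww => //; rewrite eq_sym.
exists (1%:M + w k *m cvec t (fun=> 0) 0) => //.
have := act_wedge x y z ab; congr conj_act; apply: eq_cvec => [i|i|].
- by rewrite polar_x qform_x mul0r subr0.
- by rewrite mulr0 subr0.
- by rewrite mulr0 subr0.
Qed.

Lemma reach_wc t x y z : I t ->
  conj_reach UP (cvec x y z)
    (cvec (fun i => x i + (i == o)%:R * (x i1 * t))
          (fun i => y i - y o * (t * (i == i1)%:R)) z).
Proof.
move=> It; pose t1 i := t * (i == i1)%:R.
have [Hg ab] : transv_in UP (w o) (cvec (fun=> 0) t1 0).
  apply: transv_in_wedge => // [|j _|j _|].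
  - by rewrite /t1 (negbTE o_i1) mulr0.
  - by left.
  - case: (eqVneq j i1) => [->|ji]; last by left; rewrite /t1 (negbTE ji) mulr0.
    by right; apply: UP_wc; rewrite /t1 eqxx mulr1.
  - by left.
exists (1%:M + w o *m cvec (fun=> 0) t1 0) => //.
have := act_wedge x y z ab; congr conj_act; apply: eq_cvec => [i|i|].
- rewrite polar_y qform_y mul0r mulr0 !subr0 (bigD1 i1) //= /t1 eqxx mulr1 big1 ?addr0 //.
  by move=> j /negbTE->; rewrite !mulr0.
- by [].
- by rewrite mulr0 subr0.
Qed.

Lemma reach_cw t x y z : t o = 0 -> t i1 = 0 -> (forall i, I (t i)) ->
  conj_reach UN (cvec x y z)
    (cvec (fun i => x i - x i1 * t i)
          (fun i => y i + (i == i1)%:R * (\sum_j y j * t j)) z).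
Proof.
move=> to t0 It; have [Hg ab] : transv_in UN (c i1) (cvec t (fun=> 0) 0).
  apply: transv_in_contr => // [j jk|j _|]; [|by left|by left].
  by case: (eqVneq j o) => [->|jo]; [left|right; apply: UN_cw].
exists (1%:M + c i1 *m cvec t (fun=> 0) 0) => //.
have := act_contr x y z ab; congr conj_act; apply: eq_cvec => [i|i|].
- by [].
- by rewrite polar_x qform_x mul0r mulr0 !subr0.
- by rewrite mulr0 subr0.
Qed.

Lemma reach_cc t x y z : t i1 = 0 -> (forall i, I (t i)) ->
  conj_reach UN (cvec x y z)
    (cvec x (fun i => y i + (i == i1)%:R * (\sum_j x j * t j) - x i1 * t i) z).
Proof.
move=> t0 It; have [Hg ab] : transv_in UN (c i1) (cvec (fun=> 0) t 0).
  apply: transv_in_contr => // [j _|j ji|]; [by left| |by left].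
  by right; apply: UN_cc.
exists (1%:M + c i1 *m cvec (fun=> 0) t 0) => //.
have := act_contr x y z ab; congr conj_act; apply: eq_cvec => [i|i|].
- by rewrite mulr0 subr0.
- by rewrite polar_y qform_y mul0r !subr0.
- by rewrite mulr0 subr0.
Qed.

Definition congr_w0 x y : Prop := (forall i, I (x i - (i == o)%:R)) /\ (forall i, I (y i)).

(** One application of the condition on radicals.  Let [z = 1 - X * x k] be the
    contribution of the other generators to a Bezout relation.  At a maximal
    ideal that contains the new [x], the radical condition puts
    [y k * z] into the ideal, whence [z] as well, by the choice of
    [z]; then [x k] is unchanged modulo the ideal, which is therefore not proper. *)
Lemma radical_step k x y (m : nat) : k = m :> nat -> JSR_on I 'I_l -> congr_w0 x y ->
  (forall K, is_ideal K -> (forall i, K (x i)) -> (forall i, (i <= m)%N -> K (y i)) -> K 1) ->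
  exists t, [/\ t k = 0, forall i, I (t i),
    congr_w0 (fun i => x i + (i == k)%:R * (\sum_j y j * t j) - y k * t i) y &
    forall K, is_ideal K ->
      (forall i, K (x i + (i == k)%:R * (\sum_j y j * t j) - y k * t i)) ->
      (forall i, (i < m)%N -> K (y i)) -> K 1].
Proof.
move=> km jsr [Ix Iy] unim.
pose a (q : 'I_l + 'I_l) := match q with inl i => x i | inr i => y i end.
pose D (q : 'I_l + 'I_l) := match q with inl _ => true | inr i => (i <= m)%N end.
have [d d1] : exists d, \sum_(q | D q) d q * a q = 1.
  apply: comaximal_coef => K idK Ka; apply: unim => // [i|i im].
    exact: (Ka (inl i)).
  exact: (Ka (inr i)).
pose z := 1 - d (inl k) * x k.
have zK K : is_ideal K -> (forall i, i != k -> K (x i)) ->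
    (forall i, (i <= m)%N -> K (y i)) -> K z.
  move=> idK Kx Ky; rewrite /z -d1 (bigD1 (inl k)) //= addrAC subrr add0r.
  apply: ideal_sum => // -[i|i] /andP[Di ne]; apply: idealMl => //; last exact: Ky.
  by apply: Kx; apply: contra ne => /eqP->.
pose f := y k * z; have If : I f by apply: idealMr.
have [b Ib maxb] : exists2 b : 'I_l -> R, (forall j, I (b j)) &
    forall M, is_maximal_ideal M -> (forall j, j != k -> M (x j + b j * f)) -> M f.
  case: (eqVneq o k) => [ok|ok]; last exact: (JSR_on_congr1 idI jsr ok).
  by apply: jsr => // j jk; have := Ix j; rewrite ok (negbTE jk) subr0.
pose t i := if i == k then 0 else - (b i * z).
have It i : I (t i).
  by rewrite /t; case: ifP => _; [apply: ideal0|apply: idealN => //; apply: idealMr].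
have tk : t k = 0 by rewrite /t eqxx.
pose x' i := x i + (i == k)%:R * (\sum_j y j * t j) - y k * t i.
exists t; split=> //.
  split=> // i; have -> : x' i - (i == o)%:R
      = (x i - (i == o)%:R) + ((i == k)%:R * (\sum_j y j * t j) - y k * t i).
    by rewrite /x'; ring.
  apply: (idealD idI) => //; apply: (idealB idI); last exact: idealMl.
  by apply: idealMl => //; apply: ideal_sum => // j _; apply: idealMl.
have x'E i : i != k -> x' i = x i + b i * f.
  by rewrite /x' /t => /negbTE->; rewrite /f natr_bool; ring.
have x'k : x' k = x k - z * \sum_(j | j != k) y j * b j.
  rewrite /x' eqxx tk mulr0 subr0 mul1r; congr (_ + _).
  rewrite (bigD1 k) //= tk mulr0 add0r mulr_sumr -sumrN; apply: eq_bigr => j jk.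
  by rewrite /t (negbTE jk); ring.
pose DD (q : 'I_l + 'I_l) := match q with inl _ => True | inr i => (i < m)%N end.
pose aa (q : 'I_l + 'I_l) := match q with inl i => x' i | inr i => y i end.
suff cm : comaximal DD aa.
  move=> K idK Kx Ky; apply: cm => // -[i _|i im]; first exact: Kx.
  exact: Ky.
apply: comaximal_by_maximal => M maxM Maa; have [idM _ _] := maxM.
have Mx' i : M (x' i) by apply: (Maa (inl i)).
have My i : (i < m)%N -> M (y i) by apply: (Maa (inr i)).
have Mf : M f by apply: maxb => // j jk; rewrite -x'E.
have Mx i : i != k -> M (x i).
  move=> ik; have -> : x i = x' i - b i * f by rewrite x'E //; ring.
  by apply: (idealB idM) => //; apply: idealMl.
have Mz : M z.
  have [Myk|//] := maximal_ideal_prime maxM Mf.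
  apply: zK => // i; rewrite leq_eqVlt => /orP[/eqP im|/My //].
  by have -> : i = k by apply: val_inj; rewrite /= im km.
apply: (maximal_ideal_proper maxM).
have -> : 1 = z + d (inl k) * (x' k + z * \sum_(j | j != k) y j * b j).
  by rewrite x'k /z; ring.
by apply: (idealD idM) => //; apply: idealMl => //; apply: (idealD idM) => //;
  apply: idealMr.
Qed.

(** The [y k] are removed one at a time from the generators of the unit ideal, the
    last one first. *)
Lemma comaximal_x x y z : JSR_on I 'I_l -> congr_w0 x y ->
  (forall K, is_ideal K -> (forall i, K (x i)) -> (forall i, K (y i)) -> K 1) ->
  exists x', [/\ conj_reach UP (cvec x y z) (cvec x' y z), congr_w0 x' y &
    forall K, is_ideal K -> (forall i, K (x' i)) -> K 1].
Proof.
move=> jsr cxy unim.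
suff /(_ l (leqnn _)) [x' [r' c' u']] : forall m, (m <= l)%N -> exists x',
    [/\ conj_reach UP (cvec x y z) (cvec x' y z), congr_w0 x' y &
    forall K, is_ideal K -> (forall i, K (x' i)) ->
      (forall i : 'I_l, (i < l - m)%N -> K (y i)) -> K 1].
  by exists x'; split=> // K idK Kx; apply: u' => // i; rewrite subnn.
elim=> [_|m IHm ltm].
  exists x; split=> //.
    by exists 1%:M; [case: cUP|rewrite /conj_act mul1mx mulmx1].
  by move=> K idK Kx Ky; apply: unim => // i; apply: Ky; rewrite subn0.
have [x' [r' c' u']] := IHm (ltnW ltm).
have lt : (l - m.+1 < l)%N by lia.
have [|t [tk It c'' u'']] := radical_step (k := Ordinal lt) erefl jsr c'.
  by move=> K idK Kx Ky; apply: u' => // i im; apply: Ky; rewrite /=; lia.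
exists (fun i => x' i + (i == Ordinal lt)%:R * (\sum_j y j * t j) - y (Ordinal lt) * t i).
split=> //; first by apply: (conj_reach_trans cUP r'); apply: reach_ww.
Qed.

Lemma sum_mul_delta (f : 'I_l -> R) k s : \sum_i f i * (s * (i == k)%:R) = f k * s.
Proof.
rewrite -(sum_delta (fun i => f i * s) k); apply: eq_bigr => i _.
by rewrite mulrA.
Qed.

Lemma act_ww s x y z : conj_act (1%:M + s *: (w o *m w i1)) (cvec x y z)
  (cvec (fun i => x i + (i == o)%:R * (y i1 * s) - y o * (s * (i == i1)%:R)) y z).
Proof.
have sw : s *: w i1 = cvec (fun i => s * (i == i1)%:R) (fun=> 0) 0.
  by rewrite (wedge_cvec R i1) cvecZ; apply: eq_cvec => [i|i|] //; rewrite mulr0.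
rewrite scalemxAr sw; have := @act_wedge o (fun i => s * (i == i1)%:R) (fun=> 0) 0 x y z.
have -> : w o *m cvec (fun i => s * (i == i1)%:R) (fun=> 0) 0
    + cvec (fun i => s * (i == i1)%:R) (fun=> 0) 0 *m w o = 0.
  by rewrite anti_wedge raddf0.
move=> /(_ erefl); congr conj_act; apply: eq_cvec => [i|i|].
- by rewrite polar_x qform_x mul0r subr0 sum_mul_delta.
- by rewrite mulr0 subr0.
- by rewrite mulr0 subr0.
Qed.

Lemma act_cc s x y z : conj_act (1%:M + s *: (c i1 *m c o)) (cvec x y z)
  (cvec x (fun i => y i + (i == i1)%:R * (x o * s) - x i1 * (s * (i == o)%:R)) z).
Proof.
have sw : s *: c o = cvec (fun=> 0) (fun i => s * (i == o)%:R) 0.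
  by rewrite (contr_cvec R o) cvecZ; apply: eq_cvec => [i|i|] //; rewrite mulr0.
rewrite scalemxAr sw; have := @act_contr i1 (fun=> 0) (fun i => s * (i == o)%:R) 0 x y z.
have -> : c i1 *m cvec (fun=> 0) (fun i => s * (i == o)%:R) 0
    + cvec (fun=> 0) (fun i => s * (i == o)%:R) 0 *m c i1 = 0.
  by rewrite anti_contr raddf0.
move=> /(_ erefl); congr conj_act; apply: eq_cvec => [i|i|].
- by rewrite mulr0 subr0.
- by rewrite polar_y qform_y mul0r subr0 sum_mul_delta.
- by rewrite mulr0 subr0.
Qed.

Definition z_mx r : Mat := (1%:M + (- 1) *: (w o *m w i1)) *m
  (1%:M + r *: (c i1 *m c o)) *m (1%:M + 1 *: (w o *m w i1)).

Lemma qform_o x y z : qform x y z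
  = x o * y o + (\sum_(i | i != o) x i * y i + z ^+ 2).
Proof. by rewrite /qform (bigD1 o) //= addrA. Qed.

(** [z_mx r] acts on the coordinates at [o] and [i1] only.  With [r = y i1] it
    maps the vector with coordinates [x1], [y1'] to the given one; as [x1 o = 1]
    and [y1' i1 = 0], an Eichler-Siegel transvection [W] with the axis [c o]
    maps [w o] to that vector. *)
Lemma isotropic_image x y z : congr_w0 x y -> I z -> (with_e0 = false -> z = 0) ->
  qform x y z = 0 -> y i1 = 1 - x o ->
  exists r W, [/\ I r, VM W & conj_act (z_mx r *m W) (w o) (cvec x y z)].
Proof.
move=> [Ix Iy] Iz z0 q0 y1; pose r := y i1; have Ir : I r by apply: Iy.
have xo : x o = 1 - r by rewrite /r y1; ring.
have Ixj j : j != o -> I (x j) by move=> /negbTE jo; have := Ix j; rewrite jo subr0.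
have i1o : i1 != o by rewrite eq_sym.
pose x1 i := if i == o then 1 else if i == i1 then (1 + r) * x i1 - r * y o else x i.
pose y1' i := if i == o then r * x i1 + (1 - r) * y o else if i == i1 then 0 else y i.
have q1 : qform x1 y1' z = 0.
  rewrite -q0 !qform_o (bigD1 i1) //= [in RHS](bigD1 i1) //=.
  have -> : \sum_(i | (i != o) && (i != i1)) x1 i * y1' i
      = \sum_(i | (i != o) && (i != i1)) x i * y i.
    by apply: eq_bigr => i /andP[/negbTE io /negbTE ii]; rewrite /x1 /y1' io ii.
  by rewrite /x1 /y1' !eqxx (negbTE i1o) xo -/r; ring.
pose bx i := if i == o then 0 else - x1 i.
pose by_ i := if i == o then 0 else - y1' i.
have beta : qform bx by_ (- z) = - y1' o.
  have := q1; rewrite !qform_o /bx /by_ eqxx mul0r add0r {1}/x1 eqxx mul1r => e.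
  have -> : \sum_(i | i != o) (if i == o then 0 else - x1 i) * (if i == o then 0 else - y1' i)
      = \sum_(i | i != o) x1 i * y1' i.
    by apply: eq_bigr => i /negbTE->; rewrite mulrNN.
  by rewrite sqrrN; apply/eqP; rewrite -addr_eq0 addrC e.
have [HW ab] : transv_in VM (c o) (cvec bx by_ (- z)).
  apply: transv_in_contr => // [||j jo|j jo|].
  - by rewrite /bx eqxx.
  - by rewrite /by_ eqxx.
  - right; apply: VM_cw => //; rewrite /bx (negbTE jo) /x1 (negbTE jo).
    apply: (idealN idI); case: (eqVneq j i1) => _; last exact: Ixj.
    by apply: (idealB idI); [apply: idealMl => //; apply: Ixj|apply: idealMr].
  - case: (eqVneq j i1) => [->|ji].
      by left; rewrite /by_ /y1' (negbTE i1o) eqxx oppr0.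
    right; apply: VM_cc => //; rewrite /by_ /y1' (negbTE jo) (negbTE ji).
    exact: idealN.
  - case: (boolP with_e0) => [e0|/negbTE/z0->]; last by left; rewrite oppr0.
    by right; apply: VM_cp => //; apply: idealN.
exists r, (1%:M + c o *m cvec bx by_ (- z)); split=> //.
apply: (conj_actM (v := cvec x1 y1' z)).
  have := act_contr (fun i => (i == o)%:R) (fun=> 0) 0 ab.
  rewrite -(wedge_cvec R o); congr conj_act; apply: eq_cvec => [i|i|].
  - rewrite eqxx mul1r /bx /x1; case: (eqVneq i o) => _; rewrite natr_bool; ring.
  - rewrite eqxx mul1r mulr1 beta /polar mul0r addr0.
    have -> : \sum_j ((j == o)%:R * by_ j + 0 * bx j) = 0.
      rewrite big1 // => j _; rewrite mul0r addr0 /by_.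
      by case: (j == o); rewrite ?mulr0 ?mul0r.
    by rewrite /by_; case: (eqVneq i o) => [->|_]; rewrite natr_bool; ring.
  - by rewrite eqxx; rewrite natr_bool; ring.
have := conj_actM (conj_actM (act_ww 1 x1 y1' z) (act_cc r _ _ _)) (act_ww (-1) _ _ _).
rewrite /z_mx mulmxA; congr conj_act; apply: eq_cvec => // i.
  rewrite !eqxx (negbTE o_i1) (negbTE i1o) !natr_bool /x1 /y1' !eqxx (negbTE i1o).
  case: (eqVneq i o) => [->|io].
    by rewrite (negbTE o_i1) !natr_bool xo; ring.
  by case: (eqVneq i i1) => [->|ii]; rewrite !natr_bool; ring.
rewrite !eqxx (negbTE o_i1) (negbTE i1o) !natr_bool /x1 /y1' !eqxx (negbTE i1o).
case: (eqVneq i o) => [->|io].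
  by rewrite (negbTE o_i1) !natr_bool; ring.
by case: (eqVneq i i1) => [->|ii]; rewrite !natr_bool -?/r; ring.
Qed.

(** Once the coordinates [x] are comaximal, the stable rank condition asks for
    multiples of [x i1] to be added to the other ones so that these become
    comaximal; this is done for [x o] in [U(Phi^+, I)] and for the others in
    [U(Phi^-, I)].  A Bezout relation between them then allows [y i1] to be
    set to [1 - x o]. *)
Lemma moves_spin x y z : JSR_on I 'I_l -> SR_on I 'I_l -> congr_w0 x y -> I z ->
  (with_e0 = false -> z = 0) -> qform x y z = 0 ->
  (forall K, is_ideal K -> (forall i, K (x i)) -> (forall i, K (y i)) -> K 1) ->
  exists u v, [/\ conj_reach UP (cvec x y z) u, conj_reach UN u v &
    exists r W, [/\ I r, VM W & conj_act (z_mx r *m W) (w o) v]].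
Proof.
move=> jsr sr c0 Iz z0 q0 unim.
have isotropic Sigma x' y' z' x1 y1 z1 : Sigma `<=` Phi ->
    conj_reach (U Sigma) (cvec x' y' z') (cvec x1 y1 z1) -> qform x' y' z' = 0 ->
    qform x1 y1 z1 = 0.
  move=> sP [g /(U_inv sP)[h _ gh] ga] q.
  have e : cvec x1 y1 z1 = g *m cvec x' y' z' *m h by rewrite ga -mulmxA gh mulmx1.
  apply: (@spinor_scalar_inj _ l); rewrite -cvec_sq e raddf0 -!mulmxA (mulmxA h) (mulmx1C gh).
  by rewrite mul1mx (mulmxA (cvec _ _ _)) cvec_sq q raddf0 mul0mx mulmx0.
have i1o : i1 != o by rewrite eq_sym.
have [x1 [r1 [Ix1 Iy] u1]] := comaximal_x z jsr c0 unim.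
have Ix1j j : j != o -> I (x1 j) by move=> /negbTE jo; have := Ix1 j; rewrite jo subr0.
have [||b Ib b1] := sr i1 o x1 (x1 i1) o_i1 (fun j _ => Ix1 j).
- exact: Ix1j.
- move=> K idK Kx K1; apply: u1 => // i.
  by case: (eqVneq i i1) => [->//|]; apply: Kx.
have r2 := reach_wc x1 y z (Ib o).
set x2 := (fun i => x1 i + _) in r2; set y2 := (fun i => y i - _) in r2.
pose t3 j := if (j == o) || (j == i1) then 0 else - b j.
have It3 j : I (t3 j).
  by rewrite /t3; case: ifP => _; [apply: ideal0|apply: (idealN idI); apply: Ib].
have [t3o t31] : t3 o = 0 /\ t3 i1 = 0 by rewrite /t3 !eqxx orbT.
have r3 := reach_cw x2 y2 z t3o t31 It3.
set x3 := (fun i => x2 i - _) in r3; set y3 := (fun i => y2 i + _) in r3.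
have x3E j : j != i1 -> x3 j = x1 j + b j * x1 i1.
  move=> ji; rewrite /x3 /x2 (negbTE i1o) natr_bool /t3 (negbTE ji) orbF.
  by case: (eqVneq j o) => [->|jo]; rewrite natr_bool; ring.
have x31 : x3 i1 = x1 i1.
  by rewrite /x3 /x2 (negbTE i1o) natr_bool t31; ring.
have Ix3 j : I (x3 j - (j == o)%:R).
  case: (eqVneq j i1) => [->|ji]; first by rewrite x31.
  rewrite x3E // addrAC; apply: (idealD idI) => //; apply: idealMl => //.
  exact: Ix1j.
have Iy3 j : I (y3 j).
  rewrite /y3 /y2; apply: (idealD idI).
    by apply: (idealB idI) => //; apply: idealMr.
  apply: idealMl => //; apply: ideal_sum => // i _; apply: idealMl => //.
have [d d1] : exists d, \sum_(j | j != i1) d j * x3 j = 1.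
  apply: (@comaximal_coef R 'I_l (fun j => j != i1)) => K idK Kx; apply: b1 => // j ji.
  by rewrite -x3E //; apply: Kx.
pose tau := 1 - x3 o - y3 i1.
have Itau : I tau.
  apply: (idealB idI) => //; rewrite -opprB; apply: (idealN idI).
  by have := Ix3 o; rewrite eqxx.
pose t4 j := if j == i1 then 0 else tau * d j.
have It4 j : I (t4 j).
  by rewrite /t4; case: ifP => _; [apply: ideal0|apply: idealMr].
have t41 : t4 i1 = 0 by rewrite /t4 eqxx.
have r4 := reach_cc x3 y3 z t41 It4.
set y4 := (fun i => y3 i + _ - _) in r4.
have y41 : y4 i1 = 1 - x3 o.
  have sumt : \sum_j x3 j * t4 j = tau.
    rewrite -[RHS]mulr1 -d1 mulr_sumr (bigD1 i1) //= t41 mulr0 add0r.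
    by apply: eq_bigr => j /negbTE ji; rewrite /t4 ji; ring.
  by rewrite /y4 t41 sumt eqxx natr_bool /tau; ring.
have Iy4 j : I (y4 j).
  rewrite /y4; apply: (idealB idI); last exact: idealMl.
  apply: (idealD idI) => //; apply: idealMl => //.
  by apply: ideal_sum => // i _; apply: idealMl.
have q4 : qform x3 y4 z = 0.
  apply: (isotropic _ _ _ _ _ _ _ Neg_sub r4).
  apply: (isotropic _ _ _ _ _ _ _ Neg_sub r3).
  apply: (isotropic _ _ _ _ _ _ _ Pos_sub r2).
  exact: (isotropic _ _ _ _ _ _ _ Pos_sub r1).
exists (cvec x2 y2 z), (cvec x3 y4 z); split.
- exact: conj_reach_trans cUP r1 r2.
- exact: conj_reach_trans cUN r3 r4.
- by apply: isotropic_image.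
Qed.

(** As [g] fixes [w o], it maps [c o] to a vector with coordinate 1 at [c o].  The
    transvection with the axis [w o] given by the coordinates of this vector
    outside the plane of [w o] and [c o] brings it back to [c o]: the
    coordinate at [w o] is determined by the others, the vector being
    isotropic. *)
Lemma stabilizer_spin g h x y z : g *m h = 1%:M -> g *m w o = w o *m g ->
  g *m c o = cvec x y z *m g -> (forall i, I (x i)) ->
  (forall i, I (y i - (i == o)%:R)) -> I z -> (with_e0 = false -> z = 0) ->
  exists2 s, SP s & let d := s *m g in d *m w o = w o *m d /\ d *m c o = c o *m d.
Proof.
move=> gh gw gc Ix Iy Iz z0; have hg := mulmx1C gh.
have e : cvec x y z = g *m c o *m h by rewrite gc -mulmxA gh mulmx1.
have w_h : w o = g *m w o *m h by rewrite gw -mulmxA gh mulmx1.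
have yo : y o = 1.
  have conjM u v : (g *m u *m h) *m (g *m v *m h) = g *m (u *m v) *m h.
    by rewrite !mulmxA -(mulmxA _ h g) hg mulmx1.
  apply: (@spinor_scalar_inj _ l); rewrite -(anti_wedge o x y z) e w_h !conjM.
  by rewrite -mulmxDl -mulmxDr wedge_contr eqxx mulmx1 gh.
have q0 : qform x y z = 0.
  apply: (@spinor_scalar_inj _ l); rewrite -cvec_sq e -!mulmxA (mulmxA h g) hg mul1mx.
  by rewrite (mulmxA (c o)) contr_sq mul0mx mulmx0 raddf0.
pose bx i := if i == o then 0 else x i.
pose by_ i := if i == o then 0 else y i.
have Iyj j : j != o -> I (y j) by move=> /negbTE jo; have := Iy j; rewrite jo subr0.
have [Hs ab] : transv_in SP (w o) (cvec bx by_ z).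
  apply: transv_in_wedge => // [||j jo|j jo|].
  - by rewrite /bx eqxx.
  - by rewrite /by_ eqxx.
  - by right; rewrite /bx (negbTE jo); apply: SP_ww.
  - by right; rewrite /by_ (negbTE jo); apply: SP_wc => //; apply: Iyj.
  - case: (boolP with_e0) => [e0|/negbTE/z0->]; last by left.
    by right; apply: SP_wp.
exists (1%:M + w o *m cvec bx by_ z) => //.
set s := 1%:M + _ in Hs *.
have sw : s *m w o = w o *m s.
  have bw : cvec bx by_ z *m w o = - (w o *m cvec bx by_ z).
    by apply/eqP; rewrite -addr_eq0 addrC ab.
  rewrite [RHS]mulmxDr mulmx1 mulmxA wedge_sq mul0mx addr0 /s mulmxDl mul1mx.
  by rewrite -mulmxA bw mulmxN mulmxA wedge_sq mul0mx oppr0 addr0.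
have sc : s *m cvec x y z = c o *m s.
  have := act_wedge x y z ab; rewrite /conj_act -/s => ->; congr (_ *m _).
  rewrite (contr_cvec R o) yo.
  have bxo : bx o = 0 by rewrite /bx eqxx.
  have byo : by_ o = 0 by rewrite /by_ eqxx.
  have qE : \sum_(i | i != o) x i * y i + z ^+ 2 = - x o.
    by have := q0; rewrite qform_o yo mulr1 => q; apply/eqP; rewrite -addr_eq0 addrC q.
  have beta : qform bx by_ z = - x o.
    rewrite qform_o bxo mul0r add0r -qE; congr (_ + _).
    by apply: eq_bigr => i /negbTE io; rewrite /bx /by_ io.
  have polarE : polar bx by_ z x y z = - (x o * 2).
    rewrite -mulNr -qE /polar mulrDl (bigD1 o) //= bxo byo !mulr0 !add0r mulr_suml.
    congr (_ + _); last by ring.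
    by apply: eq_bigr => i /negbTE io; rewrite /bx /by_ io; ring.
  apply: eq_cvec => [i|i|].
  - rewrite polarE beta /bx; case: (eqVneq i o) => [->|_]; rewrite natr_bool; ring.
  - by rewrite /by_; case: (eqVneq i o) => [->|_]; rewrite ?yo natr_bool; ring.
  - by rewrite mul1r subrr.
split; first by rewrite -mulmxA gw !mulmxA sw.
by rewrite -mulmxA gc !mulmxA sc.
Qed.

(** The images of [w o] and [c o] have anticommutator 1.  This is a Bezout relation
    between the [x i], [y i] and [2 * z]; as [z ^+ 2] is in the ideal of the
    [x i] by isotropy, the coordinate [z] can be removed from it. *)
Lemma spin_image g (x0 : Mat) : spin_group V g -> mx_in I (g - 1%:M) -> g *m w o = x0 *m g ->
  exists x y z, [/\ x0 = cvec x y z, congr_w0 x y, I z, with_e0 = false -> z = 0 &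
    qform x y z = 0 /\ forall K, is_ideal K -> (forall i, K (x i)) ->
      (forall i, K (y i)) -> K 1].
Proof.
move=> [h [_ gh hg Vg _]] Ig gx.
have x0E : x0 = g *m w o *m h by rewrite gx -mulmxA gh mulmx1.
have [x [y [z [z0 xE]]]] : exists x y z, (with_e0 = false -> z = 0) /\
    g *m w o *m h = cvec x y z by apply: spin_cvec => //; apply: clifford_wedge.
have [x' [y' [z' [_ xE']]]] : exists x y z, (with_e0 = false -> z = 0) /\
    g *m c o *m h = cvec x y z by apply: spin_cvec => //; apply: clifford_contr.
have := mx_in_conj (w o) gh Ig; rewrite xE (wedge_cvec R o) => /cvec_congr[Ix Iy Iz].
have q0 : qform x y z = 0.
  apply: (@spinor_scalar_inj _ l); rewrite -cvec_sq -xE -!mulmxA (mulmxA h g) hg mul1mx.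
  by rewrite (mulmxA (w o)) wedge_sq mul0mx mulmx0 raddf0.
exists x, y, z; split=> //.
- by rewrite x0E.
- by split=> // i; have := Iy i; rewrite subr0.
- by move: Iz; rewrite subr0.
split=> // K idK Kx Ky.
have conjM u v : (g *m u *m h) *m (g *m v *m h) = g *m (u *m v) *m h.
  by rewrite !mulmxA -(mulmxA _ h g) hg mulmx1.
have e1 : \sum_i (x' i * y i + y' i * x i) + z' * (z * 2) = 1.
  apply: (@spinor_scalar_inj _ l); rewrite -anti_cvec2 -xE -xE' !conjM.
  by rewrite -mulmxDl -mulmxDr wedge_contr eqxx natr_bool mulmx1 gh.
have Kz2 : K (z ^+ 2).
  have -> : z ^+ 2 = - \sum_i x i * y i.
    by apply/eqP; rewrite -addr_eq0 addrC -/(qform x y z) q0.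
  by apply: idealN => //; apply: ideal_sum => // i _; apply: idealMl.
have Ke : K (1 - z' * (z * 2)).
  rewrite -[X in X - _]e1 addrK; apply: ideal_sum => // i _.
  by apply: idealD => //; apply: idealMl.
have -> : 1 = (1 - z' * (z * 2)) * (1 + z' * (z * 2)) + (4 * z' ^+ 2) * z ^+ 2 :> R.
  by ring.
by apply: idealD => //; [apply: idealMr|apply: idealMl].
Qed.

Lemma moves_BD g (x0 : Mat) : JSR_on I 'I_l -> SR_on I 'I_l ->
  spin_group V g -> mx_in I (g - 1%:M) -> conj_act g (w o) x0 ->
  exists u v, [/\ conj_reach UP x0 u, conj_reach UN u v &
    exists r W, [/\ I r, VM W & conj_act (z_mx r *m W) (w o) v]].
Proof.
move=> jsr sr Gg Ig /(spin_image Gg Ig)[x [y [z [-> cx Iz z0 [q0 gen]]]]].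
exact: moves_spin.
Qed.

Lemma stabilizer_BD g : spin_group V g -> mx_in I (g - 1%:M) -> conj_act g (w o) (w o) ->
  exists2 s, U SPos s & spin_group V (s *m g) ->
    spin_group (clifford_vectors with_e0 [set i | i != o]) (s *m g).
Proof.
move=> Gg Ig gw.
have [h [_ gh hg Vg _]] := Gg.
have [x [y [z [z0 xE]]]] : exists x y z, (with_e0 = false -> z = 0) /\
    g *m c o *m h = cvec x y z by apply: spin_cvec => //; apply: clifford_contr.
have := mx_in_conj (c o) gh Ig; rewrite xE {1}(contr_cvec R o).
move=> /cvec_congr[Ix Iy Iz].
have gc : g *m c o = cvec x y z *m g by rewrite -xE -[RHS]mulmxA hg mulmx1.
have [||s Us /= [dw dc]] := stabilizer_spin gh gw gc _ Iy _ z0.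
- by move=> i; have := Ix i; rewrite subr0.
- by move: Iz; rewrite subr0.
exists s => // Gsg; apply: (@spin_centraliser R l with_e0 o i1) => //.
exact: neq_sym.
Qed.

End Subgroups.
End SpinMoves.

(** * Types B and D *)

Lemma unipotent_subgroup_closed (R : comPzRingType) X l (I : set R)
    (Sigma : set 'rV[int]_(coord_dim X l)) :
  unipotent_subgroup Sigma I 1%:M /\ forall g h, unipotent_subgroup Sigma I g ->
    unipotent_subgroup Sigma I h -> unipotent_subgroup Sigma I (g *m h).
Proof. by split; [apply: unipotent_subgroup1|apply: unipotent_subgroupM]. Qed.

Lemma congruence_decomposition_B (R : comPzRingType) (l : nat) (I : set R) amax :
  is_ideal I -> (3 <= l)%N -> highest_root (X := TypeB) (l := l) amax ->
  asr_le I (l - 1)%N ->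
  decomposes_at (X := TypeB) (l := l) I amax.
Proof.
move=> idI l3 hmax asrI; have l1 : (1 < l)%N by apply: ltnW.
pose o : 'I_l := Ordinal (ltnW l1); pose i1 : 'I_l := Ordinal l1.
have [Pmax _] := hmax.
have amaxE : amax = evec l o + evec l i1 by apply: (highest_root_BD _ hmax l1); left.
have o0 : o = 0%N :> nat by []. have i11 : i1 = 1%N :> nat by [].
have oi1 : o != i1 by [].
have cardl : #|'I_l| = (l - 1).+1 by rewrite card_ord; lia.
have PhiE a : root_system TypeB l a -> D_roots a \/ true /\ short_axis_roots a.
  by case; [left|right].
have rvP := spin_root_vectors_B R l.
have rootsP := @spin_rootsP true l l3 o i1 o0 i11.
have zE (r : R) : z_elt (X := TypeB) (l := l) (- amax) r 1 = z_mx o i1 r.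
  by rewrite /z_elt opprK /root_unipotent amaxE /z_mx -(rv_sum rvP) // -(rv_opp rvP).
have supp : coord_support (Delta1 TypeB l) = [set i | i != o].
  exact: (@coord_support_BD true l l3 o i1 o0 i11).
have sgG : is_subgroup (X := TypeB) (l := l) (chevalley_group R TypeB l).
  exact: spin_group_closed.
have rsq := spin_root_sq rvP PhiE.
have Groot := spin_root rvP PhiE.
have Uclosed := @unipotent_subgroup_closed R TypeB l I.
have Ugen (Sigma : set 'rV[int]_l) a s := @unipotent_subgroup_gen R TypeB l I Sigma a s.
have Uinv (Sigma : set 'rV[int]_l) g :=
  @unipotent_subgroup_inv R TypeB l I idI rsq Sigma g.
apply: (@congruence_decomposition R TypeB l I idI amax
  _ _ _ _ _ _ (@conj_act R l) (wedge R o)) => //.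
- by move=> g; rewrite /chevalley_group_Delta1 /= supp; apply: spin_sub.
- exact: conj_actM.
- exact: conj_actV.
- move=> g [[h [_ gh hg _ _]] _]; exists (g *m wedge R o *m h).
  by rewrite /conj_act -[RHS]mulmxA hg mulmx1.
- move=> g x [Gg Ig] gx.
  have [u [v [r1 r2 [r [W [Ir VW zW]]]]]] := moves_BD idI rvP oi1 Uclosed Ugen Uinv
    (@positive_root_sub TypeB l) (@negative_root_sub TypeB l)
    rootsP (JSR_onP idI asrI cardl) (asr_SR_onP idI asrI cardl) Gg Ig gx.
  by exists u, v; split=> //; exists r, W; rewrite zE amaxE.
- move=> g [Gg Ig] gw.
  have [s Us Gs] := stabilizer_BD idI rvP oi1 Uclosed Ugen rootsP Gg Ig gw.
  by exists s => // -[Gsg _]; rewrite /chevalley_group_Delta1 /= supp; apply: Gs.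
Qed.

Lemma congruence_decomposition_D (R : comPzRingType) (l : nat) (I : set R) amax :
  is_ideal I -> (3 <= l)%N -> highest_root (X := TypeD) (l := l) amax ->
  asr_le I (l - 1)%N ->
  decomposes_at (X := TypeD) (l := l) I amax.
Proof.
move=> idI l3 hmax asrI; have l1 : (1 < l)%N by apply: ltnW.
pose o : 'I_l := Ordinal (ltnW l1); pose i1 : 'I_l := Ordinal l1.
have [Pmax _] := hmax.
have amaxE : amax = evec l o + evec l i1 by apply: (highest_root_BD _ hmax l1); right.
have o0 : o = 0%N :> nat by []. have i11 : i1 = 1%N :> nat by [].
have oi1 : o != i1 by [].
have cardl : #|'I_l| = (l - 1).+1 by rewrite card_ord; lia.
have PhiE a : root_system TypeD l a -> D_roots a \/ false /\ short_axis_roots a.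
  by left.
have rvP := spin_root_vectors_D R l.
have rootsP := @spin_rootsP false l l3 o i1 o0 i11.
have zE (r : R) : z_elt (X := TypeD) (l := l) (- amax) r 1 = z_mx o i1 r.
  by rewrite /z_elt opprK /root_unipotent amaxE /z_mx -(rv_sum rvP) // -(rv_opp rvP).
have supp : coord_support (Delta1 TypeD l) = [set i | i != o].
  exact: (@coord_support_BD false l l3 o i1 o0 i11).
have sgG : is_subgroup (X := TypeD) (l := l) (chevalley_group R TypeD l).
  exact: spin_group_closed.
have rsq := spin_root_sq rvP PhiE.
have Groot := spin_root rvP PhiE.
have Uclosed := @unipotent_subgroup_closed R TypeD l I.
have Ugen (Sigma : set 'rV[int]_l) a s := @unipotent_subgroup_gen R TypeD l I Sigma a s.
have Uinv (Sigma : set 'rV[int]_l) g :=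
  @unipotent_subgroup_inv R TypeD l I idI rsq Sigma g.
apply: (@congruence_decomposition R TypeD l I idI amax
  _ _ _ _ _ _ (@conj_act R l) (wedge R o)) => //.
- by move=> g; rewrite /chevalley_group_Delta1 /= supp; apply: spin_sub.
- exact: conj_actM.
- exact: conj_actV.
- move=> g [[h [_ gh hg _ _]] _]; exists (g *m wedge R o *m h).
  by rewrite /conj_act -[RHS]mulmxA hg mulmx1.
- move=> g x [Gg Ig] gx.
  have [u [v [r1 r2 [r [W [Ir VW zW]]]]]] := moves_BD idI rvP oi1 Uclosed Ugen Uinv
    (@positive_root_sub TypeD l) (@negative_root_sub TypeD l)
    rootsP (JSR_onP idI asrI cardl) (asr_SR_onP idI asrI cardl) Gg Ig gx.
  by exists u, v; split=> //; exists r, W; rewrite zE amaxE.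
- move=> g [Gg Ig] gw.
  have [s Us Gs] := stabilizer_BD idI rvP oi1 Uclosed Ugen rootsP Gg Ig gw.
  by exists s => // -[Gsg _]; rewrite /chevalley_group_Delta1 /= supp; apply: Gs.
Qed.

Theorem theorem4 (X : classical_type) (l : nat) (R : comPzRingType) (I : set R)
    (amax : 'rV[int]_(coord_dim X l)) :
  is_ideal I ->
  highest_root amax ->
  (X = TypeA /\ (2 <= l)%N /\ sr_le I l) \/
  (X = TypeC /\ (2 <= l)%N /\ sr_le I (2 * l - 1)%N) \/
  ((X = TypeB \/ X = TypeD) /\ (3 <= l)%N /\ asr_le I (l - 1)%N) ->
  congruence_subgroup (chevalley_group R X l) I =
    unipotent_subgroup (positive_roots X l) I
    :*m: unipotent_subgroup (negative_roots X l) I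
    :*m: Z_set amax I
    :*m: unipotent_subgroup (Sigma1_neg X l `\ (- amax)) I
    :*m: unipotent_subgroup (Sigma1_pos X l) I
    :*m: congruence_subgroup (chevalley_group_Delta1 R X l) I.
Proof.
move=> idI hmax hyp; move: amax hmax.
case: hyp => [[-> [l2 srI]]|[[-> [l2 srI]]|[[->|->] [l3 asrI]]]] amax hmax.
- exact: congruence_decomposition_A.
- exact: congruence_decomposition_C.
- exact: congruence_decomposition_B.
- exact: congruence_decomposition_D.
Qed.
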